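(* For each $n$ let $A_n$ be the adjacency matrix of a stochastic block model on $n$ vertices with $d=d(n)$ classes $V_1,\dots,V_d$ of sizes $n_1,\dots,n_d$ and edge probabilities $p_{kl}=p_{lk}$ (depending on $n$), $1\le k,l\le d$, satisfying: (i) $\frac{n_k}n\to\alpha_k\in[0,\infty)$ for each $k$; (ii) the diagonal elements of $A_n$ are $0$; the entries in the block $V_i\times V_i$ are, up to symmetry, independent Bernoulli random variables with parameter $p_{ii}$; the entries in the block $V_k\times V_l$, $k\ne l$, are independent Bernoulli random variables with parameter $p_{kl}$ (all entries being independent up to symmetry); (iii) with $p=\sup_{ij}p_{ij}$, $p=\omega(1/n)$ and $\sup_np<1$; (iv) with $\sigma^2:=p(1-p)$, $\lim_{n\to\infty}\frac{p_{ij}(1-p_{ij})}{\sigma^2}=s_{ij}\in[0,1]$ for some constants $s_{ij}$. Assume $p\to0$ and $d\to\infty$ as $n\to\infty$. Then the empirical spectral distribution of $\frac{A_n}{\sigma\sqrt n}$ converges almost surely to a probability measure $\mu$ if one of the following extra conditions holds: (1) $\sum_{i=1}^\infty\alpha_i=1$ and $\alpha_1\ge\alpha_2\ge\cdots\ge0$; or (2) $\sum_{i=1}^\infty\alpha_i=\alpha<1$, $\alpha_1\ge\alpha_2\ge\cdots\ge0$; also, for any two small classes $V_k,V_l$, $k\ne l$, $s_{kl}=s_0$ for some constant $s_0$, and for any large class $V_k$ and small class $V_l$, $s_{kl}=s_{k0}$ for some constant $s_{k0}$.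
   Context: The vertex set $[n]$ is partitioned into classes $V_1,\dots,V_d$ with $|V_i|=n_i$, $\sum_in_i=n$, $V_i=\{m_{i-1}+1,\dots,m_i\}$, $m_0=0$, $m_i=\sum_{j\le i}n_j$. A class $V_i$ is small if $\frac{n_i}n\to\alpha_i=0$, and large (big) if $\frac{n_i}n\to\alpha_i>0$. $p=\omega(1/n)$ means $np\to\infty$. The empirical spectral distribution of an $n\times n$ Hermitian matrix $A$ with eigenvalues $\lambda_1,\dots,\lambda_n$ is $F^A(x)=\frac1n\sum_{i=1}^n\mathbf 1_{\{\lambda_i\le x\}}$. All $A_n$ are defined on a common probability space, and almost sure convergence means that almost surely the empirical spectral distributions converge weakly to $\mu$.
   Formalization: In (2), limits at fixed indices alone make the claim false; it is also assumed that classes V_{k(n)} with k(n)→∞ are small, and that p_kl(1-p_kl)/σ² tends to s_0 (two distinct small classes) or s_{k0} (large V_k, small class) along classes V_{k(n)} of varying index too. *)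

(* Defs.v *)
From HB Require Import structures.
From mathcomp Require Import all_boot all_order all_algebra.
From mathcomp Require Import all_classical all_reals all_analysis.
Set Implicit Arguments.
Unset Strict Implicit.
Unset Printing Implicit Defensive.
Import Order.TTheory GRing.Theory Num.Theory.
Import numFieldNormedType.Exports.
Local Open Scope classical_set_scope.
Local Open Scope ring_scope.

(* Vertices and classes are numbered from 0; class k consists of sz k
   consecutive vertices. *)
Definition class_start (sz : nat -> nat) (k : nat) : nat :=
  (\sum_(j < k) sz j)%N.

Definition in_class (sz : nat -> nat) (k i : nat) : bool :=
  (class_start sz k <= i < class_start sz k.+1)%N.

Section Independence.
Context d (T : measurableType d) (R : realType) (P : probability T R).
Context d' (T' : measurableType d') (I : finType).

Definition mutually_independent (D : {set I}) (X : I -> {RV P >-> T'}) : Prop :=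
  forall (J : {set I}) (B : I -> set T'), J \subset D ->
    (forall i, measurable (B i)) ->
    P (\bigcap_(i in [set` J]) (X i @^-1` B i)) =
    (\prod_(i in J) P (X i @^-1` B i))%E.

End Independence.

Section StochasticBlockModel.
Context d (T : measurableType d) (R : realType) (P : probability T R).

Definition adjacency n (X : 'I_n -> 'I_n -> {RV P >-> bool}) (w : T) : 'M[R]_n :=
  \matrix_(i, j) (X i j w)%:R.

(* X i j is the indicator of the edge {i, j} of a random graph on n vertices
   with c classes of sizes sz and edge probabilities q. *)
Record stochastic_block_model (n c : nat) (sz : nat -> nat)
    (q : nat -> nat -> R) (X : 'I_n -> 'I_n -> {RV P >-> bool}) : Prop := {
  sbm_sizes : (\sum_(k < c) sz k)%N = n;
  sbm_prob : forall k l, (k < c)%N -> (l < c)%N -> 0 <= q k l <= 1;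
  sbm_prob_sym : forall k l, (k < c)%N -> (l < c)%N -> q k l = q l k;
  sbm_diag : forall i w, X i i w = false;
  sbm_sym : forall i j w, X i j w = X j i w;
  sbm_bernoulli : forall k l (i j : 'I_n), (k < c)%N -> (l < c)%N -> i != j ->
    in_class sz k i -> in_class sz l j ->
    forall B : set bool, distribution P (X i j) B = bernoulli_prob (q k l) B;
  sbm_indep : mutually_independent
    [set ij : 'I_n * 'I_n | (ij.1 < ij.2)%N]%SET (fun ij => X ij.1 ij.2) }.

End StochasticBlockModel.

Section LimitingSpectrum.
Variable R : realType.

Definition max_prob (c : nat) (q : nat -> nat -> R) : R :=
  sup [set x | exists k l, [/\ (k < c)%N, (l < c)%N & x = q k l]].

Definition sigma (c : nat) (q : nat -> nat -> R) : R :=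
  Num.sqrt (max_prob c q * (1 - max_prob c q)).

Definition variance_ratio (c : nat) (q : nat -> nat -> R) (k l : nat) : R :=
  q k l * (1 - q k l) / sigma c q ^+ 2.

Definition class_fraction (sz : nat -> nat -> nat) (n k : nat) : R :=
  (sz n k)%:R / n%:R.

Definition condition1 (alpha : nat -> R) : Prop :=
  nonincreasing_seq alpha /\ series alpha @ \oo --> (1 : R).

(* As the number c n of classes grows, a class is a choice of an index k n < c n
   for each (large) n; constant k are the classes with a fixed index. *)
Definition is_class (c : nat -> nat) (k : nat -> nat) : Prop :=
  \forall n \near \oo, (k n < c n)%N.

Definition small_class (c : nat -> nat) (sz : nat -> nat -> nat)
    (k : nat -> nat) : Prop :=
  is_class c k /\ class_fraction sz n (k n) @[n --> \oo] --> (0 : R).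

(* The first four clauses are about fixed indices. The mass 1 - sum alpha is
   carried by classes whose index tends to infinity, on which limits at fixed
   indices give no information: the last three clauses say that such classes
   are small, and that the conditions on small classes hold for them too.
   Without these clauses the spectral distributions need not converge: take
   n classes of size 1, with q n k l = (n+2)^(-1/2) if k, l <= ln n or n is even,
   and q n k l = 0 otherwise; then alpha = 0 and all s k l are 1. *)
Record condition2 (c : nat -> nat) (sz : nat -> nat -> nat)
    (q : nat -> nat -> nat -> R) (alpha : nat -> R) (s : nat -> nat -> R)
    (s0 : R) (sk0 : nat -> R) : Prop := {
  cond2_sum : exists2 a : R, a < 1 & series alpha @ \oo --> a;
  cond2_mono : nonincreasing_seq alpha;
  cond2_small : forall k l, k != l -> alpha k = 0 -> alpha l = 0 -> s k l = s0;
  cond2_large : forall k l, 0 < alpha k -> alpha l = 0 -> s k l = sk0 k;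
  cond2_tail : forall k : nat -> nat, is_class c k -> k @ \oo --> \oo ->
    small_class c sz k;
  cond2_small_lim : forall k l : nat -> nat,
    small_class c sz k -> small_class c sz l ->
    (\forall n \near \oo, k n != l n) ->
    variance_ratio (c n) (q n) (k n) (l n) @[n --> \oo] --> s0;
  cond2_large_lim : forall (k : nat) (l : nat -> nat),
    0 < alpha k -> small_class c sz l ->
    variance_ratio (c n) (q n) k (l n) @[n --> \oo] --> sk0 k }.

(* Eigenvalues with algebraic multiplicity; the default value [::] is not
   reached for symmetric matrices, whose characteristic polynomial splits. *)
Definition eigenvalues n (A : 'M[R]_n) : seq R :=
  xget [::] [set r : seq R | char_poly A = \prod_(a <- r) ('X - a%:P)].

(* Empirical spectral distribution function. *)
Definition esd n (A : 'M[R]_n) (x : R) : R :=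
  (count (fun a => a <= x) (eigenvalues A))%:R / n%:R.

(* Weak convergence, for distribution functions: x is a continuity point of
   the distribution function of mu iff mu [set x] = 0. *)
Definition converges_weakly (F : nat -> R -> R)
    (mu : probability (measurableTypeR R) R) : Prop :=
  forall x : R, mu [set x] = 0%E ->
    F n x @[n --> \oo] --> fine (mu `]-oo, x]%classic).

End LimitingSpectrum.

(* Main.v *)
Require Import Defs.
From HB Require Import structures.
From mathcomp Require Import all_boot all_order all_algebra.
From mathcomp Require Import all_classical all_reals all_analysis.
From mathcomp Require complex.
From mathcomp Require Import ring lra zify.
Import Order.TTheory GRing.Theory Num.Theory.
Import numFieldNormedType.Exports.
Local Open Scope classical_set_scope.
Local Open Scope ring_scope.

(* Write B for the centered matrix (A - E A) / (sigma sqrt n) and tr h for the trace of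
   h of a matrix.

   Perturbation. If (u_i), (v_j) are eigenbases of two symmetric matrices, the weights
   |<u_i, v_j>|^2 are doubly stochastic, and sum_ij |<u_i, v_j>|^2 (lam_i - mu_j)^2 is the
   squared Frobenius distance. Hence tr h / n changes little for a smooth h when the
   Frobenius norm of the perturbation is o(sqrt n), which lets E A be removed because
   p -> 0, and changes by O(1 / (n sqrt (n p))) when one edge is flipped.

   Concentration. Averaging out one edge after the other, the flip bound gives a fourth
   central moment of tr h / n of order n^-2, hence almost sure convergence to the mean
   whatever the joint law of the A_n is.

   Moments. E tr B^k / n is a sum over closed walks, grouped by the equality pattern of
   their vertices. By |b_ij| <= 1 / (sigma sqrt n) -> 0 and E b_ij^2 <= 1/n, the only
   patterns that survive have v = e + 1 vertices for e edges, each traversed twice; their contribution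
   is a homomorphism density of the variance profile. There are at most 2^k of them, as a
   walk around a tree is determined by which steps discover a vertex, so the limit
   moments determine their measure (Bernstein polynomials). Both conditions (1) and (2)
   make the profile an L^1 limit of step kernels with finitely many steps, along which
   homomorphism densities converge. *)

Set Implicit Arguments.
Unset Strict Implicit.
Unset Printing Implicit Defensive.

(** * Spectra of symmetric matrices *)

Section SymmetricSpectrum.
Import spectral complex sesquilinear.
Variable R : realType.
Local Notation C := R[i].
Local Open Scope sesquilinear_scope.
Local Open Scope complex_scope.

(** The test functions serve three estimates, which is why they have a bounded Lipschitz derivative:
    removing the mean and approximating by Bernstein polynomials use a modulus of continuity
    [e + C (y - x)^2], the flip of an edge uses the Taylor remainder itself.

    Concentration must keep the factor p. Increments of order [eta / n] in n^2 coordinates of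
    parameter at most p, with [n p eta^2 <= 2], have total variance of order 1/n, which is not
    summable; this is the reason for the fourth moment.

    Expectations are finite sums over configurations in a power of [bool]. The given probability
    space enters through upper bounds on events that are finite unions of configurations.

    Condition (2) concerns sequences of classes, whereas a step kernel needs estimates uniform over
    all classes beyond a fixed index. A contradiction argument bridges the two; the remaining
    classes can then be merged into one step although they keep positive mass.

    The limit law is not identified. Its distribution function is an infimum of limits along ramps
    with rational ends, a countable family, so that one null set serves for all of them. *)

Definition complexify n (A : 'M[R]_n) : 'M[C]_n := map_mx (real_complex R) A.

Lemma conj_real_complex (x : R) : ((x%:C)^*)%R = x%:C :> C.
Proof. by rewrite conj_Creal //; apply/complex_realP; exists x. Qed.

Lemma adjmx_mul m n p (A : 'M[C]_(m, n)) (B : 'M[C]_(n, p)) :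
  (A *m B)^t* = B^t* *m A^t*.
Proof. by rewrite trmx_mul map_mxM. Qed.

Lemma adjmxK m n (A : 'M[C]_(m, n)) : (A^t*)^t* = A.
Proof. by apply/matrixP => i j; rewrite !mxE conjCK. Qed.

Lemma unitary_mulr n (U : 'M[C]_n) : U \is unitarymx -> U *m U^t* = 1%:M.
Proof. by move/unitarymxP. Qed.

Lemma symmetric_spectral n (A : 'M[R]_n) : A^T = A ->
  exists (U : 'M[C]_n) (lam : 'I_n -> R), U \is unitarymx /\
    complexify A = U^t* *m diag_mx (\row_i (lam i)%:C) *m U.
Proof.
move=> symA; set B := complexify A.
have hermB : B \is hermsymmx.
  apply/is_hermitianmxP; rewrite expr0 scale1r; apply/matrixP => i j.
  by rewrite !mxE conj_real_complex -[in RHS](symA) mxE.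
have /hermitian_normalmx/orthomx_spectralP := hermB.
have := hermitian_spectral_diag_real hermB.
have := spectral_unitarymx B.
set U := spectralmx B; set D := spectral_diag B => unitU /mxOverP realD eqB.
exists U, (fun i => complex.Re (D 0 i)); split=> //.
have -> : \row_i (complex.Re (D 0 i))%:C = D by apply/rowP => i; rewrite mxE RRe_real.
rewrite -(invmx_unitary unitU); exact: eqB.
Qed.

Lemma char_poly_unitary n (U D : 'M[C]_n) : U \is unitarymx ->
  char_poly (U^t* *m D *m U) = char_poly D.
Proof.
move=> unitU; have UU : U^t* *m U = 1%:M.
  exact/mulmx1C/unitary_mulr.
rewrite /char_poly.
have -> : char_poly_mx (U^t* *m D *m U) =
    map_mx polyC (U^t*) *m char_poly_mx D *m map_mx polyC U.
  rewrite /char_poly_mx mulmxBr mulmxBl -!map_mxM; congr (_ - _).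
  rewrite scalar_mxC -mulmxA -map_mxM UU map_mx1 mulmx1 //.
rewrite !det_mulmx mulrAC -det_mulmx -map_mxM UU map_mx1 det1 mul1r //.
Qed.

Lemma eigenvalues_spectral n (A : 'M[R]_n) (U : 'M[C]_n) (lam : 'I_n -> R) :
  U \is unitarymx -> complexify A = U^t* *m diag_mx (\row_i (lam i)%:C) *m U ->
  perm_eq (eigenvalues A) [seq lam i | i <- enum 'I_n].
Proof.
move=> unitU eqA.
have eqch : char_poly A = \prod_(a <- [seq lam i | i <- enum 'I_n]) ('X - a%:P).
  apply: (@map_poly_inj _ _ (real_complex R)); rewrite map_char_poly.
  rewrite -/(complexify A) eqA char_poly_unitary // char_poly_trig; last first.
    exact/diag_mx_is_trig.
  rewrite rmorph_prod /= big_map big_enum /=; apply: eq_bigr => i _.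
  by rewrite !mxE eqxx mulr1n rmorphB /= map_polyX map_polyC.
rewrite /eigenvalues; case: xgetP => [r _ /= eqr|/(_ _ eqch) //].
by apply: prod_XsubC_eq; rewrite -eqr.
Qed.

Definition eigsum n (h : R -> R) (A : 'M[R]_n) : R := \sum_(a <- eigenvalues A) h a.

Lemma eigsumE n (A : 'M[R]_n) (U : 'M[C]_n) (lam : 'I_n -> R) h :
  U \is unitarymx -> complexify A = U^t* *m diag_mx (\row_i (lam i)%:C) *m U ->
  eigsum h A = \sum_i h (lam i).
Proof.
move=> unitU eqA; rewrite /eigsum (perm_big _ (eigenvalues_spectral unitU eqA)).
by rewrite big_map big_enum.
Qed.

Lemma size_eigenvalues n (A : 'M[R]_n) : A^T = A -> size (eigenvalues A) = n.
Proof.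
case/symmetric_spectral => U [lam [unitU eqA]].
by rewrite (perm_size (eigenvalues_spectral unitU eqA)) size_map size_enum_ord.
Qed.

(* The ring structure, hence A ^+ k, exists only for sizes of the form n.+1. *)
Fixpoint mxpow n (A : 'M[R]_n) k : 'M[R]_n :=
  if k is k'.+1 then A *m mxpow A k' else 1%:M.

Lemma eigsum_pow n (A : 'M[R]_n) k : A^T = A ->
  eigsum (fun x => x ^+ k) A = \tr (mxpow A k).
Proof.
case/symmetric_spectral => U [lam [unitU eqA]].
rewrite (eigsumE _ unitU eqA); apply: (@complexI R).
have UU := unitary_mulr unitU.
have UU' : U^t* *m U = 1%:M by apply: mulmx1C.
have powE : complexify (mxpow A k) =
   U^t* *m diag_mx (\row_i ((lam i) ^+ k)%:C) *m U.
  elim: k => [|k IHk] /=.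
    rewrite /complexify map_mx1; suff -> : diag_mx (\row_i ((lam i) ^+ 0)%:C) = 1%:M.
      by rewrite mulmx1 UU'.
    by apply/matrixP => i j; rewrite !mxE expr0.
  rewrite /complexify map_mxM -!/(complexify _) eqA IHk.
  rewrite -!mulmxA (mulmxA U) UU mul1mx (mulmxA (diag_mx _)) mulmx_diag.
  congr (_ *m (diag_mx _ *m _)); apply/rowP => i.
  by rewrite !mxE exprS rmorphM.
transitivity (\tr (complexify (mxpow A k))); last first.
  by rewrite /complexify -trace_map_mx.
rewrite powE -mulmxA mxtrace_mulC -mulmxA UU mulmx1 mxtrace_diag rmorph_sum.
by apply: eq_bigr => i _; rewrite mxE.
Qed.


(** The norm on [R[i]] is itself [R[i]]-valued, whereas the weights of the coupling have to be
    real. *)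
Definition cabs (z : C) : R := complex.Re `|z|.

Lemma cabsE z : (cabs z)%:C = `|z|. Proof. by rewrite RRe_real // normr_real. Qed.

Lemma cabs_ge0 z : 0 <= cabs z. Proof. by rewrite -ler0c cabsE. Qed.

Lemma cabsM z t : cabs (z * t) = cabs z * cabs t.
Proof. by apply: (@complexI R); rewrite rmorphM /= !cabsE normrM. Qed.

Lemma norm_real_complex (x : R) : `|x%:C| = `|x|%:C :> C.
Proof. by rewrite normc_def /= expr0n addr0 sqrtr_sqr. Qed.

Lemma cabs_real (x : R) : cabs x%:C = `|x|.
Proof. by apply: (@complexI R); rewrite cabsE norm_real_complex. Qed.

Lemma unitary_row_norm n (W : 'M[C]_n) : W \is unitarymx ->
  forall i, \sum_j cabs (W i j) ^+ 2 = 1.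
Proof.
move=> /unitarymxP WW i; apply: (@complexI R); rewrite rmorph_sum /=.
move: WW => /matrixP/(_ i i); rewrite !mxE eqxx /= => WWi; rewrite -[RHS]WWi.
by apply: eq_bigr => j _; rewrite rmorphXn /= cabsE !mxE normCK.
Qed.

Lemma unitary_col_norm n (W : 'M[C]_n) : W \is unitarymx ->
  forall j, \sum_i cabs (W i j) ^+ 2 = 1.
Proof.
move=> unitW j; have unitWt : W^T \is unitarymx by rewrite trmx_unitary.
rewrite -[RHS](unitary_row_norm unitWt j).
by apply: eq_bigr => i _; rewrite mxE.
Qed.

Lemma frobenius_unitary n (U V : 'M[C]_n) (A : 'M[R]_n) :
  U \is unitarymx -> V \is unitarymx ->
  \sum_i \sum_j cabs ((U *m complexify A *m V^t*) i j) ^+ 2 =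
  \sum_i \sum_j A i j ^+ 2.
Proof.
move=> /unitarymxP UU /unitarymxP VV; set M := U *m _ *m _.
have trE (N : 'M[C]_n) : (\sum_i \sum_j cabs (N i j) ^+ 2)%:C = \tr (N *m N^t*).
  rewrite rmorph_sum; apply: eq_bigr => i _; rewrite rmorph_sum mxE.
  by apply: eq_bigr => j _; rewrite rmorphXn /= cabsE !mxE normCK.
apply: (@complexI R); rewrite trE.
have -> : M *m M^t* = U *m (complexify A *m (complexify A)^t*) *m U^t*.
  rewrite /M !adjmx_mul adjmxK.
  rewrite !mulmxA -[X in X *m _ *m _ = _]mulmxA.
  by rewrite (mulmx1C VV) mulmx1.
rewrite -mulmxA mxtrace_mulC -!mulmxA (mulmx1C UU) mulmx1.
rewrite -trE; congr (_%:C); apply: eq_bigr => i _; apply: eq_bigr => j _.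
apply: (@complexI R); rewrite rmorphXn /= cabsE mxE normCK conj_real_complex.
by rewrite -rmorphM.
Qed.

(* The weights |<u_i, v_j>|^2 between two orthonormal eigenbases are doubly
   stochastic; they play the role of the optimal matching of the
   Hoffman-Wielandt inequality. *)
Lemma spectral_coupling n (A B : 'M[R]_n) : A^T = A -> B^T = B ->
  exists (lam mu : 'I_n -> R) (p : 'I_n -> 'I_n -> R),
  [/\ (forall h, eigsum h A = \sum_i h (lam i)) /\
        (forall h, eigsum h B = \sum_i h (mu i)),
      forall i j, 0 <= p i j,
      (forall i, \sum_j p i j = 1) /\ (forall j, \sum_i p i j = 1),
      \sum_i \sum_j p i j * (lam i - mu j) ^+ 2 =
        \sum_i \sum_j (A i j - B i j) ^+ 2 &
      \sum_i `|\sum_j p i j * (mu j - lam i)| <=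
        \sum_i \sum_j `|A i j - B i j| ].
Proof.
case/symmetric_spectral => U [lam [unitU eqA]].
case/symmetric_spectral => V [mu [unitV eqB]].
have UU := unitary_mulr unitU.
have VV := unitary_mulr unitV.
pose W := U *m V^t*.
have unitVt : V^t* \is unitarymx by rewrite trmxC_unitary.
have unitW : W \is unitarymx := mul_unitarymx unitU unitVt.
exists lam, mu, (fun i j => cabs (W i j) ^+ 2); split.
- by split=> h; [exact: eigsumE eqA | exact: eigsumE eqB].
- by move=> i j; rewrite exprn_ge0 // cabs_ge0.
- by split; [exact: unitary_row_norm | exact: unitary_col_norm].
- have := frobenius_unitary (A - B) unitU unitV.
  under [in X in _ = X -> _]eq_bigr => i _ do under eq_bigr => j _ do rewrite !mxE.
  move=> <-; apply: eq_bigr => i _; apply: eq_bigr => j _.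
  have -> : U *m complexify (A - B) *m V^t* =
      diag_mx (\row_i (lam i)%:C) *m W - W *m diag_mx (\row_i (mu i)%:C).
    rewrite /complexify map_mxB -!/(complexify _) eqA eqB mulmxBr mulmxBl /W.
    rewrite !mulmxA UU mul1mx; congr (_ - _).
    by rewrite -!mulmxA VV mulmx1 !mulmxA.
  have -> : (diag_mx (\row_i (lam i)%:C) *m W - W *m diag_mx (\row_i (mu i)%:C)) i j
      = (lam i - mu j)%:C * W i j.
    move: (W) => W'; rewrite mul_diag_mx mul_mx_diag !mxE [W' i j * _]mulrC.
    by rewrite -mulrBl -rmorphB.
  by rewrite cabsM cabs_real exprMn mulrC real_normK // num_real.
(* The left side is the [i]-th diagonal entry of [B - A] in the eigenbasis of [A]. *)
have key i : (\sum_j cabs (W i j) ^+ 2 * (mu j - lam i))%:C =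
    \sum_a \sum_b U i a * (B a b - A a b)%:C * (U i b)^*%R.
  transitivity ((U *m complexify (B - A) *m U^t*) i i).
    rewrite /complexify map_mxB -!/(complexify _) eqB eqA mulmxBr mulmxBl.
    have -> : U *m (V^t* *m diag_mx (\row_i (mu i)%:C) *m V) *m U^t* =
       W *m diag_mx (\row_i (mu i)%:C) *m W^t*.
      by rewrite /W adjmx_mul adjmxK !mulmxA.
    rewrite !mulmxA UU mul1mx -[_ *m U *m _]mulmxA UU mulmx1.
    have := unitary_row_norm unitW i; move: (W) => W' rowW'.
    rewrite !mxE eqxx mulr1n rmorph_sum /= -[X in _ - X%:C]mul1r -rowW'.
    rewrite mulr_suml rmorph_sum -sumrB /=; apply: eq_bigr => j _.
    rewrite mul_mx_diag !mxE mulrBr rmorphB /= mulrAC !rmorphM.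
    by congr (_ - _); rewrite [RHS]mulrAC -normCK -cabsE expr2 mulrAC.
  rewrite !mxE exchange_big /=; apply: eq_bigr => b _.
  rewrite !mxE mulr_suml; apply: eq_bigr => a _.
  by rewrite !mxE.
(* The product of the moduli of [U i a] and [U i b] is replaced by the mean of their squares, so
   that the sum over [i] can use that the columns of [U] have norm 1. *)
have bound i : `|\sum_j cabs (W i j) ^+ 2 * (mu j - lam i)| <=
   \sum_a \sum_b `|A a b - B a b| * ((cabs (U i a) ^+ 2 + cabs (U i b) ^+ 2) / 2).
  have h : `|\sum_j cabs (W i j) ^+ 2 * (mu j - lam i)| <=
     \sum_a \sum_b `|A a b - B a b| * (cabs (U i a) * cabs (U i b)).
    rewrite -lecR; have -> : `|\sum_j cabs (W i j) ^+ 2 * (mu j - lam i)|%:C =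
        `|(\sum_j cabs (W i j) ^+ 2 * (mu j - lam i))%:C|.
      by rewrite norm_real_complex.
    rewrite key; apply: le_trans (ler_norm_sum _ _ _) _.
    rewrite rmorph_sum; apply: ler_sum => a _.
    apply: le_trans (ler_norm_sum _ _ _) _.
    rewrite rmorph_sum; apply: ler_sum => b _.
    rewrite !normrM norm_conjC !rmorphM /= !cabsE.
    have -> : `|(B a b - A a b)%:C| = `|A a b - B a b|%:C.
      by rewrite norm_real_complex distrC.
    by rewrite mulrA [_ * `|U i a|]mulrC.
  apply: le_trans h _; apply: ler_sum => a _; apply: ler_sum => b _.
  by apply: ler_wpM2l => //; have := sqr_ge0 (cabs (U i a) - cabs (U i b)); nra.
apply: le_trans (ler_sum _ (fun i _ => bound i)) _.
rewrite exchange_big /=; apply: ler_sum => a _.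
rewrite exchange_big /=; apply: ler_sum => b _.
rewrite -mulr_sumr -mulr_suml big_split /= !unitary_col_norm //.
by rewrite -[1 + 1]/2%:R divff ?mulr1 // pnatr_eq0.
Qed.

End SymmetricSpectrum.

(** * Smooth test functions *)

Section TestFunctions.
Variable R : realType.

(** The functions with a bounded Lipschitz derivative, expressed by a Taylor bound so that no
    differentiation is involved. *)
Definition smooth_test (h h' : R -> R) (L K : R) : Prop :=
  (forall x, `|h' x| <= L) /\
  (forall x y, `|h y - h x - h' x * (y - x)| <= K * (y - x) ^+ 2).

Lemma smooth_test_ge0 h h' L K : smooth_test h h' L K -> 0 <= L /\ 0 <= K.
Proof.
move=> [hL hK]; split. by apply: (le_trans _ (hL 0)).
by have := hK 0 1; rewrite subr0 expr1n !mulr1 => h1; apply: (le_trans _ h1).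
Qed.

(** From [v <= e + v^2 / e] with [v = L |y - x|]. A modulus that is quadratic up to [e] can be
    averaged, against a coupling as well as against a binomial law, and only second moments
    appear. *)
Lemma smooth_test_continuity h h' L K e : smooth_test h h' L K -> 0 < e ->
  forall x y, `|h y - h x| <= e + (K + L ^+ 2 / e) * (y - x) ^+ 2.
Proof.
move=> [hL hK] e0 x y; set u := y - x.
have h1 : `|h y - h x| <= L * `|u| + K * u ^+ 2.
  rewrite -[h y - h x](subrK (h' x * u)) addrC.
  apply: le_trans (ler_normD _ _) _; apply: lerD; last exact: hK.
  by rewrite normrM; apply: ler_wpM2r.
apply: le_trans h1 _; rewrite mulrDl addrA [e + _]addrC -addrA addrC lerD2r.
have -> : L ^+ 2 / e * u ^+ 2 = (L * `|u|) ^+ 2 / e.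
  by rewrite exprMn real_normK ?num_real // mulrAC.
set v := L * `|u|; rewrite -subr_ge0.
have -> : e + v ^+ 2 / e - v = (e ^+ 2 + v ^+ 2 - e * v) / e.
  by field; rewrite gt_eqF.
by apply: divr_ge0; [nra | exact: ltW].
Qed.

(** The quadratic modulus averaged over the coupling. As [e] is free, the bound is o(n) once the
    squared Frobenius distance is o(n). *)
Lemma eigsum_perturb_l2 n (A B : 'M[R]_n) h h' L K e : A^T = A -> B^T = B ->
  smooth_test h h' L K -> 0 < e ->
  `|eigsum h A - eigsum h B| <=
    e * n%:R + (K + L ^+ 2 / e) * \sum_i \sum_j (A i j - B i j) ^+ 2.
Proof.
move=> symA symB hh e0.
have [lam [mu [p [[-> ->] p0 [p1 p2] <- _]]]] := spectral_coupling symA symB.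
have -> : \sum_i h (lam i) - \sum_i h (mu i) =
    \sum_i \sum_j p i j * (h (lam i) - h (mu j)).
  under [RHS]eq_bigr => i _ do under eq_bigr => j _ do rewrite mulrBr.
  under [RHS]eq_bigr => i _ do rewrite sumrB -mulr_suml p1 mul1r.
  rewrite sumrB; congr (_ - _); rewrite exchange_big; apply: eq_bigr => j _.
  by rewrite -mulr_suml p2 mul1r.
apply: le_trans (ler_norm_sum _ _ _) _.
have -> : e * n%:R = \sum_i \sum_j p i j * e.
  under eq_bigr => i _ do rewrite -mulr_suml p1 mul1r.
  by rewrite sumr_const card_ord mulr_natr.
rewrite mulr_sumr -big_split; apply: ler_sum => i _ /=.
apply: le_trans (ler_norm_sum _ _ _) _.
rewrite mulr_sumr -big_split; apply: ler_sum => j _ /=.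
rewrite normrM (ger0_norm (p0 _ _)) mulrCA -mulrDr; apply: ler_wpM2l => //.
exact: (smooth_test_continuity hh).
Qed.

(** For a change of two entries the term [e * n] of the previous bound would be far too large. The
    Taylor term at [lam i] only sees the coupling average of [mu j - lam i], which the entrywise
    norm controls. *)
Lemma eigsum_perturb_l1 n (A B : 'M[R]_n) h h' L K : A^T = A -> B^T = B ->
  smooth_test h h' L K ->
  `|eigsum h A - eigsum h B| <=
    L * (\sum_i \sum_j `|A i j - B i j|) + K * \sum_i \sum_j (A i j - B i j) ^+ 2.
Proof.
move=> symA symB hh; have [hL hK] := hh; have [L0 K0] := smooth_test_ge0 hh.
have [lam [mu [p [[-> ->] p0 [p1 p2] <- ple]]]] := spectral_coupling symA symB.
rewrite distrC.
have -> : \sum_i h (mu i) - \sum_i h (lam i) =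
    \sum_i h' (lam i) * (\sum_j p i j * (mu j - lam i)) +
    \sum_i \sum_j p i j * (h (mu j) - h (lam i) - h' (lam i) * (mu j - lam i)).
  rewrite -big_split /=.
  under [RHS]eq_bigr => i _.
    rewrite mulr_sumr -big_split /=.
    under eq_bigr => j _ do
      rewrite mulrCA -mulrDr addrC subrK mulrBr.
    rewrite sumrB -[X in _ - X]mulr_suml p1 mul1r.
  over.
  rewrite sumrB; congr (_ - _); rewrite exchange_big; apply: eq_bigr => j _ /=.
  by rewrite -mulr_suml p2 mul1r.
apply: le_trans (ler_normD _ _) _; apply: lerD.
  apply: le_trans (ler_norm_sum _ _ _) _.
  apply: le_trans _ (ler_wpM2l L0 ple).
  rewrite mulr_sumr; apply: ler_sum => i _; rewrite normrM; exact: ler_wpM2r.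
apply: le_trans (ler_norm_sum _ _ _) _.
rewrite mulr_sumr; apply: ler_sum => i _.
apply: le_trans (ler_norm_sum _ _ _) _.
rewrite mulr_sumr; apply: ler_sum => j _.
rewrite normrM (ger0_norm (p0 _ _)) mulrCA; apply: ler_wpM2l => //.
by apply: le_trans (hK _ _) _; rewrite -sqrrN opprB.
Qed.

Definition pospart (x : R) : R := Num.max x 0.

Lemma pospart_sqr_taylor x y :
  0 <= pospart y ^+ 2 - pospart x ^+ 2 - 2 * pospart x * (y - x) <= (y - x) ^+ 2.
Proof.
have := sqr_ge0 (y - x); have := sqr_ge0 y; have := sqr_ge0 x.
by rewrite /pospart; case: (lerP x 0) => hx; case: (lerP y 0) => hy; nra.
Qed.

(* A C^1 transition from 1 on ]-oo, a] to 0 on [b, +oo[, as a second difference of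
   truncated squares *)
Definition ramp (a b x : R) : R :=
  1 - 2 / (b - a) ^+ 2 * (pospart (x - a) ^+ 2 - 2 * pospart (x - (a + b) / 2) ^+ 2
    + pospart (x - b) ^+ 2).

Definition ramp' (a b x : R) : R :=
  - (2 / (b - a) ^+ 2) * (2 * pospart (x - a) - 2 * (2 * pospart (x - (a + b) / 2))
    + 2 * pospart (x - b)).

Lemma ramp_left a b x : a < b -> x <= a -> ramp a b x = 1.
Proof.
move=> ab xa; rewrite /ramp /pospart !max_r; try lra.
Qed.

Lemma ramp_right a b x : a < b -> b <= x -> ramp a b x = 0.
Proof.
move=> ab xa; rewrite /ramp /pospart !max_l; try lra.
by field; rewrite subr_eq0 gt_eqF.
Qed.

Lemma ramp_bounds a b x : a < b -> 0 <= ramp a b x <= 1.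
Proof.
move=> ab; rewrite /ramp; set t := pospart _ ^+ 2 - _ + _.
have d0 : 0 < (b - a) ^+ 2 by rewrite exprn_gt0 // subr_gt0.
have ht : 0 <= t <= (b - a) ^+ 2 / 2.
  rewrite /t /pospart; case: (lerP (x - a) 0) => h1;
  case: (lerP (x - (a + b) / 2) 0) => h2; case: (lerP (x - b) 0) => h3;
  apply/andP; split; nra.
have : 0 <= 2 / (b - a) ^+ 2 * t <= 1.
  case/andP: ht => t0 t1; apply/andP; split.
    by rewrite mulr_ge0 // divr_ge0 // ltW.
  rewrite mulrAC ler_pdivrMr // mul1r; lra.
lra.
Qed.

Lemma ramp_smooth a b : a < b ->
  exists L K, smooth_test (ramp a b) (ramp' a b) L K.
Proof.
move=> ab; set c := 2 / (b - a) ^+ 2.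
have c0 : 0 <= c by rewrite divr_ge0 // sqr_ge0.
(* [ramp'] is a tent with extreme value [- c (b - a)] at the midpoint. The remainder combines three
   remainders from [[0, (y - x)^2]] with weights 1, -2, 1, hence the factor 2. *)
exists (c * (b - a)), (c * 2); split=> [x|x y].
  rewrite /ramp' -/c normrM normrN (ger0_norm c0); apply: ler_wpM2l => //.
  rewrite ler_norml /pospart; case: (lerP (x - a) 0) => h1;
  case: (lerP (x - (a + b) / 2) 0) => h2; case: (lerP (x - b) 0) => h3; lra.
have ha := pospart_sqr_taylor (x - a) (y - a).
have hb := pospart_sqr_taylor (x - b) (y - b).
have hc := pospart_sqr_taylor (x - (a + b) / 2) (y - (a + b) / 2).
have e z : y - z - (x - z) = y - x by ring.
rewrite !e in ha hb hc.
rewrite /ramp /ramp' -/c.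
set xa := pospart (x - a) in ha *; set xb := pospart (x - b) in hb *.
set xc := pospart (x - (a + b) / 2) in hc *.
set ya := pospart (y - a) in ha *; set yb := pospart (y - b) in hb *.
set yc := pospart (y - (a + b) / 2) in hc *.
set u := y - x in ha hb hc *.
have -> : 1 - c * (ya ^+ 2 - 2 * yc ^+ 2 + yb ^+ 2) -
   (1 - c * (xa ^+ 2 - 2 * xc ^+ 2 + xb ^+ 2)) -
   - c * (2 * xa - 2 * (2 * xc) + 2 * xb) * u =
  - (c * ((ya ^+ 2 - xa ^+ 2 - 2 * xa * u) - 2 * (yc ^+ 2 - xc ^+ 2 - 2 * xc * u)
    + (yb ^+ 2 - xb ^+ 2 - 2 * xb * u))) by ring.
rewrite normrN normrM (ger0_norm c0) -[c * 2 * _]mulrA; apply: ler_wpM2l => //.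
move: ha hb hc.
set A := ya ^+ 2 - _ - _; set B := yb ^+ 2 - _ - _; set D := yc ^+ 2 - _ - _.
by move=> *; rewrite ler_norml; lra.
Qed.

End TestFunctions.

(** * Products of Bernoulli measures *)

Section ProductBernoulli.
Variables (R : realType) (I : finType) (Q : I -> R).
Hypothesis Q01 : forall i, 0 <= Q i <= 1.
Implicit Types (f g : {ffun I -> bool} -> R) (x : {ffun I -> bool}).

Definition bern (q : R) (b : bool) : R := if b then q else 1 - q.

Definition bern_weight x : R := \prod_i bern (Q i) (x i).

Definition Ex f : R := \sum_x bern_weight x * f x.

Lemma bern_ge0 i b : 0 <= bern (Q i) b.
Proof. by have := Q01 i; case: b => /= /andP[]; lra. Qed.

Lemma bern_weight_ge0 x : 0 <= bern_weight x.
Proof. by apply: prodr_ge0 => i _; exact: bern_ge0. Qed.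

Lemma Ex_prod (g : I -> bool -> R) :
  Ex (fun x => \prod_i g i (x i)) = \prod_i (Q i * g i true + (1 - Q i) * g i false).
Proof.
rewrite /Ex (eq_bigr (fun x : {ffun I -> bool} =>
    \prod_i (bern (Q i) (x i) * g i (x i)))); last by move=> x _; rewrite big_split.
rewrite -(bigA_distr_bigA (fun i b => bern (Q i) b * g i b)).
by apply: eq_bigr => i _; rewrite big_bool.
Qed.

Lemma eq_Ex f g : f =1 g -> Ex f = Ex g.
Proof. by move=> e; apply: eq_bigr => x _; rewrite e. Qed.

Lemma ExD f g : Ex (fun x => f x + g x) = Ex f + Ex g.
Proof. by rewrite /Ex -big_split; apply: eq_bigr => x _; rewrite mulrDr. Qed.

Lemma ExZ a f : Ex (fun x => a * f x) = a * Ex f.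
Proof. by rewrite /Ex mulr_sumr; apply: eq_bigr => x _; rewrite mulrCA. Qed.

Lemma ExB f g : Ex (fun x => f x - g x) = Ex f - Ex g.
Proof. by rewrite /Ex -sumrB; apply: eq_bigr => x _; rewrite mulrBr. Qed.

Lemma Ex_sum (J : Type) (r : seq J) (P : pred J) (F : J -> {ffun I -> bool} -> R) :
  Ex (fun x => \sum_(j <- r | P j) F j x) = \sum_(j <- r | P j) Ex (F j).
Proof.
by rewrite /Ex exchange_big; apply: eq_bigr => x _; rewrite mulr_sumr.
Qed.

Lemma Ex_cst a : Ex (fun=> a) = a.
Proof.
have Ex1 : Ex (fun=> 1) = 1.
  have := Ex_prod (fun _ _ => 1); rewrite [in X in _ = X -> _]big1 => [h|i _].
    by rewrite -[RHS]h; apply: eq_Ex => x; rewrite big1.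
  by rewrite !mulr1 addrC subrK.
by rewrite -[RHS]mulr1 -Ex1 -ExZ; apply: eq_Ex => x; rewrite mulr1.
Qed.

Lemma le_Ex f g : (forall x, f x <= g x) -> Ex f <= Ex g.
Proof.
by move=> fg; apply: ler_sum => x _; rewrite ler_wpM2l // bern_weight_ge0.
Qed.

Lemma ler_norm_Ex f : `|Ex f| <= Ex (fun x => `|f x|).
Proof.
apply: le_trans (ler_norm_sum _ _ _) _; apply: ler_sum => x _.
by rewrite normrM ger0_norm // bern_weight_ge0.
Qed.

Definition upd x i b : {ffun I -> bool} := [ffun j => if j == i then b else x j].

(** Conditional expectation given all coordinates but [i]. *)
Definition avg i f x : R := Q i * f (upd x i true) + (1 - Q i) * f (upd x i false).

(** Functional independence: [f] ignores the coordinate [i]. *)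
Definition indep i f := forall x b, f (upd x i b) = f x.

Lemma upd_id x i : upd x i (x i) = x.
Proof. by apply/ffunP => j; rewrite ffunE; case: eqP => // ->. Qed.

Lemma upd_upd x i b c : upd (upd x i b) i c = upd x i c.
Proof. by apply/ffunP => j; rewrite !ffunE; case: eqP. Qed.

Lemma upd_comm x i j b c : i != j -> upd (upd x i b) j c = upd (upd x j c) i b.
Proof.
move=> ij; apply/ffunP => k; rewrite !ffunE; case: (eqVneq k j) => [->|//].
by rewrite eq_sym (negPf ij).
Qed.

Lemma Ex_avg i f : Ex (avg i f) = Ex f.
Proof.
(* Configurations are paired by the flip of coordinate [i]. Both members of a pair share the weight
   [w] of the other coordinates, so the identity is checked pair by pair. *)
pose flip x := upd x i (~~ x i).
have flipK : involutive flip.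
  by move=> x; rewrite /flip upd_upd ffunE eqxx negbK upd_id.
pose w x := \prod_(j | j != i) bern (Q j) (x j).
have wtE x : bern_weight x = bern (Q i) (x i) * w x by rewrite /bern_weight (bigD1 i).
have wflip x : w (flip x) = w x.
  by apply: eq_bigr => j ji; rewrite ffunE (negPf ji).
have flipi x : flip x i = ~~ x i by rewrite ffunE eqxx.
have sum2 (F : {ffun I -> bool} -> R) : \sum_x F x = 2^-1 * \sum_x (F x + F (flip x)).
  rewrite big_split /= [X in _ + X](_ : _ = \sum_x F x); last first.
    by rewrite [RHS](reindex_inj (inv_inj flipK)).
  by set S := \sum_x _; lra.
rewrite /Ex [LHS]sum2 [RHS]sum2; congr (_ * _); apply: eq_bigr => x _.
rewrite !wtE wflip flipi /avg /flip !upd_upd.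
by case: (boolP (x i)) => xi /=; rewrite -[in f x](upd_id x i) ?xi ?(negPf xi); ring.
Qed.

Lemma indep_avg i f : indep i (avg i f).
Proof. by move=> x b; rewrite /avg !upd_upd. Qed.

Lemma indep_avg_other i j f : indep i f -> indep i (avg j f).
Proof.
case: (eqVneq i j) => [-> _|ij hf]; first exact: indep_avg.
by move=> x b; rewrite /avg !(upd_comm _ _ _ ij) !hf.
Qed.

Fixpoint avgs (s : seq I) f : {ffun I -> bool} -> R :=
  if s is i :: s' then avgs s' (avg i f) else f.

Lemma indep_avgs i s f : (i \in s) || asbool (indep i f) -> indep i (avgs s f).
Proof.
elim: s f => [|j s IHs] f /=; first by move/asboolP.
rewrite in_cons -orbA => /or3P[/eqP <-|is_|/asboolP hf]; apply: IHs.
- by apply/orP; right; apply/asboolP; exact: indep_avg.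
- by rewrite is_.
- by apply/orP; right; apply/asboolP; exact: indep_avg_other.
Qed.

Lemma Ex_avgs s f : Ex (avgs s f) = Ex f.
Proof. by elim: s f => //= i s IHs f; rewrite IHs Ex_avg. Qed.

Lemma avgs_enum f x : avgs (enum I) f x = Ex f.
Proof.
have ind i : indep i (avgs (enum I) f) by apply: indep_avgs; rewrite mem_enum.
suff const y : avgs (enum I) f y = avgs (enum I) f x.
  by rewrite -(Ex_avgs (enum I)) (eq_Ex const) Ex_cst.
(* [z s] interpolates between [y] and [x]; a function that ignores every coordinate is constant
   along the way. *)
pose z (s : seq I) : {ffun I -> bool} := [ffun i => if i \in s then x i else y i].
have zE s : avgs (enum I) f (z s) = avgs (enum I) f y.
  elim: s => [|i s IHs]; first by congr avgs; apply/ffunP => i; rewrite ffunE.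
  rewrite -IHs -[RHS](ind i _ (x i)); congr avgs.
  by apply/ffunP => j; rewrite !ffunE in_cons; case: eqP => //= ->.
by rewrite -(zE (enum I)); congr avgs; apply/ffunP => i; rewrite ffunE mem_enum.
Qed.

Definition bounded_diff (c : R) f :=
  forall x i, `|f (upd x i true) - f (upd x i false)| <= c.

Lemma bounded_diff_avg c i f : 0 <= c -> bounded_diff c f -> bounded_diff c (avg i f).
Proof.
move=> c0 hf x j; case: (eqVneq i j) => [->|ij].
  by rewrite !indep_avg subrr normr0.
rewrite /avg !(upd_comm _ _ _ (_ : j != i)); try by rewrite eq_sym.
have h1 := hf (upd x i true) j; have h2 := hf (upd x i false) j.
move: h1 h2; set a := f _; set b := f _; set a' := f _; set b' := f _ => h1 h2.
have /andP[q0 q1] := Q01 i.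
rewrite (_ : _ - _ = Q i * (a - b) + (1 - Q i) * (a' - b')); last by ring.
apply: le_trans (ler_normD _ _) _; rewrite !normrM ger0_norm // (@ger0_norm _ (1 - _)); nra.
Qed.

Section FourthMoment.
Variables (c p : R).
Hypotheses (c0 : 0 <= c) (Qp : forall i, Q i <= p).

(** The increment is a centered Bernoulli variable times the jump [D], of variance
    [q (1 - q) D^2 <= p c^2]; the factor p records the sparsity. In the fourth moment the cubic
    cross term is split by [2 a b <= a^2 + b^2], which turns the coefficients 6 and 1 into 8 = 6 + 2
    and 3 = 1 + 2. *)
Lemma avg_increment i f g x : bounded_diff c f -> indep i g ->
  avg i (fun x => (f x - avg i f x + g x) ^+ 2) x <= g x ^+ 2 + p * c ^+ 2 /\
  avg i (fun x => (f x - avg i f x + g x) ^+ 4) x <=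
    g x ^+ 4 + 8 * p * c ^+ 2 * g x ^+ 2 + 3 * p * c ^+ 4.
Proof.
move=> hf hg; have := hf x i.
rewrite [avg i (fun _ => _ ^+ 2) x]/avg [avg i (fun _ => _ ^+ 4) x]/avg.
rewrite !(@indep_avg i f) !hg /avg.
set a := f _; set b := f _; set y := g x; set q := Q i.
have /andP[q0 q1] := Q01 i; have qp := Qp i; rewrite -/q in q0 q1 qp.
rewrite (_ : a - (q * a + (1 - q) * b) = (1 - q) * (a - b)); last by ring.
rewrite (_ : b - (q * a + (1 - q) * b) = - q * (a - b)); last by ring.
set D := a - b => hD.
have D2 : D ^+ 2 <= c ^+ 2 by rewrite -(real_normK (num_real D)) ler_pXn2r // nnegrE.
have D20 := sqr_ge0 D.
have v0 : 0 <= q * (1 - q) by nra.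
have vp : q * (1 - q) <= p by nra.
have vD : q * (1 - q) * D ^+ 2 <= p * c ^+ 2 by exact: ler_pM.
have vD0 : 0 <= q * (1 - q) * D ^+ 2 by exact: mulr_ge0.
have vD4 : q * (1 - q) * D ^+ 4 <= p * c ^+ 4.
  rewrite (_ : _ * D ^+ 4 = q * (1 - q) * D ^+ 2 * D ^+ 2); last by ring.
  rewrite (_ : p * c ^+ 4 = p * c ^+ 2 * c ^+ 2); last by ring.
  exact: ler_pM.
split.
  rewrite (_ : q * _ + _ = y ^+ 2 + q * (1 - q) * D ^+ 2); last by ring.
  by rewrite lerD2l.
have -> : q * ((1 - q) * D + y) ^+ 4 + (1 - q) * (- q * D + y) ^+ 4 =
  y ^+ 4 + 6 * (q * (1 - q) * D ^+ 2) * y ^+ 2 +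
  4 * (q * (1 - q) * D ^+ 2) * ((1 - 2 * q) * D * y) +
  (q * (1 - q) * D ^+ 4) * (1 - 3 * (q * (1 - q))) by ring.
have cross : 2 * ((1 - 2 * q) * D * y) <= y ^+ 2 + D ^+ 2.
  have hq : (1 - 2 * q) ^+ 2 <= 1 by nra.
  have : ((1 - 2 * q) * D) ^+ 2 <= D ^+ 2 by rewrite exprMn; nra.
  by have := sqr_ge0 ((1 - 2 * q) * D - y); nra.
have y20 := sqr_ge0 y.
have vD40 : 0 <= q * (1 - q) * D ^+ 4 by rewrite (exprM _ 2 2) mulr_ge0 // sqr_ge0.
have h1 : 8 * (q * (1 - q) * D ^+ 2) * y ^+ 2 <= 8 * p * c ^+ 2 * y ^+ 2.
  by rewrite -(mulrA 8 p); apply: ler_wpM2r => //; apply: ler_wpM2l.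
have h2 : 4 * (q * (1 - q) * D ^+ 2) * ((1 - 2 * q) * D * y) <=
   2 * (q * (1 - q) * D ^+ 2) * (y ^+ 2 + D ^+ 2) by nra.
have h3 : (q * (1 - q) * D ^+ 4) * (1 - 3 * (q * (1 - q))) <= q * (1 - q) * D ^+ 4.
  by nra.
have h4 : 2 * (q * (1 - q) * D ^+ 2) * D ^+ 2 = 2 * (q * (1 - q) * D ^+ 4) by ring.
lra.
Qed.

(** Martingale decomposition: [f - avgs (i :: s) f] is the increment at [i] plus a function that
    ignores [i]. The fourth moment feeds on the second: with [a = p c^2] and [m] steps done, a step
    adds [8 a * (m a)], and [m^2 + m <= (m + 1)^2]. *)
Lemma avgs_moments s f : bounded_diff c f ->
  Ex (fun x => (f x - avgs s f x) ^+ 2) <= (size s)%:R * (p * c ^+ 2) /\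
  Ex (fun x => (f x - avgs s f x) ^+ 4) <=
    8 * ((size s)%:R * (p * c ^+ 2)) ^+ 2 + (size s)%:R * (3 * p * c ^+ 4).
Proof.
elim: s f => [|i s IHs] f hf /=.
  have z k : Ex (fun x => (f x - f x) ^+ k.+1) = 0.
    by rewrite (eq_Ex (g := fun=> 0)) ?Ex_cst // => x; rewrite subrr expr0n.
  by rewrite !z !mul0r expr0n mulr0 addr0.
have [IH2 IH4] := IHs _ (bounded_diff_avg i c0 hf).
pose g x := avg i f x - avgs s (avg i f) x.
have hg : indep i g.
  move=> x b; rewrite /g indep_avg (@indep_avgs i) //.
  by apply/orP; right; apply/asboolP; exact: indep_avg.
have eg k : Ex (fun x => (f x - avgs s (avg i f) x) ^+ k) =
   Ex (avg i (fun x => (f x - avg i f x + g x) ^+ k)).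
  by rewrite Ex_avg; apply: eq_Ex => x; rewrite /g addrA subrK.
rewrite !eg.
set E2 := Ex (fun x => g x ^+ 2); set E4 := Ex (fun x => g x ^+ 4).
have {}IH2 : E2 <= (size s)%:R * (p * c ^+ 2) := IH2.
have {}IH4 : E4 <= _ := IH4.
have h2 := le_Ex (fun x => (avg_increment x hf hg).1).
have h4 := le_Ex (fun x => (avg_increment x hf hg).2).
rewrite [leRHS]ExD Ex_cst -/E2 in h2; rewrite [leRHS]ExD [X in X + _]ExD ExZ Ex_cst -/E2 -/E4 in h4.
have pc0 : 0 <= p * c ^+ 2.
  by rewrite mulr_ge0 ?sqr_ge0 //; apply: le_trans (Qp i); case/andP: (Q01 i).
have s0 : 0 <= (size s)%:R :> R by [].
rewrite -natr1; split; first by lra.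
apply: le_trans h4 _.
have : 8 * p * c ^+ 2 * E2 <= 8 * (p * c ^+ 2) * ((size s)%:R * (p * c ^+ 2)).
  by rewrite -(mulrA 8 p); apply: ler_wpM2l; rewrite // mulr_ge0.
nra.
Qed.

Lemma fourth_moment_bound f : bounded_diff c f ->
  Ex (fun x => (f x - Ex f) ^+ 4) <=
    8 * (#|I|%:R * (p * c ^+ 2)) ^+ 2 + #|I|%:R * (3 * p * c ^+ 4).
Proof.
move=> hf; have [_] := avgs_moments (enum I) hf.
rewrite -cardE; apply: le_trans; rewrite le_eqVlt; apply/orP; left; apply/eqP.
by apply: eq_Ex => x; rewrite avgs_enum.
Qed.

Lemma markov_fourth (f : {ffun I -> bool} -> R) (e : R) : 0 < e ->
  \sum_(x | e <= `|f x|) bern_weight x <= Ex (fun x => f x ^+ 4) / e ^+ 4.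
Proof.
move=> e0; rewrite ler_pdivlMr ?exprn_gt0 // mulr_suml [leRHS](bigID (fun x => e <= `|f x|)) /=.
apply: ler_wpDr.
  by apply: sumr_ge0 => x _; rewrite mulr_ge0 ?bern_weight_ge0 // (exprM _ 2 2) sqr_ge0.
apply: ler_sum => x ex; apply: ler_wpM2l; first exact: bern_weight_ge0.
have -> : f x ^+ 4 = `|f x| ^+ 4 by rewrite -normrX ger0_norm // (exprM _ 2 2) sqr_ge0.
by rewrite lerXn2r // nnegrE // ltW.
Qed.

End FourthMoment.
End ProductBernoulli.

(** * Closed walks and plane trees *)

Lemma undup_cons (T : eqType) (x : T) s :
  undup (x :: s) = if x \in s then undup s else x :: undup s.
Proof. by []. Qed.

(* Vertices are labelled in the order of their discovery, the walk being read from its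
   last vertex. *)
Definition code (T : eqType) (l : seq T) : seq nat := [seq index x (rev (undup l)) | x <- l].

Section Walks.
Context {disp : Order.disp_t} {T : orderType disp}.
Implicit Types (l st : seq T) (x y z : T) (e : T * T).

(* Unordered pairs are represented by sorted pairs. *)
Definition nrm e : T * T := (Order.min e.1 e.2, Order.max e.1 e.2).

Fixpoint edges l : seq (T * T) :=
  if l is x :: ((y :: _) as l') then nrm (x, y) :: edges l' else [::].

Lemma edges_cons2 x y l : edges (x :: y :: l) = nrm (x, y) :: edges (y :: l).
Proof. by []. Qed.
Arguments edges : simpl never.

Lemma nrmP x y z t : nrm (x, y) = nrm (z, t) -> (x = z /\ y = t) \/ (x = t /\ y = z).
Proof. by rewrite /nrm /=; case: (leP x y) => _; case: (leP z t) => _ [-> ->]; auto. Qed.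

Lemma nrmC x y : nrm (x, y) = nrm (y, x).
Proof. by rewrite /nrm /= minC maxC. Qed.

Lemma nrm_id e : nrm (nrm e) = nrm e.
Proof.
by case: e => x y; rewrite /nrm /=; case: (leP x y) => h; rewrite ?h ?(ltW h) /=;
  congr pair; (apply/min_idPl || apply/max_idPr) => //; exact: ltW.
Qed.

Lemma size_edges l : size (edges l) = (size l).-1.
Proof. by elim: l => // x [|y l] // IHl; rewrite edges_cons2 /= IHl. Qed.

Lemma edges_nrm l e : e \in edges l -> nrm e = e.
Proof.
elim: l => // x [|y l] // IHl; rewrite edges_cons2 in_cons => /orP[/eqP ->|/IHl //].
exact: nrm_id.
Qed.

Lemma mem_edges l x y : nrm (x, y) \in edges l -> (x \in l) && (y \in l).
Proof.
elim: l => // z [|t l] // IHl; rewrite edges_cons2 in_cons => /orP[/eqP|].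
  by case/nrmP => -[-> ->]; rewrite !inE !eqxx ?orbT.
by move/IHl => /andP[h1 h2]; rewrite !(in_cons z) h1 h2 !orbT.
Qed.

(** A vertex absent from the rest of the walk is attached by an edge absent from it: the bound
    [v <= e + 1] for connected graphs. *)
Lemma size_undup_edges l : (size (undup l) <= (size (undup (edges l))).+1)%N.
Proof.
elim: l => // x [|y l] // IHl.
rewrite edges_cons2 (undup_cons x) (undup_cons (nrm _)).
have [xl|xl] := boolP (x \in y :: l).
  by case: ifP => _ //; apply: leq_trans IHl _; exact: leqnSn.
by rewrite ifF ?ltnS //; apply: contraNF xl => /mem_edges/andP[].
Qed.

(** Local form of a global property: the traversed graph is a tree and no edge is used more than
    twice. *)
Fixpoint tree_walk l : bool :=
  if l is x :: ((y :: _) as l') then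
    tree_walk l' && ((x \in l') ==> (count_mem (nrm (x, y)) (edges l') == 1%N))
  else true.

Lemma tree_walk_cons2 x y l : tree_walk (x :: y :: l) = tree_walk (y :: l) &&
  ((x \in y :: l) ==> (count_mem (nrm (x, y)) (edges (y :: l)) == 1%N)).
Proof. by []. Qed.
Arguments tree_walk : simpl never.

(** Equality in [v <= e + 1] passes to the shorter walk: a known vertex reached along a new edge
    would close a cycle, and the shorter walk would exceed the bound. *)
Lemma tree_walkP l : size (undup l) = (size (undup (edges l))).+1 ->
  (forall e, count_mem e (edges l) <= 2)%N -> tree_walk l.
Proof.
elim: l => // x [|y l] // IHl sz2 c2.
have c2' e : (count_mem e (edges (y :: l)) <= 2)%N.
  by apply: leq_trans (c2 e); rewrite edges_cons2 /= leq_addl.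
move: sz2; rewrite edges_cons2 tree_walk_cons2 (undup_cons x) (undup_cons (nrm _)).
have := size_undup_edges (y :: l).
have [xl|xl] := boolP (x \in y :: l); last first.
  rewrite ifF; last by apply: contraNF xl => /mem_edges/andP[].
  by move=> _ /= [sz2]; rewrite andbT; apply: IHl.
move=> szl; case: ifP => [el sz2|_ sz2]; last by move: szl; rewrite sz2 /= ltnn.
rewrite IHl //=; have := c2 (nrm (x, y)); rewrite edges_cons2 /= eqxx add1n ltnS.
by rewrite eqn_leq => -> /=; rewrite -has_count has_pred1.
Qed.

Fixpoint new_steps l : seq bool :=
  if l is x :: ((_ :: _) as l') then (x \notin l') :: new_steps l' else [::].

Lemma new_steps_cons2 x y l :
  new_steps (x :: y :: l) = (x \notin y :: l) :: new_steps (y :: l).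
Proof. by []. Qed.
Arguments new_steps : simpl never.

Lemma size_new_steps l : size (new_steps l) = (size l).-1.
Proof. by elim: l => // x [|y l] // IHl; rewrite new_steps_cons2 /= IHl. Qed.

(* The path from the current vertex back to the root along the edges traversed
   exactly once. *)
Fixpoint walk_stack l : seq T :=
  if l is x :: ((_ :: _) as l') then
    if x \notin l' then x :: walk_stack l' else behead (walk_stack l')
  else l.

Lemma walk_stack_cons2 x y l : walk_stack (x :: y :: l) =
  if x \notin y :: l then x :: walk_stack (y :: l) else behead (walk_stack (y :: l)).
Proof. by []. Qed.
Arguments walk_stack : simpl never.

(** The last clause drives the induction. A step to a known vertex repeats an edge used once, which
    therefore lies on the stack; as the current vertex heads a duplicate-free stack, that edge leads
    to the second entry. Return steps are thus forced. *)
Lemma walk_stackP x l : tree_walk (x :: l) ->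
  [/\ uniq (walk_stack (x :: l)), {subset walk_stack (x :: l) <= x :: l},
      walk_stack (x :: l) = x :: behead (walk_stack (x :: l)) &
      forall e, (count_mem e (edges (x :: l)) == 1%N) =
                (e \in edges (walk_stack (x :: l)))].
Proof.
elim: l x => [|y l IHl] x; first by split.
rewrite tree_walk_cons2 => /andP[good /implyP xold].
have [ust subst headst cst] := IHl y good.
rewrite walk_stack_cons2 edges_cons2.
case: (boolP (x \in y :: l)) => xl /=; last first.
  split=> //.
  - by rewrite ust andbT; apply: contra xl => /subst.
  - move=> z; rewrite in_cons => /orP[/eqP ->|/subst h]; first exact: mem_head.
    by rewrite in_cons h orbT.
  - move=> e; rewrite headst edges_cons2 -headst in_cons -cst /=.
    case: (eqVneq (nrm (x, y)) e) => [<-|//].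
    rewrite add1n eqSS; apply/eqP/count_memPn.
    by apply: contra xl => /mem_edges/andP[].
move/eqP: (xold xl) => ce.
have : nrm (x, y) \in edges (walk_stack (y :: l)) by rewrite -cst ce.
move: ust subst headst cst; set st := walk_stack _.
case: st => // y' [|z st] //= + + [eqy]; rewrite eqy ?edges_cons2 => /andP[yst ust] subst cst.
have nin w : nrm (w, y) \notin edges (z :: st).
  by apply: contra yst => /mem_edges/andP[].
rewrite in_cons (negPf (nin x)) orbF => /eqP eqe.
have xz : x = z by case: (nrmP eqe) => -[] // -> ->.
split=> //.
- by move=> w wst; rewrite in_cons subst ?orbT // in_cons wst orbT.
- by rewrite xz.
- move=> e; case: (eqVneq (nrm (x, y)) e) => [<-|ne].
    by rewrite ce (negPf (nin x)).
  by rewrite add0n cst in_cons -eqe eq_sym (negPf ne).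
Qed.

(** The state consists of the labels of the walk, the labels of its stack and the next fresh label.
    On tree walks a return step finds a second stack entry, so the default of [nth] does not
    occur. *)
Fixpoint decode (bs : seq bool) : seq nat * seq nat * nat :=
  if bs is b :: bs' then
    let: (w, st, c) := decode bs' in
    if b then (c :: w, c :: st, c.+1) else (nth 0%N st 1 :: w, behead st, c)
  else ([:: 0%N], [:: 0%N], 1%N).

Lemma decode_new_steps x l : tree_walk (x :: l) ->
  let f z := index z (rev (undup (x :: l))) in
  decode (new_steps (x :: l)) =
    (map f (x :: l), map f (walk_stack (x :: l)), size (undup (x :: l))).
Proof.
elim: l x => [|y l IHl] x good f.
  by rewrite /new_steps /walk_stack /f /= eqxx.
rewrite {}/f new_steps_cons2 walk_stack_cons2 undup_cons.
have [ust subst headst cst] := walk_stackP good.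
move: (good); rewrite tree_walk_cons2 => /andP[good' _].
have [_ subst' headst' _] := walk_stackP good'.
have {}IHl := IHl y good'; move: IHl; set f := fun z => index z _ => IHl.
rewrite [decode _]/= IHl.
case: (boolP (x \in y :: l)) => xl; rewrite ?[~~ true]/= ?[~~ false]/=.
  rewrite behead_map map_cons; congr (_ :: _, _, _).
  move: headst; rewrite walk_stack_cons2 xl /=; set st := walk_stack _.
  by case: st => [|y' [|z st]] //= [->].
rewrite rev_cons.
have fE z : z \in y :: l -> index z (rcons (rev (undup (y :: l))) x) = f z.
  by move=> zl; rewrite -cats1 index_cat mem_rev mem_undup zl.
have fx : index x (rcons (rev (undup (y :: l))) x) = size (undup (y :: l)).
  by rewrite -cats1 index_cat mem_rev mem_undup (negPf xl) /= eqxx addn0 size_rev.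
rewrite !map_cons fx; congr (_ :: _, _ :: _, _).
  rewrite -map_cons; apply/eq_in_map => z zl; rewrite fE //.
by apply/eq_in_map => z /subst' /fE.
Qed.

Lemma code_decode x l : tree_walk (x :: l) ->
  code (x :: l) = (decode (new_steps (x :: l))).1.1.
Proof. by move/decode_new_steps => /= ->. Qed.

End Walks.

Section WalkMap.
Context {disp : Order.disp_t} {T : orderType disp}.
Context {disp' : Order.disp_t} {T' : orderType disp'}.
Variable f : T -> T'.
Definition map_edge (e : T * T) : T' * T' := nrm (f e.1, f e.2).

Lemma map_edge_nrm e : map_edge (nrm e) = nrm (f e.1, f e.2).
Proof.
by case: e => x y; rewrite /map_edge /nrm /=; case: (leP x y) => _ //=; rewrite minC maxC.
Qed.

Lemma edges_map l : edges (map f l) = map map_edge (edges l).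
Proof.
elim: l => // x [|y l] // IHl.
by rewrite (edges_cons2 x) [RHS]map_cons -IHl map_edge_nrm.
Qed.

Lemma map_edge_inj l : {in l &, injective f} ->
  {in edges l &, injective map_edge}.
Proof.
move=> injf [x y] [z t] exy ezt.
have exy' := edges_nrm exy; have ezt' := edges_nrm ezt.
move: exy ezt; rewrite -{1}exy' -{1}ezt'.
move=> /mem_edges/andP[xl yl] /mem_edges/andP[zl tl].
rewrite /map_edge /= -exy' -ezt' => /nrmP[] [/injf e1 /injf e2].
  by rewrite e1 // e2.
by rewrite e1 // e2 // nrmC.
Qed.

Lemma count_edges_map l e : {in l &, injective f} -> e \in edges l ->
  count_mem (map_edge e) (edges (map f l)) = count_mem e (edges l).
Proof.
move=> injf el; rewrite edges_map count_map; apply: eq_in_count => e' e'l /=.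
by apply/eqP/eqP => [ee'|-> //]; exact: (map_edge_inj injf).
Qed.

Lemma undup_edges_map l : {in l &, injective f} ->
  undup (edges (map f l)) = map map_edge (undup (edges l)).
Proof.
move=> injf; rewrite edges_map; have := map_edge_inj injf.
elim: (edges l) => //= e s IHs inj.
have inj' : {in s &, injective map_edge}.
  by move=> a b sa sb; apply: inj; rewrite in_cons ?sa ?sb orbT.
rewrite (_ : map_edge e \in _ = (e \in s)); first by case: ifP => _; rewrite IHs.
apply/mapP/idP => [[e' e's /inj ee']|es]; last by exists e.
by rewrite ee' ?mem_head // in_cons e's orbT.
Qed.

End WalkMap.

(** * Sums over walks with a given pattern *)

Section TupleSums.
Variables (R : realType) (T : finType).

Lemma sum_cst (c : R) : \sum_(x : T) c = #|T|%:R * c.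
Proof. by rewrite sumr_const -[c *+ _]mulr_natl. Qed.

Lemma tuple_sum_cons k (F : seq T -> R) :
  \sum_(t : k.+1.-tuple T) F t = \sum_x \sum_(s : k.-tuple T) F (x :: s).
Proof.
rewrite pair_big /= (reindex (fun xs : T * k.-tuple T => cons_tuple xs.1 xs.2)) //=.
exists (fun t : k.+1.-tuple T => (thead t, behead_tuple t)).
  by move=> [x s] _; rewrite theadE; congr pair; apply/val_inj.
by move=> t _; rewrite [t in RHS]tuple_eta; apply/val_inj.
Qed.

Lemma tuple_sum0 (F : seq T -> R) : \sum_(t : 0.-tuple T) F t = F [::].
Proof.
rewrite (big_pred1 [tuple]) // => -[[]] // i; apply/esym/eqP/val_inj.
Qed.

Lemma tuple_sum_nth k (x0 : T) (a : nat) (H : T -> R) : (a < k)%N ->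
  \sum_(t : k.-tuple T) H (nth x0 t a) = #|T|%:R ^+ k.-1 * \sum_x H x.
Proof.
elim: k a => // k IHk a ak; rewrite (tuple_sum_cons _ (fun s => H (nth x0 s a))) /=.
case: a ak => [_|a ak] /=.
  under eq_bigr => x _ do rewrite sumr_const card_tuple -[_ *+ (_ ^ _)]mulr_natl natrX.
  by rewrite -mulr_sumr.
rewrite (eq_bigr (fun _ => #|T|%:R ^+ k.-1 * \sum_x H x)); last by move=> x _; exact: IHk.
rewrite sum_cst mulrA -exprS prednK //; exact: (@leq_ltn_trans a).
Qed.

Lemma tuple_sum_nth2 k (x0 : T) (a b : nat) (G : T -> T -> R) :
  (a < k)%N -> (b < k)%N -> a != b ->
  \sum_(t : k.-tuple T) G (nth x0 t a) (nth x0 t b) =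
    #|T|%:R ^+ k.-2 * \sum_x \sum_y G x y.
Proof.
elim: k a b => // k IHk a b ak bk ab.
rewrite (tuple_sum_cons _ (fun s => G (nth x0 s a) (nth x0 s b))).
case: a b ab ak bk => [|a] [|b] // ab ak bk /=.
- rewrite mulr_sumr; apply: eq_bigr => x _; exact: (tuple_sum_nth x0 (G x)).
- rewrite [X in _ * X]exchange_big mulr_sumr; apply: eq_bigr => x _.
  exact: (tuple_sum_nth x0 (fun y => G y x)).
- rewrite (eq_bigr (fun _ => #|T|%:R ^+ k.-2 * \sum_x \sum_y G x y)); last first.
    by move=> x _; exact: IHk.
  rewrite sum_cst mulrA -exprS; congr (_ ^+ _ * _).
  by case: k ak bk ab {IHk} => [|[|k]] //; case: a b => [|a] [|b].
Qed.

(** Union bound over pairs of positions. Non-injective tuples form a fraction O(1/n), so sums over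
    injective maps may be replaced by sums over all maps. *)
Lemma tuple_sum_nonuniq k : 
  \sum_(t : k.-tuple T | ~~ uniq t) (1 : R) <= (k ^ 2)%:R * #|T|%:R ^+ k.-1.
Proof.
have [x0 _|T0] := pickP T; last first.
  rewrite big1 ?mulr_ge0 // => t; case: k t => [|k] t; first by rewrite tuple0.
  by have := T0 (thead t).
apply: (@le_trans _ _ (\sum_(a : 'I_k) \sum_(b : 'I_k | a != b)
   \sum_(t : k.-tuple T) (nth x0 t a == nth x0 t b)%:R)).
  under [leRHS]eq_bigr => a _ do rewrite exchange_big /=.
  rewrite exchange_big /= [leRHS](bigID (fun t : k.-tuple T => ~~ uniq t)) /=.
  apply: ler_wpDr; first by apply: sumr_ge0 => t _; do 2!apply: sumr_ge0 => ? _.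
  apply: ler_sum => t /(uniqPn x0)[i [j [ij]]]; rewrite size_tuple => jk eqij.
  rewrite (bigD1 (Ordinal (ltn_trans ij jk))) //=.
  rewrite (bigD1 (Ordinal jk)) /=; last by rewrite -val_eqE /= ltn_eqF.
  by rewrite eqij eqxx -addrA lerDl addr_ge0 //; do ?apply: sumr_ge0 => ? _.
rewrite (_ : (k ^ 2)%:R * _ = \sum_(a : 'I_k) \sum_(b : 'I_k) (#|T|%:R ^+ k.-1 : R)).
  apply: ler_sum => a _; rewrite [leRHS](bigID (fun b => a != b)) /=.
  apply: ler_wpDr; first by apply: sumr_ge0 => b _; rewrite exprn_ge0.
  apply: ler_sum => b ab.
  rewrite (tuple_sum_nth2 x0 (fun x y => (x == y)%:R)) //.
  rewrite (eq_bigr (fun=> 1)).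
    rewrite sum_cst mulr1 -exprSr.
    by case: k a b ab => [|[|k]] // [] // [|?] // ? [] [].
  by move=> x _; rewrite (bigD1 x) //= eqxx big1 ?addr0 // => y /negPf; rewrite eq_sym => ->.
by rewrite !sumr_const card_ord -mulrnA mulr_natl.
Qed.

Lemma tuple_sum_map (T' : finType) k (tau : T -> T') (F : seq T' -> R) :
  \sum_(t : k.-tuple T) F (map tau t) =
  \sum_(c : k.-tuple T') (\prod_(j <- c) #|[pred x | tau x == j]|%:R) * F c.
Proof.
elim: k F => [|k IHk] F.
  rewrite (tuple_sum0 (fun s => F (map tau s))) (big_pred1 [tuple]).
    by rewrite big_nil mul1r.
  by move=> -[[]] // i; apply/esym/eqP/val_inj.
rewrite (tuple_sum_cons _ (fun s => F (map tau s))).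
transitivity (\sum_y \sum_(c : k.-tuple T')
   (\prod_(j <- y :: c) #|[pred x | tau x == j]|%:R) * F (y :: c)).
  under eq_bigr => x _ do rewrite (IHk (fun s => F (tau x :: s))).
  rewrite (partition_big tau predT) //=; apply: eq_bigr => y _.
  rewrite (eq_bigr (fun _ => \sum_(c : k.-tuple T')
     (\prod_(j <- c) #|[pred x | tau x == j]|%:R) * F (y :: c))); last first.
    by move=> x /eqP ->.
  rewrite sumr_const -[_ *+ #|_|]mulr_natl mulr_sumr; apply: eq_bigr => c _.
  by rewrite big_cons mulrA.
rewrite pair_big /= [RHS](reindex (fun xs : T' * k.-tuple T' => cons_tuple xs.1 xs.2)) //=.
exists (fun t : k.+1.-tuple T' => (thead t, behead_tuple t)).
  by move=> [x s] _; rewrite theadE; congr pair; apply/val_inj.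
by move=> t _; rewrite [t in RHS]tuple_eta; apply/val_inj.
Qed.

End TupleSums.

Section Codes.
Variable T : eqType.
Implicit Type l : seq T.

Lemma map_nth_code (x0 : T) l : map (nth x0 (rev (undup l))) (code l) = l.
Proof.
rewrite -map_comp -[RHS]map_id; apply/eq_in_map => x xl /=.
by rewrite nth_index // mem_rev mem_undup.
Qed.

Lemma code_map (T' : eqType) (f : T -> T') l : {in l &, injective f} ->
  code (map f l) = code l.
Proof.
move=> injf; rewrite /code -map_comp.
have -> : rev (undup (map f l)) = map f (rev (undup l)).
  rewrite map_rev; congr rev.
  elim: l injf => //= x s IHs inj.
  have inj' : {in s &, injective f}.
    by move=> a b sa sb; apply: inj; rewrite in_cons ?sa ?sb orbT.
  rewrite (_ : f x \in _ = (x \in s)); first by case: ifP => _; rewrite IHs.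
  apply/mapP/idP => [[e' e's /inj ee']|es]; last by exists x.
  by rewrite ee' ?mem_head // in_cons e's orbT.
apply/eq_in_map => x xl /=; rewrite /index find_map.
apply: eq_in_find => y; rewrite mem_rev mem_undup => yl /=.
by apply/eqP/eqP => [/injf ->|->].
Qed.

Lemma size_undup_code l : size (undup (code l)) = size (undup l).
Proof.
case: l => // x0 l'; set l := x0 :: l'.
rewrite -(size_rev (undup l)) -{2}(map_nth_code x0 l).
have inj : {in code l &, injective (nth x0 (rev (undup l)))}.
  move=> _ _ /mapP[x xl ->] /mapP[y yl ->].
  by rewrite !nth_index ?mem_rev ?mem_undup // => ->.
rewrite size_rev; elim: (code l) inj => //= x s IHs inj.
have inj' : {in s &, injective (nth x0 (rev (undup l)))}.
  by move=> a b sa sb; apply: inj; rewrite in_cons ?sa ?sb orbT.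
rewrite (_ : nth _ _ x \in _ = (x \in s)); first by case: ifP => _ /=; rewrite IHs.
apply/mapP/idP => [[e' e's /inj ee']|es]; last by exists x.
by rewrite ee' ?mem_head // in_cons e's orbT.
Qed.

Lemma mem_code_lt l a : a \in code l -> (a < size (undup l))%N.
Proof.
by case/mapP => x xl ->; rewrite -(size_rev (undup l)) index_mem mem_rev mem_undup.
Qed.

End Codes.

Lemma code_code (T : eqType) (l : seq T) : code (code l) = code l.
Proof.
rewrite {2}/code code_map // => x y xl yl /(congr1 (nth x (rev (undup l)))).
by rewrite !nth_index ?mem_rev ?mem_undup.
Qed.

Lemma undup_code_id (g : seq nat) : code g = g -> rev (undup g) = iota 0 (size (undup g)).
Proof.
move=> gg; apply: (@eq_from_nth _ 0%N); first by rewrite size_rev size_iota.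
move=> i; rewrite size_rev => iv; rewrite nth_iota // add0n.
set y := nth 0%N _ i.
have yg : y \in g by rewrite -mem_undup -mem_rev mem_nth // size_rev.
have : y = index y (rev (undup g)).
  move: yg; rewrite -{1}gg => /mapP[x xg yx].
  suff yx' : x = y by rewrite {1}yx yx'.
  have fix_ a : a \in g -> index a (rev (undup g)) = a.
    move=> ag; have := map_nth_code 0%N g; rewrite -{3}gg => h.
    have /eq_in_map : map (fun x => index x (rev (undup g))) g = map id g.
      by rewrite map_id; exact: gg.
    by apply.
  by rewrite yx fix_.
by rewrite index_uniq ?size_rev ?rev_uniq ?undup_uniq.
Qed.

Section CodeSum.
Variables (R : realType) (T : finType) (x0 : T).

(** Walks with pattern [g] correspond to injective labellings [u]; the inverse lists the vertices in
    order of discovery. The default of [insubd] would only serve lists of the wrong length, which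
    [h'E] excludes. *)
Lemma sum_code k (g : k.-tuple nat) (F : seq T -> R) : code g = g ->
  \sum_(l : k.-tuple T | code l == g) F l =
  \sum_(u : (size (undup g)).-tuple T | uniq u) F (map (nth x0 u) g).
Proof.
move=> gg; set v := size (undup g).
pose h (u : v.-tuple T) : k.-tuple T := map_tuple (nth x0 u) g.
pose h' (l : k.-tuple T) : v.-tuple T := insubd (nseq_tuple v x0) (rev (undup l)).
have h'E l : code (val l) = g -> val (h' l) = rev (undup l).
  by move=> lg; rewrite val_insubd size_rev -size_undup_code lg eqxx.
rewrite (reindex_onto h h') /=; last first.
  move=> l /eqP lg; apply/val_inj; rewrite /= h'E // -[in RHS](map_nth_code x0 l).
  by rewrite lg.
apply: eq_bigl => u; apply/andP/idP => [[/eqP lg /eqP hu]|uu].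
  by rewrite -hu h'E // rev_uniq undup_uniq.
have inj : {in g &, injective (nth x0 u)}.
  have lt a : a \in tval g -> (a < v)%N by move=> ag; apply: mem_code_lt; rewrite gg.
  move=> a b /lt av /lt bv /eqP.
  by rewrite nth_uniq ?size_tuple // => /eqP.
have lg : code (map (nth x0 u) g) = g by rewrite code_map.
split; first by rewrite lg.
apply/eqP/val_inj; rewrite h'E //=.
apply: (@eq_from_nth _ x0); first by rewrite size_rev -size_undup_code lg size_tuple.
move=> i; rewrite size_rev -size_undup_code lg -/v => iv.
have ig : i \in g by rewrite -mem_undup -mem_rev undup_code_id // mem_iota.
have -> : i = index (nth x0 u i) (rev (undup (map (nth x0 u) g))).
  have /eq_in_map : map (fun a => index (nth x0 u a) (rev (undup (map (nth x0 u) g)))) g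
     = map id g.
    by rewrite map_id -[RHS]lg /code -map_comp.
  by move/(_ i ig).
rewrite nth_index; last by rewrite mem_rev mem_undup map_f.
congr nth; have /eq_in_map : map (fun a => index (nth x0 u a) (rev (undup (map (nth x0 u) g)))) g
     = map id g.
  by rewrite map_id -[RHS]lg /code -map_comp.
by move/(_ i ig).
Qed.

End CodeSum.

(** * Moments of centered matrices *)

Definition closed_walk (T : eqType) (l : seq T) : bool :=
  if l is x :: s then last x s == x else true.

Section TraceWalks.
Variables (R : realType) (n : nat) (A : 'M[R]_n).
Hypothesis symA : A^T = A.

Definition edge_prod (l : seq 'I_n) : R := \prod_(e <- edges l) A e.1 e.2.

Lemma entry_nrm i j : A (nrm (i, j)).1 (nrm (i, j)).2 = A i j.
Proof. by rewrite /nrm /=; case: (leP i j) => _ //; rewrite -{1}symA mxE. Qed.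

Lemma mxpow_walks k i j : mxpow A k i j =
  \sum_(s : k.-tuple 'I_n) (if last i s == j then edge_prod (i :: s) else 0).
Proof.
elim: k i => [|k IHk] i /=.
  rewrite (tuple_sum0 (fun s => if last i s == j then edge_prod (i :: s) else 0)) /=.
  by rewrite mxE /edge_prod big_nil; case: eqP.
rewrite (tuple_sum_cons _ (fun s => if last i s == j then edge_prod (i :: s) else 0)).
rewrite mxE; apply: eq_bigr => m _; rewrite IHk mulr_sumr; apply: eq_bigr => s _ /=.
case: ifP => _; last by rewrite mulr0.
by rewrite /edge_prod edges_cons2 big_cons entry_nrm.
Qed.

Lemma trace_walks k : \tr (mxpow A k) =
  \sum_(l : k.+1.-tuple 'I_n | closed_walk l) edge_prod l.
Proof.
rewrite [RHS]big_mkcond /=.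
rewrite (tuple_sum_cons _ (fun l => if closed_walk l then edge_prod l else 0)) /=.
by apply: eq_bigr => i _; rewrite mxpow_walks.
Qed.

End TraceWalks.

Lemma prodr_undup_count (R : realType) (T : eqType) (s : seq T) (F : T -> R) :
  \prod_(e <- s) F e = \prod_(e <- undup s) F e ^+ count_mem e s.
Proof.
by rewrite -(big_undup_iterop_count _ s predT F).
Qed.

Section CenteredMoments.
Variables (R : realType) (n : nat) (Q : 'I_n * 'I_n -> R) (eta : R).
Hypothesis Q01 : forall e, 0 <= Q e <= 1.
Hypothesis eta01 : 0 <= eta <= 1.
Hypothesis var_le : forall e, eta ^+ 2 * (Q e * (1 - Q e)) <= n%:R^-1.

Definition xi (e : 'I_n * 'I_n) (b : bool) : R :=
  if e.1 == e.2 then 0 else eta * (b%:R - Q e).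

(** Reading the coordinate at the sorted pair ties the two symmetric entries to one Bernoulli
    variable. *)
Definition centered (x : {ffun 'I_n * 'I_n -> bool}) : 'M[R]_n :=
  \matrix_(i, j) xi (nrm (i, j)) (x (nrm (i, j))).

Lemma centered_sym x : (centered x)^T = centered x.
Proof. by apply/matrixP => i j; rewrite !mxE nrmC. Qed.

Definition xi_moment e c : R := Q e * xi e true ^+ c + (1 - Q e) * xi e false ^+ c.

Definition walk_moment (l : seq 'I_n) : R :=
  \prod_(e <- undup (edges l)) xi_moment e (count_mem e (edges l)).

Lemma Ex_walk l : Ex Q (fun x => edge_prod (centered x) l) = walk_moment l.
Proof.
transitivity (Ex Q (fun x => \prod_e xi e (x e) ^+ count_mem e (edges l))).
  apply: eq_Ex => x; rewrite /edge_prod.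
  transitivity (\prod_(e <- edges l) xi e (x e)).
    apply: eq_big_seq => e el; rewrite mxE.
    by rewrite (_ : nrm (e.1, e.2) = e) //; case: e el => a b /edges_nrm.
  rewrite prodr_undup_count [LHS]big_uniq ?undup_uniq // [RHS](bigID [in undup (edges l)]) /=.
  rewrite [X in _ * X]big1 ?mulr1 //.
  by move=> e; rewrite mem_undup => /count_memPn ->; rewrite expr0.
rewrite (Ex_prod Q (fun e b => xi e b ^+ count_mem e (edges l))).
rewrite /walk_moment [RHS]big_uniq ?undup_uniq // (bigID [in undup (edges l)]) /=.
rewrite [X in _ * X]big1 ?mulr1 //.
by move=> e; rewrite mem_undup => /count_memPn ->; rewrite !expr0 !mulr1 addrC subrK.
Qed.

Lemma Ex_trace k : Ex Q (fun x => \tr (mxpow (centered x) k)) =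
  \sum_(l : k.+1.-tuple 'I_n | closed_walk l) walk_moment l.
Proof.
under eq_Ex => x do rewrite (trace_walks (centered_sym x)).
by rewrite Ex_sum; apply: eq_bigr => l _; rewrite Ex_walk.
Qed.

Lemma xi_moment1 e : xi_moment e 1 = 0.
Proof. by rewrite /xi_moment /xi; case: eqP => _ /=; ring. Qed.

Lemma xi_moment2 e :
  xi_moment e 2 = if e.1 == e.2 then 0 else eta ^+ 2 * (Q e * (1 - Q e)).
Proof. by rewrite /xi_moment /xi; case: eqP => _ /=; ring. Qed.

Lemma xi_le e b : `|xi e b| <= eta.
Proof.
have /andP[e0 _] := eta01; have /andP[q0 q1] := Q01 e.
rewrite /xi; case: ifP => _; first by rewrite normr0.
by rewrite normrM (ger0_norm e0) ler_piMr // ler_norml; case: b => /=; lra.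
Qed.

Lemma xi_moment2_bounds e : 0 <= xi_moment e 2 <= n%:R^-1.
Proof.
rewrite xi_moment2; case: ifP => _; first by rewrite lexx invr_ge0 ler0n.
have /andP[q0 q1] := Q01 e; rewrite var_le andbT.
by rewrite mulr_ge0 ?sqr_ge0 // mulr_ge0 // subr_ge0.
Qed.

(** Two factors pay the variance bound 1/n, each of the remaining [c] factors the uniform bound
    [eta]. *)
Lemma xi_moment_le e c : `|xi_moment e c.+2| <= n%:R^-1 * eta ^+ c.
Proof.
have /andP[e0 _] := eta01; have /andP[q0 q1] := Q01 e.
have p1 : 0 <= 1 - Q e by rewrite subr_ge0.
have h b : `|xi e b ^+ c.+2| <= xi e b ^+ 2 * eta ^+ c.
  rewrite -addn2 addnC exprD normrM normrX real_normK ?num_real //.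
  by rewrite ler_wpM2l ?sqr_ge0 // normrX lerXn2r ?nnegrE // xi_le.
apply: (@le_trans _ _ (xi_moment e 2 * eta ^+ c)); last first.
  by rewrite ler_wpM2r ?exprn_ge0 //; case/andP: (xi_moment2_bounds e).
rewrite /xi_moment [leRHS]mulrDl; apply: le_trans (ler_normD _ _) _.
rewrite (normrM (Q e)) (normrM (1 - Q e)) (ger0_norm q0) (ger0_norm p1).
by rewrite -(mulrA (Q e)) -(mulrA (1 - Q e)); apply: lerD; apply: ler_wpM2l.
Qed.

Lemma walk_moment_loop l e : e \in edges l -> e.1 = e.2 -> walk_moment l = 0.
Proof.
move=> el ee; rewrite /walk_moment (bigD1_seq e) ?undup_uniq ?mem_undup //=.
have : (0 < count_mem e (edges l))%N by rewrite -has_count has_pred1.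
case: (count_mem _ _) => // c _.
by rewrite /xi_moment /xi ee eqxx !expr0n /= !mulr0 addr0 mul0r.
Qed.

Lemma walk_moment_single l e : count_mem e (edges l) = 1%N -> walk_moment l = 0.
Proof.
move=> c1; have el : e \in edges l by rewrite -has_pred1 has_count c1.
rewrite /walk_moment (bigD1_seq e) ?undup_uniq ?mem_undup //=.
by rewrite c1 xi_moment1 mul0r.
Qed.

Lemma sum_count_undup (T : eqType) (s : seq T) :
  (\sum_(e <- undup s) count_mem e s)%N = size s.
Proof.
rewrite -sum1_size -(big_undup_iterop_count _ s predT (fun=> 1%N)) /=.
by apply: eq_bigr => e _; elim: (count_mem e s) => // -[|m] //= <-.
Qed.

Lemma walk_moment_le l : (forall e, e \in edges l -> 2 <= count_mem e (edges l))%N ->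
  `|walk_moment l| <= n%:R^-1 ^+ size (undup (edges l)) *
    eta ^+ (size (edges l) - (size (undup (edges l))).*2).
Proof.
move=> c2; rewrite /walk_moment normr_prod.
have -> : (size (edges l) - (size (undup (edges l))).*2)%N =
   (\sum_(e <- undup (edges l)) (count_mem e (edges l) - 2))%N.
  rewrite -[X in (X - _)%N]sum_count_undup.
  have -> : (size (undup (edges l))).*2 = (\sum_(e <- undup (edges l)) 2)%N.
    by elim: (undup _) => [|e s IHs]; rewrite ?big_nil // big_cons -IHs.
  rewrite [RHS]big_seq sumnB; last by move=> e; rewrite mem_undup => /c2.
  by rewrite -!big_seq.
have -> : n%:R^-1 ^+ size (undup (edges l)) = \prod_(e <- undup (edges l)) (n%:R^-1 : R).
  by elim: (undup _) => [|e s IHs]; rewrite ?big_nil // big_cons -IHs exprS.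
rewrite expr_sum -big_split /=.
rewrite [leLHS]big_seq [leRHS]big_seq.
apply: ler_prod => e; rewrite mem_undup => /c2 h; rewrite normr_ge0 /=.
by have := xi_moment_le e (count_mem e (edges l) - 2); rewrite -addn2 subnK.
Qed.

End CenteredMoments.

(** * Homomorphism densities *)

Section Approximation.
Variable R : realType.

(** The sequence is Cauchy. In this form each approximation may bring its own limit, without a
    relation between these limits. *)
Lemma approx_cvg (u : nat -> R) :
  (forall e : R, 0 < e -> exists c : R, \forall n \near \oo, `|u n - c| <= e) ->
  exists c : R, u @ \oo --> c.
Proof.
move=> h; suff /cvg_ex[c uc] : cvg (u @ \oo) by exists c.
apply/cauchy_cvgP; apply: cauchy_exP => e e0.
have [c hc] := h _ (divr_gt0 e0 (ltr0Sn R 1)).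
exists c; suff : \forall n \near \oo, ball c e (u n) by [].
near=> n; rewrite /ball /= distrC.
apply: (@le_lt_trans _ _ (e / 2)); first by near: n.
by rewrite ltr_pdivrMr // ltr_pMr // ltr1n.
Unshelve. all: by end_near. Qed.

Lemma cvg_sum_seq (I : Type) (r : seq I) (f : I -> nat -> R) (a : I -> R) :
  (forall i, f i @ \oo --> a i) ->
  (fun n => \sum_(i <- r) f i n) @ \oo --> \sum_(i <- r) a i.
Proof.
move=> fa; elim: r => [|i r IHr].
  by under eq_fun do rewrite big_nil; rewrite big_nil; exact: cvg_cst.
by under eq_fun do rewrite big_cons; rewrite big_cons; exact: cvgD.
Qed.

Lemma cvg_bounds (u : nat -> R) a b c : u @ \oo --> c ->
  (\forall n \near \oo, a <= u n <= b) -> a <= c <= b.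
Proof.
move=> uc ab; apply/andP; split.
  apply: (closed_cvg (fun y => a <= y)) uc; first exact: closed_ge.
  by near=> n; have /andP[] : a <= u n <= b by near: n.
apply: (closed_cvg (fun y => y <= b)) uc; first exact: closed_le.
by near=> n; have /andP[] : a <= u n <= b by near: n.
Unshelve. all: by end_near. Qed.

Lemma prod_diff_le (I : Type) (r : seq I) (f g : I -> R) :
  (forall i, 0 <= f i <= 1) -> (forall i, 0 <= g i <= 1) ->
  `|\prod_(i <- r) f i - \prod_(i <- r) g i| <= \sum_(i <- r) `|f i - g i|.
Proof.
move=> f01 g01; have p01 (h : I -> R) s : (forall i, 0 <= h i <= 1) ->
    0 <= \prod_(i <- s) h i <= 1.
  move=> h01; elim: s => [|i s IHs]; rewrite ?big_nil ?ler01 ?lexx // big_cons.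
  have /andP[a0 a1] := h01 i; have /andP[b0 b1] := IHs.
  by rewrite mulr_ge0 //= mulr_ile1.
elim: r => [|i r IHr]; first by rewrite !big_nil subrr normr0.
rewrite !big_cons.
have /andP[a0 a1] := f01 i; have /andP[b0 b1] := p01 g r g01.
rewrite (_ : _ - _ = f i * (\prod_(j <- r) f j - \prod_(j <- r) g j) +
   (f i - g i) * \prod_(j <- r) g j); last by ring.
apply: le_trans (ler_normD _ _) _; rewrite addrC; apply: lerD.
  by rewrite normrM (ger0_norm b0) ler_piMr.
by rewrite normrM (ger0_norm a0); apply: le_trans IHr; rewrite ler_piMl.
Qed.

(** The partition [tau] may vary with n, but the number of steps, their values [sK] and their limit
    weights [w] may not: this is what makes the densities of the step kernels converge. *)
Definition kernel_approx (W : forall n, 'I_n -> 'I_n -> R) : Prop :=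
  forall e : R, 0 < e -> exists K (tau : forall n, 'I_n -> 'I_K.+1)
    (w : 'I_K.+1 -> R) (sK : 'I_K.+1 -> 'I_K.+1 -> R),
  [/\ forall a b, 0 <= sK a b <= 1,
      forall j, #|[pred i | tau n i == j]|%:R / n%:R @[n --> \oo] --> w j &
      \forall n \near \oo,
        \sum_i \sum_j `|W n i j - sK (tau n i) (tau n j)| <= e * n%:R ^+ 2].

Section HomDensity.
Variables (W : forall n, 'I_n -> 'I_n -> R).
Hypothesis W01 : \forall n \near \oo, forall i j, 0 <= @W n i j <= 1.
Hypothesis W_approx : kernel_approx W.
Variables (v : nat) (E : seq (nat * nat)).
Hypothesis E_ok : forall e, e \in E -> [&& (e.1 < v)%N, (e.2 < v)%N & e.1 != e.2].

Definition hom_weight n (x0 : 'I_n) (u : seq 'I_n) : R :=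
  \prod_(e <- E) @W n (nth x0 u e.1) (nth x0 u e.2).

(** Density over injective maps. The picked vertex is the default value for [nth], and there is one
    as soon as n > 0. *)
Definition hom_density n : R :=
  if [pick x : 'I_n] is Some x0 then
    n%:R ^- v * \sum_(u : v.-tuple 'I_n | uniq u) hom_weight x0 u
  else 0.

Lemma hom_weight01 n (x0 : 'I_n) u : (forall i j, 0 <= @W n i j <= 1) ->
  0 <= hom_weight x0 u <= 1.
Proof.
move=> w01; rewrite /hom_weight; elim: E => [|e s IHs].
  by rewrite big_nil ler01 lexx.
rewrite big_cons; have /andP[a0 a1] := w01 (nth x0 u e.1) (nth x0 u e.2).
by have /andP[b0 b1] := IHs; rewrite mulr_ge0 //= mulr_ile1.
Qed.

Lemma hom_density01 : \forall n \near \oo, 0 <= hom_density n <= 1.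
Proof.
near=> n.
have w01 : forall i j, 0 <= @W n i j <= 1 by near: n.
rewrite /hom_density; case: pickP => [x0 _|_]; last by rewrite lexx ler01.
have n0 : 0 < n%:R :> R by rewrite ltr0n; case: (n) x0 => // -[].
have nv0 : 0 < n%:R ^+ v :> R by rewrite exprn_gt0.
apply/andP; split.
  rewrite mulr_ge0 ?invr_ge0 ?(ltW nv0) //.
  by apply: sumr_ge0 => u _; case/andP: (hom_weight01 x0 u w01).
rewrite mulrC ler_pdivrMr // mul1r.
apply: (@le_trans _ _ (\sum_(u : v.-tuple 'I_n) 1)).
  rewrite [leRHS](bigID (fun u : v.-tuple 'I_n => uniq u)) /=.
  apply: ler_wpDr; first exact: sumr_ge0.
  by apply: ler_sum => u _; case/andP: (hom_weight01 x0 u w01).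
by rewrite sumr_const card_tuple card_ord -[1 *+ _]/(_%:R) natrX.
Unshelve. all: by end_near. Qed.

Lemma hom_density_cvg : exists c : R, hom_density @ \oo --> c.
Proof.
apply: approx_cvg => e e0.
(* A third of [e] for each of the three errors [AB], [BC], [CC]; the share of the step kernel is
   divided among the edges, with a successor in case [E] is empty. *)
have d0 : 0 < e / 3 / (size E).+1%:R by rewrite !divr_gt0.
have [K [tau [w [sK [sK01 tau_cvg W_close]]]]] := W_approx d0.
pose G (c : seq 'I_K.+1) := \prod_(e <- E) sK (nth ord0 c e.1) (nth ord0 c e.2).
(* [C n] is the density of the step kernel over all maps, a polynomial in the frequencies of the
   steps. *)
pose C n := \sum_(c : v.-tuple 'I_K.+1)
  (\prod_(j <- c) (#|[pred i | tau n i == j]|%:R / n%:R)) * G c.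
pose Cl := \sum_(c : v.-tuple 'I_K.+1) (\prod_(j <- c) w j) * G c.
have C_cvg : C @ \oo --> Cl.
  apply: cvg_sum_seq => c; apply: cvgMr_tmp.
  elim: (tval c) => [|j s IHs].
    by under eq_fun do rewrite big_nil; rewrite big_nil; exact: cvg_cst.
  by under eq_fun do rewrite big_cons; rewrite big_cons; apply: cvgM.
exists Cl; near=> n.
have w01 : forall i j, 0 <= @W n i j <= 1 by near: n.
have n0 : (0 < n)%N by near: n; exact: nbhs_infty_gt.
have n0R : 0 < n%:R :> R by rewrite ltr0n.
rewrite /hom_density; case: pickP => [x0 _|/(_ (Ordinal n0)) //].
have nv0 : 0 < n%:R ^+ v :> R by rewrite exprn_gt0.
set A := \sum_(u | _) _.
pose B := \sum_(u : v.-tuple 'I_n) hom_weight x0 u.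
have AB : `|n%:R ^- v * A - n%:R ^- v * B| <= e / 3.
  rewrite -mulrBr normrM ger0_norm ?invr_ge0 ?(ltW nv0) // mulrC ler_pdivrMr //.
  rewrite /B (bigID (fun u : v.-tuple 'I_n => uniq u)) /= -/A opprD addNKr normrN.
  apply: (@le_trans _ _ (\sum_(u : v.-tuple 'I_n | ~~ uniq u) 1)).
    apply: le_trans (ler_norm_sum _ _ _) _; apply: ler_sum => u _.
    by have /andP[a0 a1] := hom_weight01 x0 u w01; rewrite ger0_norm.
  apply: le_trans (tuple_sum_nonuniq _ _ _) _; rewrite card_ord.
  have nbig : (v ^ 2)%:R / (e / 3) <= n%:R by near: n; exact: nbhs_infty_ger.
  have [v0|vpos] := posnP v.
    by rewrite v0 exp0n // mul0r expr0 mulr1 divr_ge0 // ltW.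
  rewrite -[in leRHS](prednK vpos) exprS mulrA; apply: ler_wpM2r; first by rewrite exprn_ge0.
  by rewrite mulrC -ler_pdivrMr ?divr_gt0.
(* Exchanging the factors of the product one at a time costs one L^1 distance per edge. The ends of
   an edge are distinct, so the other coordinates are summed freely. *)
have BC : `|n%:R ^- v * B - C n| <= e / 3.
  have -> : C n = n%:R ^- v * \sum_(u : v.-tuple 'I_n) G (map (tau n) u).
    rewrite tuple_sum_map /C mulr_sumr; apply: eq_bigr => c _.
    rewrite mulrA; congr (_ * _).
    have -> : n%:R ^- v = (n%:R^-1 : R) ^+ size c by rewrite size_tuple exprVn.
    elim: (tval c) => [|j s IHs]; first by rewrite !big_nil expr0 mulr1.
    by rewrite !big_cons IHs /= exprS; ring.
  rewrite -mulrBr normrM ger0_norm ?invr_ge0 ?(ltW nv0) // mulrC ler_pdivrMr //.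
  rewrite -sumrB; apply: le_trans (ler_norm_sum _ _ _) _.
  apply: (@le_trans _ _ (\sum_(u : v.-tuple 'I_n) \sum_(e <- E)
     `|@W n (nth x0 u e.1) (nth x0 u e.2) -
       sK (tau n (nth x0 u e.1)) (tau n (nth x0 u e.2))|)).
    apply: ler_sum => u _; rewrite /hom_weight /G.
    have -> : \prod_(e <- E) sK (nth ord0 (map (tau n) u) e.1) (nth ord0 (map (tau n) u) e.2) =
       \prod_(e <- E) sK (tau n (nth x0 u e.1)) (tau n (nth x0 u e.2)).
      apply: eq_big_seq => a /E_ok /and3P[a1 a2 _].
      by rewrite !(nth_map x0) ?size_tuple.
    exact: (prod_diff_le E (f := fun a => @W n (nth x0 u a.1) (nth x0 u a.2))
      (g := fun a => sK (tau n (nth x0 u a.1)) (tau n (nth x0 u a.2)))).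
  rewrite exchange_big /=.
  have Wc : \sum_i \sum_j `|@W n i j - sK (tau n i) (tau n j)| <=
     e / 3 / (size E).+1%:R * n%:R ^+ 2 by near: n.
  apply: (@le_trans _ _ (\sum_(a <- E) (e / 3 / (size E).+1%:R * n%:R ^+ v))).
    rewrite big_seq [leRHS]big_seq; apply: ler_sum => a /E_ok /and3P[a1 a2 a12].
    rewrite (tuple_sum_nth2 x0 (fun i j => `|@W n i j - sK (tau n i) (tau n j)|)) //.
    rewrite card_ord; apply: le_trans (ler_wpM2l _ Wc) _; first by rewrite exprn_ge0.
    rewrite mulrCA -exprD addn2.
    case: (v) a1 a2 a12 => [|[|v']] //=.
    by case: (a) => -[|?] [|?].
  rewrite big_const_seq count_predT iter_addr addr0 -[_ *+ _]mulr_natr mulrAC.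
  apply: ler_wpM2r; first exact: ltW.
  rewrite mulrAC ler_pdivrMr ?ltr0Sn //; apply: ler_wpM2l; last by rewrite ler_nat.
  by rewrite divr_ge0 ?ltW.
have CC : `|C n - Cl| <= e / 3.
  rewrite distrC; near: n; move/cvgrPdist_le : C_cvg; apply; by rewrite divr_gt0.
have -> : n%:R ^- v * A - Cl = (n%:R ^- v * A - n%:R ^- v * B) +
   ((n%:R ^- v * B - C n) + (C n - Cl)) by ring.
apply: le_trans (ler_normD _ _) _.
have := ler_normD (n%:R ^- v * B - C n) (C n - Cl).
lra.
Unshelve. all: by end_near. Qed.

Lemma hom_density_limit : exists2 c : R, 0 <= c <= 1 & hom_density @ \oo --> c.
Proof.
have [c hc] := hom_density_cvg; exists c => //; exact: cvg_bounds hc hom_density01.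
Qed.

End HomDensity.
End Approximation.

(** * Limits of the moments *)

Lemma closed_walk_map (T T' : eqType) (f : T -> T') (l : seq T) :
  {in l &, injective f} -> closed_walk (map f l) = closed_walk l.
Proof.
case: l => //= x s inj; rewrite last_map.
by apply/eqP/eqP => [/inj->|-> //] //; rewrite ?mem_head ?mem_last.
Qed.

Lemma closed_walk_code (T : eqType) (l : seq T) : closed_walk (code l) = closed_walk l.
Proof.
apply: closed_walk_map => x y xl yl /(congr1 (nth x (rev (undup l)))).
by rewrite !nth_index ?mem_rev ?mem_undup.
Qed.

Section MomentLimit.
Variables (R : realType) (Q : forall n, 'I_n * 'I_n -> R) (eta : nat -> R).
Hypothesis Q01 : forall n (e : 'I_n * 'I_n), 0 <= Q e <= 1.
Hypothesis eta01 : \forall n \near \oo, 0 <= eta n <= 1.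
Hypothesis eta_to0 : eta @ \oo --> (0 : R).
Hypothesis var_le : \forall n \near \oo, forall e : 'I_n * 'I_n,
  eta n ^+ 2 * (Q e * (1 - Q e)) <= n%:R^-1.

Definition profile n (i j : 'I_n) : R := n%:R * xi_moment (@Q n) (eta n) (nrm (i, j)) 2.

Hypothesis profile_approx : kernel_approx profile.

Lemma profile01 : \forall n \near \oo, forall i j : 'I_n, 0 <= profile i j <= 1.
Proof.
near=> n => i j.
have e01 : 0 <= eta n <= 1 by near: n.
have vle : forall e : 'I_n * 'I_n, eta n ^+ 2 * (Q e * (1 - Q e)) <= n%:R^-1 by near: n.
have n0 : 0 < n%:R :> R by rewrite ltr0n; case: (n) i => // -[].
have /andP[h0 h1] := xi_moment2_bounds (@Q01 n) vle (nrm (i, j)).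
by rewrite /profile mulr_ge0 ?(ltW n0) //= mulrC -ler_pdivlMr // div1r.
Unshelve. all: by end_near. Qed.

Section Pattern.
Variables (k : nat) (g : k.+1.-tuple nat).

Definition pattern_term n : R := n%:R^-1 *
  \sum_(l : k.+1.-tuple 'I_n | closed_walk l && (code l == g)) walk_moment (@Q n) (eta n) l.

Let v := size (undup g).
Let E := undup (edges g).

Lemma pattern_invalid n : (code g != g) || ~~ closed_walk g -> pattern_term n = 0.
Proof.
move=> h; rewrite /pattern_term big_pred0 ?mulr0 // => l; apply/negbTE.
apply: contraL h => /andP[cl /eqP lg].
by rewrite negb_or negbK -{1 2}lg code_code lg eqxx /= negbK -lg closed_walk_code.
Qed.

Hypotheses (gg : code g = g) (closed_g : closed_walk g).

Lemma pattern_label_lt a : a \in tval g -> (a < v)%N.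
Proof. by move=> ag; apply: mem_code_lt; rewrite gg. Qed.

Lemma label_inj n (x0 : 'I_n) (u : v.-tuple 'I_n) : uniq u ->
  {in tval g &, injective (nth x0 u)}.
Proof.
move=> uu a b /pattern_label_lt av /pattern_label_lt bv /eqP.
by rewrite nth_uniq ?size_tuple // => /eqP.
Qed.

Lemma pattern_termE n (x0 : 'I_n) : pattern_term n = n%:R^-1 *
  \sum_(u : v.-tuple 'I_n | uniq u) walk_moment (@Q n) (eta n) (map (nth x0 u) g).
Proof.
rewrite /pattern_term; congr (_ * _).
rewrite -(sum_code x0 (walk_moment (@Q n) (eta n)) gg); apply: eq_bigl => l.
apply: andb_idl => /eqP lg.
by rewrite -closed_walk_code lg.
Qed.

Lemma walk_moment_map n (x0 : 'I_n) (u : v.-tuple 'I_n) : uniq u ->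
  walk_moment (@Q n) (eta n) (map (nth x0 u) g) =
  \prod_(e <- E) xi_moment (@Q n) (eta n) (map_edge (nth x0 u) e) (count_mem e (edges g)).
Proof.
move=> uu; have inj := @label_inj n x0 u uu.
rewrite /walk_moment undup_edges_map // big_map; apply: eq_big_seq => e.
by rewrite mem_undup => eg; rewrite count_edges_map.
Qed.

Lemma pattern_loop n e : e \in edges g -> e.1 = e.2 -> pattern_term n = 0.
Proof.
move=> eg ee; case: (pickP (fun _ : 'I_n => true)) => [x0 _|n0]; last first.
  by rewrite /pattern_term big1 ?mulr0 // => l; have := n0 (thead l).
rewrite (pattern_termE x0) big1 ?mulr0 // => u uu.
apply: (@walk_moment_loop _ _ _ _ _ (map_edge (nth x0 u) e)).
  by rewrite edges_map map_f.
by rewrite /map_edge ee /nrm /= minxx maxxx.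
Qed.

Lemma pattern_single n e : count_mem e (edges g) = 1%N -> pattern_term n = 0.
Proof.
move=> c1; case: (pickP (fun _ : 'I_n => true)) => [x0 _|n0]; last first.
  by rewrite /pattern_term big1 ?mulr0 // => l; have := n0 (thead l).
rewrite (pattern_termE x0) big1 ?mulr0 // => u uu.
apply: (@walk_moment_single _ _ _ _ _ (map_edge (nth x0 u) e)).
rewrite count_edges_map //; first exact: label_inj.
by rewrite -has_pred1 has_count c1.
Qed.

Lemma pattern_le : (forall e, e \in edges g -> 2 <= count_mem e (edges g))%N ->
  \forall n \near \oo, `|pattern_term n| <=
    n%:R^-1 * n%:R ^+ v * (n%:R^-1 ^+ size E * eta n ^+ (k - (size E).*2)).
Proof.
move=> c2; near=> n.
have e01 : 0 <= eta n <= 1 by near: n.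
have vle : forall e : 'I_n * 'I_n, eta n ^+ 2 * (Q e * (1 - Q e)) <= n%:R^-1 by near: n.
have n0 : (0 < n)%N by near: n; exact: nbhs_infty_gt.
pose x0 := Ordinal n0; have n0R : 0 < n%:R :> R by rewrite ltr0n.
have /andP[e0 _] := e01.
rewrite (pattern_termE x0) normrM ger0_norm ?invr_ge0 ?ler0n // -mulrA.
apply: ler_wpM2l; first by rewrite invr_ge0.
set b := n%:R^-1 ^+ size E * _.
have b0 : 0 <= b by rewrite mulr_ge0 // exprn_ge0 // invr_ge0.
apply: (@le_trans _ _ (\sum_(u : v.-tuple 'I_n) b)); last first.
  by rewrite sumr_const card_tuple card_ord -[_ *+ (_ ^ _)]mulr_natl natrX.
rewrite [leRHS](bigID (fun u : v.-tuple 'I_n => uniq u)) /=.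
apply: ler_wpDr; first exact: sumr_ge0.
apply: le_trans (ler_norm_sum _ _ _) _; apply: ler_sum => u uu.
have inj := @label_inj n x0 u uu.
apply: le_trans (walk_moment_le (@Q01 n) e01 vle _) _.
  move=> e; rewrite edges_map => /mapP[a ag ->].
  by rewrite -edges_map count_edges_map // c2.
rewrite undup_edges_map // size_map size_edges size_map size_tuple.
exact: lexx.
Unshelve. all: by end_near. Qed.

(** With e edges the bound is [n^(v - 1 - e) eta^(k - 2 e)]. If [v <= e] a factor 1/n is left over;
    otherwise [v = e + 1], the powers of n cancel, and [2 e < k] leaves a factor [eta]. *)
Lemma pattern_negligible : (forall e, e \in edges g -> 2 <= count_mem e (edges g))%N ->
  ((v <= size E) || ((size E).*2 < k))%N ->
  pattern_term @ \oo --> (0 : R).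
Proof.
move=> c2 small.
have inv0 : (fun n : nat => n%:R^-1 : R) @ \oo --> (0 : R).
  by apply/gtr0_cvgV0; [near=> n; rewrite ltr0n; near: n; exact: nbhs_infty_gt
    | exact: cvgr_idn].
have sum0 : (fun n : nat => n%:R^-1 + eta n : R) @ \oo --> (0 : R).
  by rewrite -[X in _ --> X](addr0 0); exact: cvgD.
apply: norm_cvg0; apply: (squeeze_cvgr _ (cvg_cst 0) sum0).
have hle := pattern_le c2.
near=> n; rewrite normr_ge0 /=.
have n0 : (0 < n)%N by near: n; exact: nbhs_infty_gt.
have n0R : 0 < n%:R :> R by rewrite ltr0n.
have n1R : 1 <= n%:R :> R by rewrite ler1n.
have /andP[e0 e1] : 0 <= eta n <= 1 by near: n.
have hn : `|pattern_term n| <=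
    n%:R^-1 * n%:R ^+ v * (n%:R^-1 ^+ size E * eta n ^+ (k - (size E).*2)) by near: n.
apply: le_trans hn _.
have nE0 : 0 < n%:R ^+ size E :> R by rewrite exprn_gt0.
have [vE|vE] := leqP v (size E).
  apply: (@le_trans _ _ (n%:R^-1)); last by rewrite lerDl.
  have h1 : n%:R ^+ v * n%:R^-1 ^+ size E <= 1 :> R.
    by rewrite exprVn ler_pdivrMr // mul1r ler_weXn2l.
  have h0 : 0 <= n%:R ^+ v * n%:R^-1 ^+ size E :> R.
    by rewrite mulr_ge0 // exprn_ge0 // invr_ge0.
  rewrite -mulrA ler_piMr ?invr_ge0 ?(ltW n0R) // mulrA.
  by apply: mulr_ile1 => //; rewrite ?exprn_ge0 ?exprn_ile1.
have vE1 : v = (size E).+1 by apply/eqP; rewrite eqn_leq vE size_undup_edges.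
move: small; rewrite leqNgt vE /= => kE.
apply: (@le_trans _ _ (eta n)); last by rewrite lerDr invr_ge0 ltW.
rewrite vE1 exprS mulKf ?gt_eqF // mulrA exprVn divff ?gt_eqF // mul1r.
by apply: ler_iXnr; rewrite ?subn_gt0.
Unshelve. all: by end_near. Qed.

Lemma pattern_tree : (forall e, e \in edges g -> 2 <= count_mem e (edges g))%N ->
  (size E < v)%N -> (k <= (size E).*2)%N ->
  v = (size E).+1 /\ forall e, e \in edges g -> count_mem e (edges g) = 2%N.
Proof.
move=> c2 vE kE; split.
  by apply/eqP; rewrite eqn_leq vE size_undup_edges.
have := sum_count_undup (edges g); rewrite size_edges size_tuple /= -/E => sumk.
have sum2 : (\sum_(e <- E) 2 = (size E).*2)%N.
  by elim: (E) => [|e s IHs]; rewrite ?big_nil // big_cons IHs.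
have : (\sum_(e <- E) (count_mem e (edges g) - 2) == 0)%N.
  rewrite big_seq sumnB; last by move=> e; rewrite mem_undup => /c2.
  by rewrite -!big_seq sumk sum2 subn_eq0.
rewrite sum_nat_seq_eq0 => /allP h e eg.
have := h e; rewrite mem_undup => /(_ eg); rewrite subn_eq0 /= => le2.
by apply/eqP; rewrite eqn_leq le2 c2.
Qed.

(** Since [v = e + 1], the prefactor 1/n and the e variances, each 1/n times a value of [profile],
    combine to the normalisation [n^-v] of a homomorphism density. *)
Lemma pattern_hom : (forall e, e \in edges g -> e.1 != e.2) ->
  v = (size E).+1 -> (forall e, e \in edges g -> count_mem e (edges g) = 2%N) ->
  exists2 c : R, 0 <= c <= 1 & pattern_term @ \oo --> c.
Proof.
move=> loopless vE c2.
have E_ok e : e \in E -> [&& (e.1 < v)%N, (e.2 < v)%N & e.1 != e.2].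
  rewrite mem_undup => eg; rewrite loopless // andbT.
  have := edges_nrm eg; case: e eg => a b /= eg ee.
  have /mem_edges/andP[ag bg] : nrm (a, b) \in edges g by rewrite ee.
  by rewrite !pattern_label_lt.
have [c c01 hc] := hom_density_limit profile01 profile_approx E_ok.
exists c => //; apply: cvg_trans hc; apply: near_eq_cvg; near=> n.
have n0 : (0 < n)%N by near: n; exact: nbhs_infty_gt.
have n0R : n%:R != 0 :> R by rewrite pnatr_eq0 -lt0n.
rewrite /hom_density; case: pickP => [x0 _|/(_ (Ordinal n0)) //].
rewrite (pattern_termE x0) !mulr_sumr; apply: eq_bigr => u uu.
rewrite walk_moment_map // /hom_weight.
have nvE : n%:R ^- v = n%:R^-1 * n%:R ^- size E :> R by rewrite vE exprS invfM.
transitivity (n%:R^-1 * (n%:R ^- size E * \prod_(e <- E)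
   profile (nth x0 u e.1) (nth x0 u e.2))); first by rewrite nvE mulrA.
congr (_ * _).
transitivity (\prod_(e <- E) (n%:R^-1 * profile (nth x0 u e.1) (nth x0 u e.2))).
  by elim: (E) => [|e s IHs]; rewrite ?big_nil ?expr0 ?invr1 ?mul1r // !big_cons -IHs
    exprS invfM; ring.
apply: eq_big_seq => e; rewrite mem_undup => eg.
by rewrite /profile mulKf // c2.
Unshelve. all: by end_near. Qed.

End Pattern.

(** The disjunction keeps a Boolean word for every pattern with nonzero limit; counting these words
    bounds the limit moments. *)
Lemma pattern_limit k (g : k.+1.-tuple nat) : exists c : R,
  [/\ 0 <= c <= 1, pattern_term g @ \oo --> c &
      c = 0 \/ exists b : k.-tuple bool, tval g = (decode b).1.1].
Proof.
have zero : (forall n, pattern_term g n = 0) -> exists c : R,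
  [/\ 0 <= c <= 1, pattern_term g @ \oo --> c &
      c = 0 \/ exists b : k.-tuple bool, tval g = (decode b).1.1].
  move=> h; exists 0; split; [by rewrite lexx ler01| |by left].
  by rewrite (_ : pattern_term g = cst 0); [exact: cvg_cst|apply/funext].
have [inv|] := boolP ((code g != g) || ~~ closed_walk g).
  by apply: zero => n; exact: pattern_invalid.
rewrite negb_or !negbK => /andP[/eqP gg cg].
have [/hasP[e eg /eqP ee]|/hasPn loopless] := boolP (has (fun e => e.1 == e.2) (edges g)).
  by apply: zero => n; exact: (pattern_loop gg cg _ eg ee).
have [/hasP[e eg /eqP ee]|/hasPn nosingle] :=
  boolP (has (fun e => count_mem e (edges g) == 1%N) (edges g)).
  by apply: zero => n; exact: (pattern_single gg cg _ ee).
have c2 e : e \in edges g -> (2 <= count_mem e (edges g))%N.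
  move=> eg; have := nosingle e eg.
  have : (0 < count_mem e (edges g))%N by rewrite -has_count has_pred1.
  by case: (count_mem e (edges g)) => [|[]].
have [small|] := boolP ((size (undup g) <= size (undup (edges g))) ||
   ((size (undup (edges g))).*2 < k))%N.
  exists 0; split; [by rewrite lexx ler01| |by left].
  exact: pattern_negligible.
rewrite negb_or -!ltnNge ltnS => /andP[vE kE].
have [vE1 c22] := pattern_tree c2 vE kE.
have [c c01 hc] := pattern_hom gg cg loopless vE1 c22.
exists c; split=> //; right.
have good : tree_walk g.
  apply: tree_walkP => // e; have [eg|/count_memPn -> //] := boolP (e \in edges g).
  by rewrite c22.
have szb : size (new_steps g) == k by rewrite size_new_steps size_tuple.
exists (Tuple szb) => /=; rewrite -[LHS]gg.
by case: (g) good => -[|a s] // _ /= /code_decode.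
Qed.

Definition mean_moment k n : R :=
  n%:R^-1 * Ex (@Q n) (fun x => \tr (mxpow (centered (@Q n) (eta n) x) k)).

(** The labels of a walk with [k.+1] vertices are below [k.+1], so patterns are indexed by a finite
    type and [inord] changes no label. *)
Definition code_tuple (T : eqType) k (l : k.+1.-tuple T) : k.+1.-tuple 'I_k.+1 :=
  [tuple inord (nth 0%N (code l) i) | i < k.+1].

Lemma val_code_tuple (T : eqType) k (l : k.+1.-tuple T) :
  map val (code_tuple l) = code l.
Proof.
have szc : size (code l) = k.+1 by rewrite size_map size_tuple.
apply: (@eq_from_nth _ 0%N) => [|i]; rewrite size_map size_tuple ?szc // => ik.
rewrite (nth_map ord0) ?size_tuple // -[i]/(val (Ordinal ik)) -tnth_nth tnth_mktuple.
rewrite /= inordK //; apply: (@leq_trans (size (undup l))).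
  by apply: mem_code_lt; rewrite mem_nth // szc.
by rewrite -[X in (_ <= X)%N](size_tuple l) size_undup.
Qed.

Lemma mean_moment_patterns k n : mean_moment k n =
  \sum_(g : k.+1.-tuple 'I_k.+1) pattern_term (map_tuple val g) n.
Proof.
rewrite /mean_moment Ex_trace /pattern_term -mulr_sumr; congr (_ * _).
rewrite (partition_big (@code_tuple _ k) predT) //=; apply: eq_bigr => g _.
apply: eq_bigl => l; congr (_ && _); rewrite -val_code_tuple.
by apply/eqP/eqP => [<- //|/(inj_map val_inj)/val_inj].
Qed.

Lemma mean_moment_limit k : exists c : R,
  0 <= c <= 2 ^+ k /\ mean_moment k @ \oo --> c.
Proof.
have /choice[c hc] : forall g : k.+1.-tuple 'I_k.+1, exists c : R,
  [/\ 0 <= c <= 1, pattern_term (map_tuple val g) @ \oo --> c &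
      c = 0 \/ exists b : k.-tuple bool, tval (map_tuple val g) = (decode b).1.1].
  by move=> g; exact: pattern_limit.
exists (\sum_g c g); split; last first.
  rewrite (_ : mean_moment k = fun n => \sum_(g : k.+1.-tuple 'I_k.+1)
      pattern_term (map_tuple val g) n).
    by apply: cvg_sum_seq => g; have [] := hc g.
  by apply/funext => n; exact: mean_moment_patterns.
apply/andP; split; first by apply: sumr_ge0 => g _; have [/andP[]] := hc g.
(* Double counting: every contributing pattern is decoded from some word, and a word decodes to at
   most one pattern. *)
apply: (@le_trans _ _ (\sum_g \sum_(b : k.-tuple bool)
    (map val (g : k.+1.-tuple 'I_k.+1) == (decode b).1.1)%:R)).
  apply: ler_sum => g _; have [/andP[c0 c1] _ [->|[b /= gb]]] := hc g.
    exact: sumr_ge0.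
  by rewrite (bigD1 b) //= gb eqxx (le_trans c1) // lerDl sumr_ge0.
rewrite exchange_big /=; apply: (@le_trans _ _ (\sum_(b : k.-tuple bool) 1)).
  apply: ler_sum => b _; have [[g gb]|none] := pselect (exists g : k.+1.-tuple 'I_k.+1,
      map val g = (decode b).1.1); last first.
    rewrite big1 // => g _; case: eqP => // gb; case: none; by exists g.
  rewrite (bigD1 g) //= gb eqxx big1 ?addr0 // => g' g'g.
  case: eqP => // g'b; case/eqP: g'g; apply/val_inj/(inj_map val_inj).
  by rewrite g'b.
by rewrite sumr_const card_tuple card_bool -[1 *+ _]/(_%:R) natrX.
Qed.

End MomentLimit.

(** * The moment method *)

Section Bernstein.
Variable R : realType.

(* E f(K) for K binomial with parameters N and t, where s = 1 - t. *)
Fixpoint bernstein (A : comPzRingType) (inj : R -> A) (t s : A) N (f : nat -> R) : A :=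
  if N is N'.+1 then
    t * bernstein inj t s N' (fun k => f k.+1) + s * bernstein inj t s N' f
  else inj (f 0%N).

Local Notation bernR t N f := (@bernstein R id t (1 - t) N f).

Lemma bernstein_horner (t s : {poly R}) N f x :
  (bernstein polyC t s N f).[x] = @bernstein R id t.[x] s.[x] N f.
Proof. by elim: N f => [|N IHN] f /=; rewrite ?hornerC // !hornerE !IHN. Qed.

Lemma bernstein_le (t : R) N f g : 0 <= t <= 1 -> (forall k, f k <= g k) ->
  bernR t N f <= bernR t N g.
Proof.
move=> /andP[t0 t1]; elim: N f g => [|N IHN] f g fg /=; first exact: fg.
by apply: lerD; apply: ler_wpM2l; rewrite ?subr_ge0 // IHN.
Qed.

Lemma bernstein_affine (t a b : R) N f :
  bernR t N (fun k => a + b * f k) = a + b * bernR t N f.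
Proof. by elim: N f => [//|N IHN] f /=; rewrite !IHN; ring. Qed.

(** Squared bias plus variance of the binomial law. The centre [c] is arbitrary because the
    induction shifts it. *)
Lemma bernstein_sqr (t c : R) N :
  bernR t N (fun k => (k%:R - c) ^+ 2) = (N%:R * t - c) ^+ 2 + N%:R * (t * (1 - t)).
Proof.
elim: N c => [|N IHN] c /=; first by rewrite !mul0r addr0.
have -> : (fun k : nat => (k.+1%:R - c) ^+ 2) = (fun k => (k%:R - (c - 1)) ^+ 2).
  by apply/funext => k; rewrite -natr1; ring.
by rewrite !IHN -natr1; ring.
Qed.

(** [t = (x + 4) / 8] maps the window to [0, 1]. The quadratic modulus averages to the binomial
    variance: 64 is the square of the window length 8, and [t (1 - t) <= 1/4] leaves 16. *)
Lemma bernstein_approx (h : R -> R) (e c : R) N : 0 <= c -> (0 < N)%N ->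
  (forall x y, `|h y - h x| <= e + c * (y - x) ^+ 2) ->
  exists p : {poly R}, forall x, -4 <= x <= 4 -> `|h x - p.[x]| <= e + c * 16 / N%:R.
Proof.
move=> c0 N0 hc; have N0R : 0 < N%:R :> R by rewrite ltr0n.
pose tp : {poly R} := 8^-1 *: ('X + 4%:P).
pose f k := h (8 * (k%:R / N%:R) - 4).
exists (bernstein polyC tp (1 - tp) N f) => x /andP[x0 x1].
set t := 8^-1 * (x + 4).
have tpx : tp.[x] = t by rewrite /tp hornerZ hornerD hornerX hornerC.
rewrite bernstein_horner hornerD hornerN tpx -polyC1 hornerC.
have t0 : 0 <= t by rewrite /t; lra.
have t1 : t <= 1 by rewrite /t; lra.
have t01 : 0 <= t <= 1 by rewrite t0.
have xt : x = 8 * t - 4 by rewrite /t; lra.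
pose b := e + c * 64 / N%:R ^+ 2 * bernR t N (fun k => (k%:R - N%:R * t) ^+ 2).
have fle k : `|f k - h x| <= e + c * 64 / N%:R ^+ 2 * (k%:R - N%:R * t) ^+ 2.
  apply: le_trans (hc _ _) _; rewrite lerD2l.
  rewrite (_ : 8 * (k%:R / N%:R) - 4 - x = 8 / N%:R * (k%:R - N%:R * t)).
    by rewrite exprMn expr_div_n !mulrA le_eqVlt; apply/orP; left; apply/eqP; ring.
  by rewrite xt; field; rewrite gt_eqF.
have bE : b = e + c * 64 / N%:R * (t * (1 - t)).
  by rewrite /b bernstein_sqr subrr expr0n add0r; field; rewrite gt_eqF.
have up : bernR t N f <= h x + b.
  rewrite /b addrA -bernstein_affine; apply: bernstein_le => // k.
  by have := fle k; rewrite ler_norml; lra.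
have lo : h x - b <= bernR t N f.
  rewrite /b opprD addrA -mulNr -bernstein_affine; apply: bernstein_le => // k.
  rewrite mulNr; have := fle k.
  by set w := c * 64 / _ * _; rewrite ler_norml => /andP[h1 _]; lra.
have tt : t * (1 - t) <= 1 / 4 by have := sqr_ge0 (t - 1 / 2); rewrite expr2; lra.
have ble : b <= e + c * 16 / N%:R.
  rewrite bE lerD2l (_ : c * 16 / N%:R = c * 64 / N%:R * (1 / 4)); last by field; rewrite gt_eqF.
  by apply: ler_wpM2l => //; rewrite divr_ge0 ?(ltW N0R) // mulr_ge0.
by rewrite ler_norml; lra.
Qed.

End Bernstein.

Section MomentMethod.
Variable R : realType.

Record positive_functional (L : (R -> R) -> R) : Prop := {
  pf_lin : forall a f g, L (fun x => a * f x + g x) = a * L f + L g;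
  pf_le : forall f g, (forall x, f x <= g x) -> L f <= L g;
  pf_one : L (fun=> 1) = 1 }.

Section Functional.
Variable L : (R -> R) -> R.
Hypothesis posL : positive_functional L.

Lemma pf_zero : L (fun=> 0) = 0.
Proof.
have := pf_lin posL 1 (fun=> 0) (fun=> 0).
by rewrite [X in L X](_ : _ = fun=> 0); [lra | apply/funext => x; rewrite mulr0 addr0].
Qed.

Lemma pf_scale a f : L (fun x => a * f x) = a * L f.
Proof.
rewrite -[RHS]addr0 -pf_zero -(pf_lin posL); congr L.
by apply/funext => x; rewrite addr0.
Qed.

Lemma pf_horner (p : {poly R}) :
  L (fun x => p.[x]) = \sum_(i < size p) p`_i * L (fun x => x ^+ i).
Proof.
under eq_fun do rewrite horner_coef.
elim: (size p) => [|m IHm].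
  by under eq_fun do rewrite big_ord0; rewrite big_ord0 pf_zero.
under eq_fun do rewrite big_ord_recr /= addrC.
by rewrite (pf_lin posL) IHm big_ord_recr /= addrC.
Qed.

Lemma pf_dist f g b : (forall x, `|f x - g x| <= b x) -> `|L f - L g| <= L b.
Proof.
move=> fgb; have h1 : L f <= L (fun x => 1 * b x + g x).
  by apply: (pf_le posL) => x; have := fgb x; rewrite ler_norml; lra.
have h2 : L g <= L (fun x => 1 * b x + f x).
  by apply: (pf_le posL) => x; have := fgb x; rewrite ler_norml; lra.
by move: h1 h2; rewrite !(pf_lin posL) ler_norml; lra.
Qed.

End Functional.

Variables (L : nat -> (R -> R) -> R) (m : nat -> R).
Hypothesis posL : forall n, (0 < n)%N -> positive_functional (L n).
Hypothesis m_le : forall k, 0 <= m k <= 2 ^+ k.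
Hypothesis L_moment : forall k, L n (fun x => x ^+ k) @[n --> \oo] --> m k.

Lemma poly_growth (p : {poly R}) (D : nat) x : (size p <= D)%N -> 4 <= `|x| ->
  `|p.[x]| <= (\sum_(i < size p) `|p`_i|) * x ^+ D.*2.
Proof.
move=> pD x4; rewrite horner_coef; apply: le_trans (ler_norm_sum _ _ _) _.
rewrite mulr_suml; apply: ler_sum => i _; rewrite normrM; apply: ler_wpM2l => //.
rewrite -muln2 mulnC exprM -[x ^+ 2]real_normK ?num_real // -exprM normrX.
apply: ler_weXn2l; first by lra.
by apply: leq_trans (ltnW (ltn_ord i)) _; rewrite mul2n -addnn (leq_trans pD) // leq_addr.
Qed.

Lemma bound_succ (x : R) : x <= (Num.bound x).+1%:R.
Proof.
have [x0|/ltW x0] := lerP 0 x; last exact: le_trans x0 (ler0n _ _).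
by apply: ltW; apply: lt_trans (archi_boundP x0) _; rewrite ltr_nat.
Qed.

(** The measures need not have bounded support. Moments of order [2^k] make the mass outside [-4, 4]
    harmless: beyond 4 the polynomial is dominated through the factor [(x^2 / 16)^K >= 1], whose
    cost is about [4^(D + K) / 16^K], small for large [K]. *)
Lemma moment_method (h h' : R -> R) A B : smooth_test h h' A B ->
  (forall x, 0 <= h x <= 1) -> exists c : R, L n h @[n --> \oo] --> c.
Proof.
move=> hh h01; apply: approx_cvg => e e0.
pose e1 : R := e / 5; have e10 : 0 < e1 by rewrite divr_gt0.
have [A0 B0] := smooth_test_ge0 hh.
pose c := B + A ^+ 2 / e1.
have c0 : 0 <= c by rewrite addr_ge0 // divr_ge0 ?sqr_ge0 ?ltW.
pose N := (Num.bound (c * 16 / e1)).+1.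
have cN : c * 16 / N%:R <= e1.
  rewrite ler_pdivrMr ?ltr0n // [e1 * _]mulrC -ler_pdivrMr //; exact: bound_succ.
have [p hp] := bernstein_approx (N := N) c0 isT (smooth_test_continuity hh e10).
pose D := size p; pose C := 1 + \sum_(i < size p) `|p`_i|.
have C0 : 0 < C by rewrite ltr_pwDl // sumr_ge0.
pose K := (Num.bound (C * 2 * 4 ^+ D / e1)).+1.
have CK : C * 2 * 4 ^+ D / 4 ^+ K <= e1.
  have K4 : (K%:R : R) <= 4 ^+ K.
    by rewrite -natrX ler_nat ltnW // ltn_expl.
  rewrite ler_pdivrMr ?exprn_gt0 // [e1 * _]mulrC -ler_pdivrMr //.
  by apply: le_trans K4; exact: bound_succ.
(* A bound for [|h - p|] on the whole line whose mean only involves one even moment: the constant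
   serves inside [-4, 4], the power outside. *)
pose b x := e1 * 2 + C / 16 ^+ K * x ^+ (D + K).*2.
have x0 (x : R) k : 0 <= x ^+ k.*2 by rewrite -muln2 mulnC exprM exprn_ge0 // sqr_ge0.
have hb x : `|h x - p.[x]| <= b x.
  have C16 : 0 <= C / 16 ^+ K by rewrite divr_ge0 ?ltW // exprn_gt0.
  have [x4|x4] := lerP `|x| 4.
    apply: le_trans (hp x _) _; first by rewrite -ler_norml.
    have : 0 <= C / 16 ^+ K * x ^+ (D + K).*2 by rewrite mulr_ge0.
    by rewrite /b -/c; lra.
  have big : C * x ^+ D.*2 <= b x.
    rewrite /b; apply: ler_wpDl; first by rewrite mulr_ge0 ?ltW.
    rewrite doubleD exprD -!mulrA; apply: ler_wpM2l; first exact: ltW.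
    rewrite mulrCA ler_peMr // mulrC ler_pdivlMr ?exprn_gt0 // mul1r.
    rewrite -muln2 mulnC exprM lerXn2r ?nnegrE ?sqr_ge0 //.
    by rewrite -real_normK ?num_real //; nra.
  apply: le_trans big; apply: le_trans (ler_normB _ _) _.
  rewrite /C mulrDl mul1r; apply: lerD; last by apply: poly_growth => //; exact: ltW.
  apply: (@le_trans _ _ 1); first by rewrite ger0_norm; case/andP: (h01 x).
  by rewrite -muln2 mulnC exprM -real_normK ?num_real // exprn_ege1 //; nra.
pose l := \sum_(i < size p) p`_i * m i.
have L_p : (fun n => \sum_(i < size p) p`_i * L n (fun x => x ^+ i)) @ \oo --> l.
  by apply: cvg_sum_seq => i; apply: cvgMl_tmp; exact: L_moment.
exists l; near=> n.
have n0 : (0 < n)%N by near: n; exact: nbhs_infty_gt.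
have pL := posL n0.
have h1 : `|L n h - L n (fun x => p.[x])| <= L n b by exact: pf_dist.
have h2 : `|L n (fun x => p.[x]) - l| <= e1.
  rewrite (pf_horner pL) distrC; near: n; move/cvgrPdist_le : L_p; exact.
have h3 : L n (fun x => x ^+ (D + K).*2) <= 2 ^+ (D + K).*2 * 2.
  have : `|m (D + K).*2 - L n (fun x => x ^+ (D + K).*2)| <= 1.
    by near: n; have /cvgrPdist_le := @L_moment (D + K).*2; exact.
  rewrite ler_norml => /andP[h3 _].
  have /andP[_ mle] := m_le (D + K).*2.
  have : 1 <= 2 ^+ (D + K).*2 :> R by rewrite exprn_ege1 // ler1n.
  lra.
have h4 : L n b <= 3 * e1.
  have -> : L n b = e1 * 2 + C / 16 ^+ K * L n (fun x => x ^+ (D + K).*2).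
    rewrite -[b]/(fun x => b x).
    have -> : (fun x => b x) = (fun x => C / 16 ^+ K * x ^+ (D + K).*2 + e1 * 2 * 1).
      by apply/funext => x; rewrite /b addrC mulr1.
    rewrite (pf_lin pL _ _ (fun=> e1 * 2 * 1)) (pf_scale pL (e1 * 2) (fun=> 1)).
    by rewrite (pf_one pL) mulr1 addrC.
  have : C / 16 ^+ K * L n (fun x => x ^+ (D + K).*2) <= e1; last by lra.
  apply: le_trans CK; apply: le_trans (ler_wpM2l _ h3) _.
    by rewrite divr_ge0 ?ltW // exprn_gt0.
  rewrite -muln2 mulnC exprM exprD (_ : 2 ^+ 2 = 4 :> R); last by ring.
  rewrite (_ : (16 : R) = 4 * 4) ?exprMn; last by ring.
  rewrite le_eqVlt; apply/orP; left; apply/eqP.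
  by field; rewrite gt_eqF // exprn_gt0.
rewrite (_ : L n h - l = (L n h - L n (fun x => p.[x])) + (L n (fun x => p.[x]) - l)).
  apply: le_trans (ler_normD _ _) _; rewrite /e1 in h2 h4 *; lra.
by ring.
Unshelve. all: by end_near. Qed.

End MomentMethod.

(** * The limiting measure *)

Section LimitMeasure.
Variables (R : realType) (G : rat -> rat -> R).
Hypothesis G01 : forall a b, a < b -> 0 <= G a b <= 1.
Hypothesis G_top : forall e : R, 0 < e ->
  exists M : R, forall a b, a < b -> M <= ratr a -> 1 - e <= G a b.
Hypothesis G_bot : forall e : R, 0 < e ->
  exists M : R, forall a b, a < b -> ratr b <= M -> G a b <= e.

(** [G a b] stands for the limit along the ramp from [a] to [b]. The strict inequality [x < ratr a]
    makes the infimum right-continuous in [x]. *)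
Definition ramp_values (x : R) : set R :=
  [set y | exists a b : rat, [/\ x < ratr a, a < b & y = G a b]].

Definition limit_cdf (x : R) : R := inf (ramp_values x).

Lemma rat_between (x y : R) : x < y -> exists a : rat, x < ratr a < y.
Proof. by move=> /rat_in_itvoo[a]; rewrite in_itv /=; exists a. Qed.

Lemma ramp_values_neq0 x : ramp_values x !=set0.
Proof.
have /rat_between[a /andP[xa _]] : x < x + 1 by rewrite ltrDl.
by exists (G a (a + 1)), a, (a + 1); split=> //; rewrite ltrDl.
Qed.

Lemma ramp_values_ge0 x : lbound (ramp_values x) 0.
Proof. by move=> _ [a [b [_ ab ->]]]; case/andP: (G01 ab). Qed.

Lemma ramp_values_has_inf x : has_inf (ramp_values x).
Proof. by split; [exact: ramp_values_neq0|exists 0; exact: ramp_values_ge0]. Qed.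

Lemma limit_cdf_le x a b : x < ratr a -> a < b -> limit_cdf x <= G a b.
Proof.
move=> xa ab; apply: ge_inf; first by exists 0; exact: ramp_values_ge0.
by exists a, b.
Qed.

Lemma limit_cdf_approx x e : 0 < e ->
  exists a b, [/\ x < ratr a, a < b & G a b < limit_cdf x + e].
Proof.
move=> e0; have [_ [a [b [xa ab ->]]] h] := inf_adherent e0 (ramp_values_has_inf x).
by exists a, b.
Qed.

Lemma limit_cdf_ge x c : (forall a b, x < ratr a -> a < b -> c <= G a b) ->
  c <= limit_cdf x.
Proof.
move=> h; apply: lb_le_inf; first exact: ramp_values_neq0.
by move=> _ [a [b [xa ab ->]]]; exact: h.
Qed.

Lemma limit_cdf_ge0 x : 0 <= limit_cdf x.
Proof. by apply: limit_cdf_ge => a b _ /G01/andP[]. Qed.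

Lemma limit_cdf_le1 x : limit_cdf x <= 1.
Proof.
have [a [b [xa ab _]]] := limit_cdf_approx x ltr01.
by apply: le_trans (limit_cdf_le xa ab) _; case/andP: (G01 ab).
Qed.

Lemma limit_cdf_nondecreasing : {homo limit_cdf : x y / x <= y}.
Proof.
move=> x y xy; apply: limit_cdf_ge => a b ya ab.
by apply: limit_cdf_le => //; exact: le_lt_trans ya.
Qed.

Lemma limit_cdf_right_continuous x : limit_cdf y @[y --> x^'+] --> limit_cdf x.
Proof.
apply/cvgrPdist_le => e e0; have [a [b [xa ab h]]] := limit_cdf_approx x e0.
near=> y; have xy : x < y by near: y; exact: nbhs_right_gt.
have ya : y < ratr a by near: y; exact: nbhs_right_lt.
have h1 := limit_cdf_le ya ab; have h2 := limit_cdf_nondecreasing (ltW xy).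
by rewrite ler_norml; lra.
Unshelve. all: by end_near. Qed.

Lemma limit_cdf_pinfty : limit_cdf y @[y --> +oo] --> (1 : R).
Proof.
apply/cvgrPdist_le => e e0; have [M hM] := G_top e0.
near=> y; have My : M <= y by near: y; apply: nbhs_pinfty_ge; exact: num_real.
have h1 := limit_cdf_le1 y.
have h2 : 1 - e <= limit_cdf y.
  by apply: limit_cdf_ge => a b ya ab; apply: hM => //; lra.
by rewrite ler_norml; lra.
Unshelve. all: by end_near. Qed.

Lemma limit_cdf_ninfty : limit_cdf y @[y --> -oo] --> (0 : R).
Proof.
apply/cvgrPdist_le => e e0; have [M hM] := G_bot e0.
near=> y; have My : y <= M - 2 by near: y; apply: nbhs_ninfty_le; exact: num_real.
have /rat_between[a /andP[ya aM]] : y < M - 1 by lra.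
have /rat_between[b /andP[ab bM]] : ratr a < M by lra.
have h1 := limit_cdf_ge0 y.
have {}ab : a < b by rewrite -(ltr_rat R).
have h2 := limit_cdf_le ya ab; have h3 := hM a b ab (ltW bM).
by rewrite ler_norml; lra.
Unshelve. all: by end_near. Qed.

Lemma limit_measure : exists mu : probability (measurableTypeR R) R,
  forall x, mu `]-oo, x]%classic = (limit_cdf x)%:E.
Proof.
pose cum := isCumulative.Build R _ R limit_cdf
  limit_cdf_nondecreasing limit_cdf_right_continuous.
pose bnd := isCumulativeBounded.Build R 0 1 limit_cdf limit_cdf_ninfty limit_cdf_pinfty.
pose f : cumulativeBounded (0 : R) 1 := HB.pack limit_cdf cum bnd.
exists (lebesgue_stieltjes_measure f) => x.
by rewrite -[RHS](cdf_lebesgue_stieltjes_id f).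
Qed.

(** Continuity of [mu] from below along [x - 1 / (k + 1)]: without an atom at [x], the open and the
    closed half-line have the same mass. *)
Lemma left_limit (mu : probability (measurableTypeR R) R) x e :
  (forall x, mu `]-oo, x]%classic = (limit_cdf x)%:E) -> mu [set x] = 0%E -> 0 < e ->
  exists2 y, y < x & limit_cdf x - e <= limit_cdf y.
Proof.
move=> muE mux e0; pose A k : set (measurableTypeR R) := `]-oo, x - k.+1%:R^-1]%classic.
have bigA : \bigcup_k A k = `]-oo, x[%classic.
  apply/seteqP; split=> t /=.
    move=> [k _]; rewrite /A /= !in_itv /=; move/le_lt_trans; apply.
    by rewrite ltrBlDr ltrDl invr_gt0.
  rewrite in_itv /= => tx; have xt : 0 < x - t by rewrite subr_gt0.
  exists (Num.bound (x - t)^-1) => //; rewrite /A /= in_itv /= lerBrDl -lerBrDr.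
  rewrite -[leRHS]invrK lef_pV2 ?posrE ?invr_gt0 //; apply: ltW.
  by apply: lt_trans (archi_boundP _) _; rewrite ?invr_ge0 ?ltW // ltr_nat.
have A_cvg : mu (A k) @[k --> \oo] --> mu (\bigcup_k A k).
  apply: nondecreasing_cvg_mu; [by move=> k; exact: measurable_itv|by rewrite bigA; exact: measurable_itv|].
  move=> m n mn; apply/subsetPset => t; rewrite /A /= !in_itv /= => /le_trans; apply.
  by rewrite lerD2l lerN2 lef_pV2 ?posrE // ler_nat.
have muA : mu (\bigcup_k A k) = (limit_cdf x)%:E.
  rewrite bigA -muE -(setUitv1 true) // measureU //=; first by rewrite mux adde0.
  by apply/seteqP; split => t //= []; rewrite in_itv /= => tx tE; move: tx; rewrite tE ltxx.
have F_cvg : limit_cdf (x - k.+1%:R^-1) @[k --> \oo] --> limit_cdf x.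
  have /fine_cvg : (limit_cdf (x - k.+1%:R^-1))%:E @[k --> \oo] --> (limit_cdf x)%:E.
    by rewrite -muA; under eq_fun do rewrite -muE; exact: A_cvg.
  exact.
have /cvgrPdist_le /(_ e e0) [N _ hN] := F_cvg.
exists (x - N.+1%:R^-1); first by rewrite ltrBlDr ltrDl invr_gt0.
by have := hN N (leqnn N); rewrite ler_norml /=; lra.
Qed.

(** Sandwich between a ramp starting right of [x], close to the infimum that defines [limit_cdf x],
    and a ramp placed between [y] and [x], whose limit is at least [limit_cdf y]; the absence of an
    atom brings [limit_cdf y] close to [limit_cdf x]. *)
Lemma weak_convergence (mu : probability (measurableTypeR R) R)
    (F : nat -> R -> R) (S : nat -> (R -> R) -> R) :
  (forall x, mu `]-oo, x]%classic = (limit_cdf x)%:E) ->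
  (forall n x (a b : rat), a < b -> x <= ratr a -> F n x <= S n (ramp (ratr a) (ratr b))) ->
  (forall n x (a b : rat), a < b -> ratr b <= x -> S n (ramp (ratr a) (ratr b)) <= F n x) ->
  (forall a b : rat, a < b -> S n (ramp (ratr a) (ratr b)) @[n --> \oo] --> G a b) ->
  converges_weakly F mu.
Proof.
move=> muE F_le F_ge S_cvg x mux; rewrite muE /=.
apply/cvgrPdist_le => e e0; have e2 : 0 < e / 2 by rewrite divr_gt0.
have [a [b [xa ab hG]]] := limit_cdf_approx x e2.
have [y yx hy] := left_limit muE mux e2.
have [a' /andP[ya' a'x]] := rat_between yx.
have [b' /andP[ab' b'x]] := rat_between a'x.
rewrite ltr_rat in ab'.
near=> n.
have h1 : `|G a b - S n (ramp (ratr a) (ratr b))| <= e / 2.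
  by near: n; have /cvgrPdist_le := S_cvg _ _ ab; apply.
have h2 : `|G a' b' - S n (ramp (ratr a') (ratr b'))| <= e / 2.
  by near: n; have /cvgrPdist_le := S_cvg _ _ ab'; apply.
have h3 := F_le n x a b ab (ltW xa).
have h4 := F_ge n x a' b' ab' (ltW b'x).
have h5 := limit_cdf_le ya' ab'.
move: h1 h2; rewrite !ler_norml; lra.
Unshelve. all: by end_near. Qed.

End LimitMeasure.

(** * Approximation of the variance profile *)

Section UniformTail.
Variables (d : nat -> nat) (good : nat -> nat -> nat -> Prop).
Hypothesis d_to_oo : d @ \oo --> \oo.
Hypothesis good_seq : forall k l : nat -> nat, is_class d k -> is_class d l ->
  k @ \oo --> \oo -> l @ \oo --> \oo -> (\forall n \near \oo, k n != l n) ->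
  \forall n \near \oo, good n (k n) (l n).

(* Counterexamples along a sparse sequence of indices n are completed by the classes
   d n - 1 and d n - 2 into sequences of classes that contradict good_seq. *)
Lemma uniform_tail : exists M, \forall n \near \oo, forall k l,
  (M <= k < d n)%N -> (M <= l < d n)%N -> k != l -> good n k l.
Proof.
apply: contrapT => /forallNP nogood.
pose bad n m := exists kl : nat * nat, [/\ (m <= kl.1 < d n)%N, (m <= kl.2 < d n)%N,
  kl.1 != kl.2 & ~ good n kl.1 kl.2].
have /choice[g hg] : forall mN : nat * nat, exists n, (mN.2 <= n)%N /\ bad n mN.1.
  move=> [m N] /=; apply: contrapT => /forallNP h; apply: (nogood m).
  exists N => // n /= Nn k l hk hl kl; apply: contrapT => ngood.
  by apply: (h n); split=> //; exists (k, l).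
(* [r m] is an index with a counterexample beyond [m]. Strict growth of [r] assigns at most one
   counterexample to each n. *)
pose r := fix r m := if m is m'.+1 then g (m, (r m').+1) else g (0%N, 0%N).
have r_bad m : bad (r m) m.
  by case: m => [|m]; [have [] := hg (0%N, 0%N)|have [] := hg (m.+1, (r m).+1)].
have r_lt m : (r m < r m.+1)%N by have [] := hg (m.+1, (r m).+1).
have r_mono : {homo r : m n / (m <= n)%N}.
  move=> m n; elim: n => [|n IHn]; first by rewrite leqn0 => /eqP ->.
  by rewrite leq_eqVlt ltnS => /predU1P[-> //|/IHn/leq_trans]; apply; exact: ltnW.
have r_ge m : (m <= r m)%N by elim: m => // m IHm; exact: leq_ltn_trans IHm (r_lt m).
have r_inj m m' : r m = r m' -> m = m'.
  have r_ltn a b : (a < b)%N -> (r a < r b)%N.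
    by move=> ab; apply: leq_trans (r_lt a) _; exact: r_mono.
  by move=> e; case: (ltngtP m m') => // /r_ltn; rewrite e ltnn.
have /choice[kl hkl] : forall n, exists kl : nat * nat,
    (forall m, r m = n -> [/\ (m <= kl.1 < d n)%N, (m <= kl.2 < d n)%N,
       kl.1 != kl.2 & ~ good n kl.1 kl.2]) /\
    ((forall m, r m <> n) -> kl = ((d n).-1, (d n).-2)).
  move=> n; have [[m rm]|nr] := pselect (exists m, r m = n).
    have [kl] := r_bad m; rewrite rm => hkl; exists kl; split; last by move/(_ m).
    by move=> m' rm'; have <- : m = m' by apply: r_inj; rewrite rm rm'.
  exists ((d n).-1, (d n).-2); split=> // m rm; case: nr; by exists m.
move/cvgnyPge : d_to_oo => d_ge.
have kl_ge m : \forall n \near \oo,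
    [/\ (m <= (kl n).1 < d n)%N, (m <= (kl n).2 < d n)%N & (kl n).1 != (kl n).2].
  near=> n; have dn : (m.+2 <= d n)%N by near: n; exact: d_ge.
  have [h1 h2] := hkl n.
  have [[m' rm]|nr] := pselect (exists m', r m' = n).
    have [k1 l1 kl1 _] := h1 _ rm.
    have mm' : (m <= m')%N.
      rewrite leqNgt; apply/negP => /ltnW /r_mono; rewrite rm leqNgt => /negP; apply.
      by near: n; exact: nbhs_infty_gt.
    case/andP: k1 => k1 k2; case/andP: l1 => l1 l2.
    by split=> //; rewrite (leq_trans mm').
  rewrite h2 /=; last by move=> m1 rm; case: nr; exists m1.
  have mdn : (m.+1 < d n)%N by [].
  split; [lia|lia|]; apply/eqP; lia.
have near_lt (k : nat -> nat) :
    (forall m, \forall n \near \oo, (m <= k n < d n)%N) -> is_class d k /\ k @ \oo --> \oo.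
  move=> hk; split; first by apply: filterS (hk 0%N) => n /andP[].
  by apply/cvgnyPge => m; apply: filterS (hk m) => n /andP[].
have [ck k_oo] : is_class d (fun n => (kl n).1) /\ (fun n => (kl n).1) @ \oo --> \oo.
  by apply: near_lt => m; apply: filterS (kl_ge m) => n [].
have [cl l_oo] : is_class d (fun n => (kl n).2) /\ (fun n => (kl n).2) @ \oo --> \oo.
  by apply: near_lt => m; apply: filterS (kl_ge m) => n [].
have [|N _ hN] := good_seq ck cl k_oo l_oo.
  by apply: filterS (kl_ge 0%N) => n [].
have [_ _ _] := (hkl (r N)).1 N erefl; apply; exact: hN (r_ge N).
Unshelve. all: by end_near. Qed.

End UniformTail.

Section ClassApproximation.
Variable R : realType.

(** A bad class costs its mass twice, as a row and as a column; an uncontrolled diagonal block costs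
    only the square of its mass. *)
Lemma weighted_error_le D (a : nat -> R) (err : nat -> nat -> R) (e : R) (bad diag : pred nat) :
  (forall k, 0 <= a k) -> \sum_(k < D) a k = 1 ->
  (forall k l, (k < D)%N -> (l < D)%N ->
    err k l <= e + (bad k)%:R + (bad l)%:R + (diag k && (k == l))%:R) ->
  \sum_(k < D) \sum_(l < D) a k * a l * err k l <=
    e + 2 * (\sum_(k < D | bad k) a k) + \sum_(k < D | diag k) a k ^+ 2.
Proof.
move=> a0 a1 err_le.
apply: (@le_trans _ _ (\sum_(k < D) \sum_(l < D) (a k * a l * e + a k * a l * (bad k)%:R +
    a k * a l * (bad l)%:R + a k * a l * (diag k && (k == l :> nat))%:R))).
  apply: ler_sum => k _; apply: ler_sum => l _; rewrite -!mulrDr.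
  by apply: ler_wpM2l; [exact: mulr_ge0|exact: err_le].
under eq_bigr => k _ do rewrite !big_split /=.
rewrite !big_split /= le_eqVlt; apply/orP; left; apply/eqP.
have sum1 (f : nat -> R) : \sum_(k < D) \sum_(l < D) a k * a l * f k = \sum_(k < D) a k * f k.
  apply: eq_bigr => k _; under eq_bigr => l _ do rewrite mulrAC.
  by rewrite -mulr_sumr a1 mulr1.
have sum2 (f : nat -> R) : \sum_(k < D) \sum_(l < D) a k * a l * f l = \sum_(k < D) a k * f k.
  rewrite exchange_big /= -[RHS]sum1; apply: eq_bigr => k _; apply: eq_bigr => l _.
  by rewrite (mulrC (a l)).
have sumb (P : pred nat) : \sum_(k < D) a k * (P k)%:R = \sum_(k < D | P k) a k.
  by rewrite [RHS]big_mkcond; apply: eq_bigr => k _; case: (P k); rewrite ?mulr1 ?mulr0.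
rewrite (sum1 (fun=> e)) (sum1 (fun k => (bad k)%:R)) (sum2 (fun l => (bad l)%:R)) !sumb.
rewrite -mulr_suml a1 mul1r mulr_natl mulr2n -!addrA; do 3!congr (_ + _).
rewrite [RHS]big_mkcond; apply: eq_bigr => k _; rewrite (bigD1 k) //= eqxx andbT.
rewrite big1 ?addr0; last first.
  by move=> l lk; rewrite (_ : (k == l :> nat) = false) ?andbF ?mulr0 // eq_sym; exact/negbTE.
by case: (diag k); rewrite ?mulr1 ?mulr0.
Qed.

Variables (d : nat -> nat) (a : nat -> nat -> R) (V : nat -> nat -> nat -> R).
Variables (alpha : nat -> R) (s : nat -> nat -> R).
Hypothesis d_to_oo : d @ \oo --> \oo.
Hypothesis a_ge0 : forall n k, 0 <= a n k.
Hypothesis a_sum : \forall n \near \oo, \sum_(k < d n) a n k = 1.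
Hypothesis a_lim : forall k, a n k @[n --> \oo] --> alpha k.
Hypothesis V01 : \forall n \near \oo, forall k l, (k < d n)%N -> (l < d n)%N -> 0 <= V n k l <= 1.
Hypothesis V_lim : forall k l, V n k l @[n --> \oo] --> s k l.
Hypothesis s01 : forall k l, 0 <= s k l <= 1.
Hypothesis alpha_ge0 : forall k, 0 <= alpha k.

(** Through [minn] all classes from [K] on are merged into a single step. *)
Definition class_approx : Prop := forall e : R, 0 < e ->
  exists K (S : nat -> nat -> R), (forall k l, 0 <= S k l <= 1) /\
    \forall n \near \oo, \sum_(k < d n) \sum_(l < d n)
      a n k * a n l * `|V n k l - S (minn k K) (minn l K)| <= e.

Lemma near_finite K (P : nat -> nat -> Prop) :
  (forall k, (k < K)%N -> \forall n \near \oo, P n k) ->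
  \forall n \near \oo, forall k, (k < K)%N -> P n k.
Proof.
elim: K => [|K IHK] hP; first by apply: nearW.
have h1 := IHK (fun k kK => hP k (ltnW kK)); have h2 := hP K (ltnSn K).
near=> n => k; rewrite ltnS leq_eqVlt => /predU1P[->|kK]; first by near: n.
have H : forall k, (k < K)%N -> P n k by near: n.
exact: H.
Unshelve. all: by end_near. Qed.

Lemma near_head K e : 0 < e ->
  \forall n \near \oo, forall k, (k < K)%N -> forall l, (l < K)%N -> `|V n k l - s k l| <= e.
Proof.
move=> e0; apply: near_finite => k kK; apply: near_finite => l lK.
by have /cvgrPdist_le/(_ e e0) := @V_lim k l; apply: filterS => n; rewrite distrC.
Qed.

Lemma near_partial_sum K (P : pred nat) e : 0 < e ->
  \forall n \near \oo, `|\sum_(k < K | P k) a n k - \sum_(k < K | P k) alpha k| <= e.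
Proof.
move=> e0.
have h : (fun n => \sum_(k < K | P k) a n k) @ \oo --> \sum_(k < K | P k) alpha k.
  under eq_fun do rewrite big_mkcond /=; rewrite big_mkcond.
  by apply: cvg_sum_seq => k; case: ifP => _; [exact: a_lim|exact: cvg_cst].
by have /cvgrPdist_le/(_ e e0) := h; apply: filterS => n; rewrite distrC.
Qed.

Lemma dist01 (x y : R) : 0 <= x <= 1 -> 0 <= y <= 1 -> `|x - y| <= 1.
Proof. by move=> /andP[x0 x1] /andP[y0 y1]; rewrite ler_norml; lra. Qed.

(** The merged classes have negligible mass, so the kernel is set to 0 there. The budget is
    [e / 2 + 2 * (e / 8 + e / 8)]: the head, then the tail mass of the limit weights and its error
    at n. *)
Lemma class_approx1 : condition1 alpha -> class_approx.
Proof.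
move=> [_ alpha1] e e0; have e8 : 0 < e / 8 by rewrite divr_gt0.
have [K _ hK] : \forall K \near \oo, `|1 - series alpha K| <= e / 8.
  by have /cvgrPdist_le/(_ _ e8) := alpha1.
have {hK} := hK K (leqnn K); rewrite /series /= big_mkord => alphaK.
pose S k l := if (k < K)%N && (l < K)%N then s k l else 0.
have S01 k l : 0 <= S k l <= 1 by rewrite /S; case: ifP => _; rewrite ?lexx ?ler01.
exists K, S; split => //; near=> n.
have an1 : \sum_(k < d n) a n k = 1 by near: n.
have v01 : forall k l, (k < d n)%N -> (l < d n)%N -> 0 <= V n k l <= 1 by near: n.
have head : forall k, (k < K)%N -> forall l, (l < K)%N -> `|V n k l - s k l| <= e / 2.
  by near: n; apply: near_head; rewrite divr_gt0.
have dK : (K <= d n)%N by near: n; move/cvgnyPge : d_to_oo; exact.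
have := @weighted_error_le _ (a n) (fun k l => `|V n k l - S (minn k K) (minn l K)|)
   (e / 2) (fun k => K <= k)%N pred0 (a_ge0 n) an1.
rewrite [X in _ + X]big_pred0 // addr0 => h; apply: le_trans (h _) _.
  move=> k l kd ld; rewrite addr0; case: (leqP K k) => kK /=.
    apply: le_trans (dist01 (v01 k l kd ld) (S01 _ _)) _.
    by have : 0 <= (K <= l)%:R :> R by []; lra.
  case: (leqP K l) => lK /=.
    by apply: le_trans (dist01 (v01 k l kd ld) (S01 _ _)) _; lra.
  by rewrite /S kK lK !addr0; exact: head.
have headsum : `|\sum_(k < K) a n k - \sum_(k < K) alpha k| <= e / 8.
  by near: n; exact: (near_partial_sum K predT).
have : \sum_(k < d n | (K <= k)%N) a n k = 1 - \sum_(k < K) a n k.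
  rewrite -an1 (big_ord_widen _ (a n) dK) [X in _ = X - _](bigID (fun k : 'I_ _ => k < K)%N) /=.
  by rewrite addrAC subrr add0r; apply: eq_bigl => k; rewrite -leqNgt.
move: alphaK headsum; rewrite !ler_norml; lra.
Unshelve. all: by end_near. Qed.

Variables (s0 : R) (sk0 : nat -> R).
Hypothesis s0_01 : 0 <= s0 <= 1.
Hypothesis sk0_01 : forall k, 0 < alpha k -> 0 <= sk0 k <= 1.
Hypothesis Vsym : \forall n \near \oo, forall k l, (k < d n)%N -> (l < d n)%N ->
  V n k l = V n l k.
Hypothesis a_tail : forall e, 0 < e -> exists M, \forall n \near \oo, forall k,
  (M <= k < d n)%N -> a n k <= e.
Hypothesis V_tail : forall e, 0 < e -> exists M, \forall n \near \oo, forall k l,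
  (M <= k < d n)%N -> (M <= l < d n)%N -> k != l -> `|V n k l - s0| <= e.
Hypothesis V_large : forall k e, 0 < alpha k -> 0 < e ->
  exists M, \forall n \near \oo, forall l, (M <= l < d n)%N -> `|V n k l - sk0 k| <= e.

(** The merged classes may keep positive mass, but they behave as one class with value [s0] inside
    and [sk0 k] towards a large class [k]. Their diagonal blocks escape the bound [V_tail]; since
    each tail class has mass at most [e], the squared masses sum to at most [e]. The total
    [e + 2 * (2 * e) + e] explains [e' / 6]. *)
Lemma class_approx2 (alpha_sum : R) : series alpha @ \oo --> alpha_sum -> class_approx.
Proof.
move=> alpha_cvg e' e'0; pose e := e' / 6; have e0 : 0 < e by rewrite divr_gt0.
have e2 : 0 < e / 2 by rewrite divr_gt0.
have [K _ hK] : \forall K \near \oo, `|alpha_sum - series alpha K| <= e / 2.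
  by have /cvgrPdist_le/(_ _ e2) := alpha_cvg.
pose Tl k := if 0 < alpha k then sk0 k else 0.
have Tl01 k : 0 <= Tl k <= 1.
  by rewrite /Tl; case: ifP => [/sk0_01 //|_]; rewrite lexx ler01.
pose S k l := if (k < K)%N then (if (l < K)%N then s k l else Tl k)
  else (if (l < K)%N then Tl l else s0).
have S01 k l : 0 <= S k l <= 1 by rewrite /S; case: ifP => _; case: ifP.
exists K, S; split=> //.
have [M1 hM1] := a_tail e0; have [M2 hM2] := V_tail e0.
have [M3 hM3] : exists M3, forall k, (k < K)%N -> 0 < alpha k ->
    \forall n \near \oo, forall l, (M3 <= l < d n)%N -> `|V n k l - sk0 k| <= e.
  have /choice[m hm] : forall k, exists M, 0 < alpha k -> \forall n \near \oo, forall l,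
      (M <= l < d n)%N -> `|V n k l - sk0 k| <= e.
    move=> k; have [k0|k0] := boolP (0 < alpha k); last by exists 0%N.
    by have [M hM] := V_large k0 e0; exists M.
  exists (\max_(k < K) m k)%N => k kK k0; apply: filterS (hm k k0) => n h l /andP[ml ld].
  apply: h; rewrite ld andbT; apply: leq_trans ml.
  exact: (leq_bigmax (Ordinal kK)).
pose M := maxn K (maxn M1 (maxn M2 M3)).
(* Between [K] and [M] the tail estimates are not yet available, and for a head class with
   [alpha k = 0] the value 0 of [Tl] is a placeholder. The former have limit mass at most [e], a
   piece of a convergent series, the latter have none. *)
pose bad k := (K <= k < M)%N || ((k < K)%N && (alpha k == 0)).
near=> n.
have an1 : \sum_(k < d n) a n k = 1 by near: n.
have v01 : forall k l, (k < d n)%N -> (l < d n)%N -> 0 <= V n k l <= 1 by near: n.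
have vsym : forall k l, (k < d n)%N -> (l < d n)%N -> V n k l = V n l k by near: n.
have head : forall k, (k < K)%N -> forall l, (l < K)%N -> `|V n k l - s k l| <= e.
  by near: n; apply: near_head.
have dM : (M <= d n)%N by near: n; move/cvgnyPge : d_to_oo; exact.
have tail1 : forall k, (M1 <= k < d n)%N -> a n k <= e by near: n.
have tail2 : forall k l, (M2 <= k < d n)%N -> (M2 <= l < d n)%N -> k != l ->
  `|V n k l - s0| <= e by near: n.
have tail3 : forall k, (k < K)%N -> 0 < alpha k -> forall l, (M3 <= l < d n)%N ->
    `|V n k l - sk0 k| <= e.
  near: n; apply: near_finite => k kK; have [k0|k0] := boolP (0 < alpha k).
    by apply: filterS (hM3 k kK k0) => m h _.
  by apply: nearW => m k0'; case/negP: k0.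
have MK k : (M <= k)%N -> [/\ (K <= k)%N, (M1 <= k)%N, (M2 <= k)%N & (M3 <= k)%N].
  by rewrite /M !geq_max => /and4P[].
have := @weighted_error_le _ (a n) (fun k l => `|V n k l - S (minn k K) (minn l K)|)
   e bad (fun k => M <= k)%N (a_ge0 n) an1.
move=> h; apply: le_trans (h _) _ => {h}.
  move=> k l kd ld.
  have h1 := dist01 (v01 k l kd ld) (S01 (minn k K) (minn l K)).
  have bnat (b : bool) : 0 <= b%:R :> R by [].
  have [bk|nbk] := boolP (bad k).
    by have := bnat (bad l); have := bnat ((M <= k)%N && (k == l)); rewrite /=; lra.
  have [bl|nbl] := boolP (bad l).
    by have := bnat ((M <= k)%N && (k == l)); rewrite /=; lra.
  rewrite !addr0.
  have cases j : ~~ bad j -> (j < K)%N /\ 0 < alpha j \/ (M <= j)%N.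
    rewrite negb_or !negb_and -!ltnNge !ltnS => /andP[/orP[jK|Mj _]]; last by right.
    rewrite leqNgt jK /= => aj; left; split=> //.
    by rewrite lt0r aj alpha_ge0.
  have [[kK ak]|/[dup] Mk /MK[Kk M1k M2k M3k]] := cases k nbk;
  have [[lK al]|/[dup] Ml /MK[Kl M1l M2l M3l]] := cases l nbl.
  - rewrite (minn_idPl (ltnW kK)) (minn_idPl (ltnW lK)) /S kK lK.
    by have := head k kK l lK; have := bnat ((M <= k)%N && (k == l)); lra.
  - rewrite (minn_idPl (ltnW kK)) (minn_idPr Kl) /S kK ltnn /Tl ak.
    have := tail3 k kK ak l; rewrite M3l ld => /(_ erefl).
    by have := bnat ((M <= k)%N && (k == l)); lra.
  - rewrite (minn_idPr Kk) (minn_idPl (ltnW lK)) /S lK ltnn /Tl al vsym //.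
    have := tail3 l lK al k; rewrite M3k kd => /(_ erefl).
    by have := bnat ((M <= k)%N && (k == l)); lra.
  - move: h1; rewrite (minn_idPr Kk) (minn_idPr Kl) /S ltnn Mk /= => h1.
    case: eqVneq => [kl|kl] /=; first lra.
    by rewrite addr0; apply: tail2 => //; apply/andP.
have badsum : \sum_(k < d n | bad k) a n k <= 2 * e.
  have -> : \sum_(k < d n | bad k) a n k = \sum_(k < M | bad k) a n k.
    rewrite (big_ord_widen_cond _ _ (a n) dM); apply: eq_bigl => k.
    apply/esym/andb_idr; rewrite /bad => /orP[/andP[] //|/andP[kK _]].
    by apply: leq_trans kK _; rewrite leq_maxl.
  have near_bad : `|\sum_(k < M | bad k) a n k - \sum_(k < M | bad k) alpha k| <= e.
    by near: n; exact: near_partial_sum.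
  have : \sum_(k < M | bad k) alpha k <= e.
    have -> : \sum_(k < M | bad k) alpha k = series alpha M - series alpha K.
      rewrite /series /= !big_mkord (big_ord_widen M alpha (leq_maxl _ _)).
      rewrite [X in _ = X - _](bigID (fun k : 'I_ _ => k < K)%N) /= addrAC subrr add0r.
      rewrite [LHS](bigID (fun k : 'I_ _ => k < K)%N) /= big1 ?add0r; last first.
        by move=> k /andP[bk kK]; move: bk; rewrite /bad leqNgt kK /= => /eqP.
      apply: eq_bigl => k; rewrite /bad ltn_ord andbT -leqNgt.
      by case: (leqP K k) => _ /=; rewrite ?andbF ?andbT.
    have := hK M (leq_maxl _ _); have := hK K (leqnn K).
    by rewrite !ler_norml; lra.
  by move: near_bad; rewrite ler_norml; lra.
have diagsum : \sum_(k < d n | (M <= k)%N) a n k ^+ 2 <= e.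
  apply: (@le_trans _ _ (\sum_(k < d n) a n k * e)).
    rewrite big_mkcond; apply: ler_sum => k _; case: leqP => [Mk|_]; last first.
      by rewrite mulr_ge0 // ltW.
    rewrite expr2; apply: ler_wpM2l => //; apply: tail1.
    by have [_ -> _ _] := MK _ Mk; rewrite ltn_ord.
  by rewrite -mulr_suml an1 mul1r.
rewrite (_ : e' = 6 * e); first lra.
by rewrite /e; field.
Unshelve. all: by end_near. Qed.

End ClassApproximation.

(** * The block model *)

Section VertexClasses.
Variables (R : realType) (c : nat) (sz : nat -> nat).
Local Notation n := (\sum_(k < c) sz k)%N.

Definition vertex_class (i : nat) : nat :=
  find (fun k => i < class_start sz k.+1)%N (iota 0 c).

Lemma class_startS k : class_start sz k.+1 = (class_start sz k + sz k)%N.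
Proof. by rewrite /class_start big_ord_recr. Qed.

Lemma class_start_le k l : (k <= l)%N -> (class_start sz k <= class_start sz l)%N.
Proof.
move=> kl; rewrite -(subnK kl); elim: (l - k)%N => // m IHm.
by rewrite addSn class_startS (leq_trans IHm) // leq_addr.
Qed.

Lemma vertex_classP i : (i < n)%N -> (vertex_class i < c)%N /\ in_class sz (vertex_class i) i.
Proof.
move=> i_n; have hasP : has (fun k => i < class_start sz k.+1)%N (iota 0 c).
  case: c i_n => [|c'] i_n; first by rewrite big_ord0 in i_n.
  by apply/hasP; exists c'; [rewrite mem_iota /= ltnSn|exact: i_n].
have lt : (vertex_class i < c)%N by rewrite -[X in (_ < X)%N](size_iota 0) -has_find.
split=> //; have := nth_find 0%N hasP; rewrite -/(vertex_class i) nth_iota // add0n.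
rewrite /in_class => ->; rewrite andbT.
case E : (vertex_class i) lt => [|k] lt; first by rewrite /class_start big_ord0.
have := @before_find _ 0%N (fun k => i < class_start sz k.+1)%N (iota 0 c) k.
rewrite -/(vertex_class i) E ltnSn => /(_ isT); rewrite nth_iota ?(ltnW lt) //.
by rewrite add0n => /negbT; rewrite -leqNgt.
Qed.

Lemma in_class_uniq k i : (i < n)%N -> in_class sz k i -> vertex_class i = k.
Proof.
move=> /vertex_classP[_]; rewrite /in_class => /andP[h1 h2] /andP[h3 h4].
case: (ltngtP (vertex_class i) k) => // /class_start_le h.
  by have := leq_trans h2 (leq_trans h h3); rewrite ltnn.
by have := leq_trans h4 (leq_trans h h1); rewrite ltnn.
Qed.

Lemma sum_vertex_class (f : nat -> R) :
  \sum_(i < n) f (vertex_class i) = \sum_(k < c) (sz k)%:R * f k.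
Proof.
rewrite -(big_mkord predT (fun i => f (vertex_class i))) /=.
suff h m : (m <= c)%N -> \sum_(0 <= i < class_start sz m) f (vertex_class i) =
    \sum_(k < m) (sz k)%:R * f k by exact: h.
elim: m => [|m IHm] mc; first by rewrite /class_start !big_ord0 big_geq.
rewrite big_ord_recr /= -IHm ?(ltnW mc) //.
rewrite (big_cat_nat (n := class_start sz m)) //=; last exact: class_start_le.
congr (_ + _); rewrite (eq_big_nat _ _ (F2 := fun=> f m)).
  by rewrite sumr_const_nat class_startS addKn mulr_natl.
move=> i /andP[h1 h2]; rewrite (@in_class_uniq m) //; last by rewrite /in_class h1.
apply: leq_trans h2 _; exact: (@class_start_le m.+1 c).
Qed.

End VertexClasses.

Section ModelProfile.
Variables (R : realType) (d : nat -> nat) (sz : nat -> nat -> nat) (q : nat -> nat -> nat -> R).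
Hypothesis sizes : forall n, (\sum_(k < d n) sz n k)%N = n.
Hypothesis q01 : forall n k l, (k < d n)%N -> (l < d n)%N -> 0 <= q n k l <= 1.
Hypothesis q_sym : forall n k l, (k < d n)%N -> (l < d n)%N -> q n k l = q n l k.
Hypothesis p_omega : n%:R * max_prob (d n) (q n) @[n --> \oo] --> +oo.
Hypothesis p_to0 : max_prob (d n) (q n) @[n --> \oo] --> (0 : R).

Local Notation p n := (max_prob (d n) (q n)).
Local Notation cls n := (vertex_class (d n) (sz n)).
Local Notation V n := (variance_ratio (d n) (q n)).

(** Each unordered pair is represented by its increasing ordering; the other coordinates get
    parameter 0 and are constantly false. *)
Definition edge_prob n (e : 'I_n * 'I_n) : R :=
  if (e.1 < e.2)%N then q n (cls n e.1) (cls n e.2) else 0.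

Definition scale n : R := (sigma (d n) (q n) * Num.sqrt n%:R)^-1.

Lemma cls_lt n (i : 'I_n) : (cls n i < d n)%N.
Proof. by have [] := @vertex_classP (d n) (sz n) i; rewrite ?sizes. Qed.

Lemma edge_prob01 n (e : 'I_n * 'I_n) : 0 <= edge_prob e <= 1.
Proof.
by rewrite /edge_prob; case: ifP => _; rewrite ?lexx ?ler01 // q01 // cls_lt.
Qed.

Lemma q_le_p n k l : (k < d n)%N -> (l < d n)%N -> q n k l <= p n.
Proof.
move=> kd ld; apply: sup_ubound; last by exists k, l.
exists 1 => _ [k' [l' [kd' ld' ->]]]; by case/andP: (q01 kd' ld').
Qed.

Lemma p_near (A : R) : \forall n \near \oo,
  [/\ 0 < n%:R :> R, 0 < p n, p n <= 1 / 2 & A <= n%:R * p n].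
Proof.
have hp : \forall n \near \oo, p n <= 1 / 2.
  have /cvgrPdist_le/(_ (1 / 2)) := p_to0; rewrite divr_gt0 // => /(_ isT).
  by apply: filterS => n; rewrite sub0r normrN => /ler_normlP[_].
move/cvgryPge : p_omega => p_ge.
near=> n; have n0 : (0 < n)%N by near: n; exact: nbhs_infty_gt.
have n0R : 0 < n%:R :> R by rewrite ltr0n.
have p1 : 1 <= n%:R * p n by near: n; exact: p_ge.
have p0 : 0 < p n by rewrite -(pmulr_rgt0 _ n0R); lra.
by split=> //; near: n; [exact: hp|exact: p_ge].
Unshelve. all: by end_near. Qed.

Lemma sigma_sqr n : 0 <= p n <= 1 -> sigma (d n) (q n) ^+ 2 = p n * (1 - p n).
Proof. by move=> /andP[p0 p1]; rewrite sqr_sqrtr // mulr_ge0 // subr_ge0. Qed.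

Lemma scale_ge0 n : 0 <= scale n.
Proof. by rewrite invr_ge0 mulr_ge0 // sqrtr_ge0. Qed.

Lemma scale_sqr n : 0 <= p n <= 1 -> scale n ^+ 2 = (p n * (1 - p n) * n%:R)^-1.
Proof. by move=> p01; rewrite exprVn exprMn sigma_sqr // sqr_sqrtr. Qed.

Lemma scale_small (e : R) : 0 < e -> \forall n \near \oo, scale n <= e.
Proof.
move=> e0; near=> n.
have [n0 p0 p2 pA] : [/\ 0 < n%:R :> R, 0 < p n, p n <= 1 / 2 & 2 / e ^+ 2 <= n%:R * p n].
  by near: n; exact: p_near.
rewrite -(@ler_pXn2r _ 2) ?nnegrE ?scale_ge0 ?(ltW e0) // scale_sqr; last by apply/andP; lra.
have e20 : 0 < e ^+ 2 by rewrite exprn_gt0.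
rewrite -[leRHS]invrK lef_pV2 ?posrE ?invr_gt0 //; last first.
  by rewrite !mulr_gt0 // subr_gt0; lra.
have : 2 * (e ^+ 2)^-1 <= n%:R * p n by [].
set x := _^-1 => h; have : n%:R * p n * (1 / 2) <= n%:R * p n * (1 - p n).
  by apply: ler_wpM2l; [exact/ltW/mulr_gt0|lra].
lra.
Unshelve. all: by end_near. Qed.

Lemma scale_to0 : scale @ \oo --> (0 : R).
Proof.
apply/cvgrPdist_le => e e0; apply: filterS (scale_small e0) => n h.
by rewrite sub0r normrN ger0_norm // scale_ge0.
Qed.

Lemma scale01 : \forall n \near \oo, 0 <= scale n <= 1.
Proof. by apply: filterS (scale_small ltr01) => n ->; rewrite scale_ge0. Qed.

Lemma edge_prob_le n (e : 'I_n * 'I_n) : 0 <= p n -> edge_prob e <= p n.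
Proof.
by move=> p0; rewrite /edge_prob; case: ifP => _ //; apply: q_le_p; exact: cls_lt.
Qed.

(** [x (1 - x)] increases on [0, 1/2], and p is eventually in that range; hence the largest
    probability also gives the largest variance. *)
Lemma scale_var_le : \forall n \near \oo, forall e : 'I_n * 'I_n,
  scale n ^+ 2 * (edge_prob e * (1 - edge_prob e)) <= n%:R^-1.
Proof.
near=> n => e.
have [n0 p0 p2 _] : [/\ 0 < n%:R :> R, 0 < p n, p n <= 1 / 2 & 0 <= n%:R * p n].
  by near: n; exact: p_near.
have qp := edge_prob_le e (ltW p0); have /andP[q0 q1] := edge_prob01 e.
have pp : 0 < p n * (1 - p n) by rewrite mulr_gt0 // subr_gt0; lra.
rewrite scale_sqr; last by apply/andP; lra.
rewrite invfM mulrAC mulrC ler_piMr ?invr_ge0 ?(ltW n0) //.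
by rewrite mulrC ler_pdivrMr // mul1r; nra.
Unshelve. all: by end_near. Qed.

Lemma variance_ratio01 : \forall n \near \oo, forall k l, (k < d n)%N -> (l < d n)%N ->
  0 <= V n k l <= 1.
Proof.
near=> n => k l kd ld.
have [n0 p0 p2 _] : [/\ 0 < n%:R :> R, 0 < p n, p n <= 1 / 2 & 0 <= n%:R * p n].
  by near: n; exact: p_near.
have qp := q_le_p kd ld; have /andP[q0 q1] := q01 kd ld.
have pp : 0 < p n * (1 - p n) by rewrite mulr_gt0 // subr_gt0; lra.
rewrite /variance_ratio sigma_sqr; last by apply/andP; lra.
rewrite divr_ge0 ?(ltW pp) //=; last by rewrite mulr_ge0 // subr_ge0.
by rewrite ler_pdivrMr // mul1r; nra.
Unshelve. all: by end_near. Qed.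

Lemma variance_ratio_sym n k l : (k < d n)%N -> (l < d n)%N -> V n k l = V n l k.
Proof. by move=> kd ld; rewrite /variance_ratio q_sym. Qed.

Lemma profileE : \forall n \near \oo, forall i j : 'I_n,
  profile edge_prob scale i j = if i == j then 0 else V n (cls n i) (cls n j).
Proof.
near=> n => i j.
have [n0 p0 p2 _] : [/\ 0 < n%:R :> R, 0 < p n, p n <= 1 / 2 & 0 <= n%:R * p n].
  by near: n; exact: p_near.
have p01 : 0 <= p n <= 1 by apply/andP; lra.
rewrite /profile xi_moment2 /nrm /=.
have VE k l : n%:R * (scale n ^+ 2 * (q n k l * (1 - q n k l))) = V n k l.
  rewrite scale_sqr // /variance_ratio sigma_sqr // invfM.
  rewrite mulrA [n%:R * _]mulrCA divff ?gt_eqF // mulr1 mulrC //.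
case: (eqVneq i j) => [->|ij]; first by rewrite minxx maxxx eqxx mulr0.
case: (leP i j) => h /=.
  have lt : (i < j)%N by rewrite ltn_neqAle; apply/andP; split; [exact: ij|exact: h].
  by rewrite (negPf ij) /edge_prob /= lt VE.
rewrite eq_sym (negPf ij) /edge_prob /= (_ : (j < i)%N); last exact: h.
by rewrite VE variance_ratio_sym // cls_lt.
Unshelve. all: by end_near. Qed.

Local Notation a n k := (class_fraction R sz n k).

Lemma class_fraction_sum : \forall n \near \oo, \sum_(k < d n) a n k = 1.
Proof.
near=> n; have n0 : (0 < n)%N by near: n; exact: nbhs_infty_gt.
by rewrite /class_fraction -mulr_suml -natr_sum sizes divff // pnatr_eq0 -lt0n.
Unshelve. all: by end_near. Qed.

(** Sums over vertices become sums over classes weighted by their sizes. The vanishing diagonal of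
    the profile costs n terms out of n^2, and the merged step receives the remaining weight
    [1 - sum]. *)
Lemma profile_kernel_approx (alpha : nat -> R) : d @ \oo --> \oo ->
  (forall k, a n k @[n --> \oo] --> alpha k) ->
  class_approx d (fun n k => a n k) (fun n k l => V n k l) ->
  kernel_approx (profile edge_prob scale).
Proof.
move=> d_oo a_lim approx e e0.
have e2 : 0 < e / 2 by rewrite divr_gt0.
have [K [S [S01 S_close]]] := approx _ e2.
pose tau n (i : 'I_n) : 'I_K.+1 := inord (minn (cls n i) K).
have tauE n (i : 'I_n) : tau n i = minn (cls n i) K :> nat.
  by rewrite inordK // ltnS geq_minr.
have sumE n (f : nat -> R) : \sum_(i < n) f (cls n i) = \sum_(k < d n) (sz n k)%:R * f k.
  have := sum_vertex_class (d n) (sz n) f; rewrite sizes; exact.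
have cntE n (j : 'I_K.+1) : #|[pred i | tau n i == j]|%:R / n%:R =
    \sum_(k < d n) a n k * (minn k K == j)%:R.
  rewrite -sum1_card natr_sum big_mkcond /=.
  rewrite (eq_bigr (fun i : 'I_n => (minn (cls n i) K == j)%:R)); last first.
    by move=> i _; rewrite inE -val_eqE /= tauE; case: eqP.
  rewrite (sumE n (fun k => (minn k K == j)%:R)) mulr_suml.
  by apply: eq_bigr => k _; rewrite /class_fraction mulrAC.
exists K, tau, (fun j : 'I_K.+1 => if (j < K)%N then alpha j else 1 - \sum_(k < K) alpha k),
  (fun x y => S x y); split=> [x y //|j|].
  under eq_fun do rewrite cntE.
  move/cvgnyPge : d_oo => d_ge.
  case: ifP => jK.
    apply: cvg_trans (a_lim j); apply: near_eq_cvg; near=> n.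
    have jd : (j < d n)%N by near: n; exact: d_ge.
    rewrite (bigD1 (Ordinal jd)) //= (minn_idPl (ltnW jK)) eqxx mulr1 big1 ?addr0 //.
    move=> k kj; case: eqP; rewrite ?mulr0 // => h; case/eqP: kj; apply/val_inj => /=.
    by move: h jK; rewrite /minn; case: ltnP => // _ h; rewrite -h ltnn.
  have jEK : j = K :> nat by apply/eqP; rewrite eqn_leq -ltnS ltn_ord leqNgt jK.
  have lim1 : (fun n => 1 - \sum_(k < K) a n k) @ \oo --> 1 - \sum_(k < K) alpha k.
    by apply: cvgB; [exact: cvg_cst|exact: cvg_sum_seq].
  apply: cvg_trans lim1; apply: near_eq_cvg; near=> n.
  have Kd : (K <= d n)%N by near: n; exact: d_ge.
  have a1 : \sum_(k < d n) a n k = 1 by near: n; exact: class_fraction_sum.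
  rewrite -[X in X - _]a1 (big_ord_widen _ (fun k => a n k) Kd).
  rewrite [X in X - _](bigID (fun k : 'I_ _ => k < K)%N) /= addrAC subrr add0r.
  rewrite big_mkcond; apply: eq_bigr => k _; rewrite jEK -leqNgt.
  by rewrite /minn; case: (ltnP k K) => kK /=; [rewrite ltn_eqF // mulr0|rewrite eqxx mulr1].
near=> n.
have n0 : (0 < n)%N by near: n; exact: nbhs_infty_gt.
have n0R : 0 < n%:R :> R by rewrite ltr0n.
have close : \sum_(k < d n) \sum_(l < d n)
      a n k * a n l * `|V n k l - S (minn k K) (minn l K)| <= e / 2 by near: n.
have prE : forall i j : 'I_n,
    profile edge_prob scale i j = if i == j then 0 else V n (cls n i) (cls n j).
  by near: n; exact: profileE.
have nbig : 2 / e <= n%:R by near: n; exact: nbhs_infty_ger.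
apply: (@le_trans _ _ (\sum_(i < n) \sum_(j < n)
   (`|V n (cls n i) (cls n j) - S (minn (cls n i) K) (minn (cls n j) K)| + (i == j)%:R))).
  apply: ler_sum => i _; apply: ler_sum => j _; rewrite prE !tauE.
  case: eqP => _; last by rewrite addr0.
  rewrite sub0r normrN; apply: ler_wpDl => //.
  by have /andP[s0 s1] := S01 (minn (cls n i) K) (minn (cls n j) K); rewrite ger0_norm.
under eq_bigr => i _ do rewrite big_split /=.
rewrite big_split /= [X in _ + X](_ : _ = n%:R); last first.
  rewrite -[RHS](_ : \sum_(i < n) 1 = _); last by rewrite sumr_const card_ord.
  by apply: eq_bigr => i _; rewrite (bigD1 i) //= eqxx big1 ?addr0 // => j /negPf; rewrite eq_sym => ->.
have -> : \sum_(i < n) \sum_(j < n)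
    `|V n (cls n i) (cls n j) - S (minn (cls n i) K) (minn (cls n j) K)| =
   n%:R ^+ 2 * \sum_(k < d n) \sum_(l < d n)
      a n k * a n l * `|V n k l - S (minn k K) (minn l K)|.
  rewrite (sumE n (fun k => \sum_(j < n) `|V n k (cls n j) - S (minn k K) (minn (cls n j) K)|)).
  rewrite mulr_sumr; apply: eq_bigr => k _.
  rewrite (sumE n (fun l => `|V n k l - S (minn k K) (minn l K)|)) !mulr_sumr.
  apply: eq_bigr => l _; rewrite /class_fraction; field.
  by rewrite gt_eqF.
have h1 : n%:R ^+ 2 * \sum_(k < d n) \sum_(l < d n)
      a n k * a n l * `|V n k l - S (minn k K) (minn l K)| <= n%:R ^+ 2 * (e / 2).
  by apply: ler_wpM2l => //; rewrite exprn_ge0.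
have h2 : 1 <= n%:R * (e / 2).
  have : 2 / e * (e / 2) <= n%:R * (e / 2) by apply: ler_wpM2r => //; exact: ltW.
  by rewrite (_ : 2 / e * (e / 2) = 1) //; field; rewrite gt_eqF.
have h3 : n%:R <= n%:R ^+ 2 * (e / 2).
  by rewrite expr2 -mulrA -[leLHS]mulr1; apply: ler_wpM2l => //; exact: ltW.
lra.
Unshelve. all: by end_near. Qed.

End ModelProfile.

Section ConditionsApprox.
Variables (R : realType) (d : nat -> nat) (sz : nat -> nat -> nat) (q : nat -> nat -> nat -> R).
Variables (alpha : nat -> R) (s : nat -> nat -> R).
Hypothesis sizes : forall n, (\sum_(k < d n) sz n k)%N = n.
Hypothesis q01 : forall n k l, (k < d n)%N -> (l < d n)%N -> 0 <= q n k l <= 1.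
Hypothesis q_sym : forall n k l, (k < d n)%N -> (l < d n)%N -> q n k l = q n l k.
Hypothesis p_omega : n%:R * max_prob (d n) (q n) @[n --> \oo] --> +oo.
Hypothesis p_to0 : max_prob (d n) (q n) @[n --> \oo] --> (0 : R).
Hypothesis alpha_ge0 : forall k : nat, 0 <= alpha k.
Hypothesis size_lim : forall k : nat, class_fraction R sz n k @[n --> \oo] --> alpha k.
Hypothesis s01 : forall k l : nat, 0 <= s k l <= 1.
Hypothesis ratio_lim : forall k l : nat,
  variance_ratio (d n) (q n) k l @[n --> \oo] --> s k l.
Hypothesis d_to_oo : d @ \oo --> \oo.

Local Notation V n := (variance_ratio (d n) (q n)).
Local Notation a n k := (class_fraction R sz n k).

Let a_ge0 n k : 0 <= a n k. Proof. by rewrite divr_ge0. Qed.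

Let d_shift m : (fun n => (d n).-1 - m)%N @ \oo --> \oo.
Proof.
apply/cvgnyPge => A; move/cvgnyPge : d_to_oo => /(_ (A + m).+1).
by apply: filterS => n; lia.
Qed.

Let d_shift_class m : is_class d (fun n => (d n).-1 - m)%N.
Proof.
move/cvgnyPge : d_to_oo => /(_ 1%N); apply: filterS => n; lia.
Qed.

Lemma conditions_class_approx :
  condition1 alpha \/ (exists (s0 : R) (sk0 : nat -> R), condition2 d sz q alpha s s0 sk0) ->
  class_approx d (fun n k => a n k) (fun n k l => V n k l).
Proof.
have v01 := variance_ratio01 q01 p_omega p_to0.
case=> [cond1|[s0 [sk0 cond2]]].
  exact: (class_approx1 d_to_oo a_ge0 (class_fraction_sum R sizes) size_lim v01 ratio_lim s01 cond1).
case: cond2 => -[alpha_sum _ alpha_cvg] _ _ _ tail small_lim large_lim.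
have lim01 (x : R) (k l : nat -> nat) : is_class d k -> is_class d l ->
    V n (k n) (l n) @[n --> \oo] --> x -> 0 <= x <= 1.
  move=> ck cl hx; apply: cvg_bounds hx _; near=> n.
  have v01n : forall k l, (k < d n)%N -> (l < d n)%N -> 0 <= V n k l <= 1 by near: n.
  by apply: v01n; near: n.
have smallk k : is_class d k -> k @ \oo --> \oo -> small_class R d sz k by exact: tail.
(* The last two classes, with indices [d n - 1] and [d n - 2], are distinct small classes; the limit
   inherits its bounds from the ratios along them. *)
have s0_01 : 0 <= s0 <= 1.
  apply: (lim01 s0 _ _ (d_shift_class 0) (d_shift_class 1)).
  apply: small_lim; [exact: smallk _ (d_shift_class 0) (d_shift 0)|
    exact: smallk _ (d_shift_class 1) (d_shift 1)|].
  by move/cvgnyPge : d_to_oo => /(_ 2); apply: filterS => n dn; apply/eqP; lia.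
have const_class k : is_class d (fun=> k).
  by move/cvgnyPge : d_to_oo => /(_ k.+1).
have sk0_01 k : 0 < alpha k -> 0 <= sk0 k <= 1.
  move=> ak; apply: (lim01 (sk0 k) _ _ (const_class k) (d_shift_class 0)).
  by apply: large_lim => //; exact: smallk _ (d_shift_class 0) (d_shift 0).
have vsym : \forall n \near \oo, forall k l, (k < d n)%N -> (l < d n)%N -> V n k l = V n l k.
  by apply: nearW => n k l kd ld; exact: variance_ratio_sym.
have a_tail e : 0 < e -> exists M, \forall n \near \oo, forall k,
    (M <= k < d n)%N -> a n k <= e.
  move=> e0; have [M hM] : exists M, \forall n \near \oo, forall k l,
      (M <= k < d n)%N -> (M <= l < d n)%N -> k != l -> a n k <= e.
    apply: uniform_tail => // k l ck cl k_oo l_oo _.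
    have [_ /cvgrPdist_le/(_ e e0)] := smallk _ ck k_oo.
    by apply: filterS => n; rewrite sub0r normrN ger0_norm.
  exists M; near=> n => k /andP[Mk kd].
  have hMn : forall k l, (M <= k < d n)%N -> (M <= l < d n)%N -> k != l -> a n k <= e by near: n.
  have dn : (M.+1 < d n)%N by near: n; move/cvgnyPge : d_to_oo; exact.
  (* [uniform_tail] speaks of pairs of distinct classes, so [k] is given a companion, [M] or
     [M.+1]. *)
  by have [kM|kM] := eqVneq k M; [apply: (hMn k M.+1)|apply: (hMn k M)]; lia.
have V_tail e : 0 < e -> exists M, \forall n \near \oo, forall k l,
    (M <= k < d n)%N -> (M <= l < d n)%N -> k != l -> `|V n k l - s0| <= e.
  move=> e0; apply: uniform_tail => // k l ck cl k_oo l_oo kl.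
  have /cvgrPdist_le/(_ e e0) := small_lim _ _ (smallk _ ck k_oo) (smallk _ cl l_oo) kl.
  by apply: filterS => n; rewrite distrC.
have V_large k e : 0 < alpha k -> 0 < e ->
    exists M, \forall n \near \oo, forall l, (M <= l < d n)%N -> `|V n k l - sk0 k| <= e.
  move=> ak e0; have [M hM] : exists M, \forall n \near \oo, forall l j,
      (M <= l < d n)%N -> (M <= j < d n)%N -> l != j -> `|V n k l - sk0 k| <= e.
    apply: uniform_tail => // l j cl cj l_oo j_oo _.
    have /cvgrPdist_le/(_ e e0) := large_lim k l ak (smallk _ cl l_oo).
    by apply: filterS => n; rewrite distrC.
  exists M; near=> n => l /andP[Ml ld].
  have hMn : forall l j, (M <= l < d n)%N -> (M <= j < d n)%N -> l != j ->
    `|V n k l - sk0 k| <= e by near: n.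
  have dn : (M.+1 < d n)%N by near: n; move/cvgnyPge : d_to_oo; exact.
  by have [lM|lM] := eqVneq l M; [apply: (hMn l M.+1)|apply: (hMn l M)]; lia.
exact: (class_approx2 d_to_oo a_ge0 (class_fraction_sum R sizes) size_lim v01 ratio_lim
  s01 alpha_ge0 s0_01 sk0_01 vsym a_tail V_tail V_large alpha_cvg).
Unshelve. all: by end_near. Qed.

End ConditionsApprox.

(** * Concentration of spectral means *)

Section SpectralMeans.
Variables (R : realType) (p : nat -> R) (Q : forall n, 'I_n * 'I_n -> R) (eta : nat -> R).
Hypothesis Q01 : forall n (e : 'I_n * 'I_n), 0 <= Q e <= 1.
Hypothesis eta01 : \forall n \near \oo, 0 <= eta n <= 1.
Hypothesis eta_to0 : eta @ \oo --> (0 : R).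
Hypothesis var_le : \forall n \near \oo, forall e : 'I_n * 'I_n,
  eta n ^+ 2 * (Q e * (1 - Q e)) <= n%:R^-1.
Hypothesis profile_approx : kernel_approx (profile Q eta).
Hypothesis p_ge0 : \forall n \near \oo, 0 <= p n.
Hypothesis Q_le : \forall n \near \oo, forall e : 'I_n * 'I_n, Q e <= p n.
Hypothesis p_to0 : p @ \oo --> (0 : R).
Hypothesis eta_p : \forall n \near \oo, n%:R * (p n * eta n ^+ 2) <= 2.

Implicit Types (h : R -> R).

Definition adj n (x : {ffun 'I_n * 'I_n -> bool}) : 'M[R]_n :=
  \matrix_(i, j) (if i == j then 0 else (x (nrm (i, j)))%:R).

Definition centered_mean n h : R :=
  n%:R^-1 * Ex (@Q n) (fun x => eigsum h (centered (@Q n) (eta n) x)).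

Definition spectral_mean n h (x : {ffun 'I_n * 'I_n -> bool}) : R :=
  eigsum h (eta n *: adj x) / n%:R.

Definition expected_mean n h : R := Ex (@Q n) (spectral_mean h).

Lemma scaled_adj_sym n (x : {ffun 'I_n * 'I_n -> bool}) : (eta n *: adj x)^T = eta n *: adj x.
Proof. by apply/matrixP => i j; rewrite !mxE nrmC eq_sym. Qed.

Lemma centered_mean_functional n : (0 < n)%N -> positive_functional (centered_mean n).
Proof.
move=> n0; have n0R : 0 < n%:R :> R by rewrite ltr0n.
split=> [a f g|f g fg|].
- rewrite /centered_mean mulrCA -mulrDr; congr (_ * _).
  rewrite -ExZ -ExD; apply: eq_Ex => x.
  by rewrite /eigsum mulr_sumr -big_split.
- apply: ler_wpM2l; first by rewrite invr_ge0 ltW.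
  by apply: le_Ex => // x; apply: ler_sum => i _.
- rewrite /centered_mean (@eq_Ex _ _ _ _ (fun=> n%:R)) ?Ex_cst ?mulVf ?gt_eqF // => x.
  rewrite /eigsum big_const_seq count_predT iter_addr addr0.
  by rewrite size_eigenvalues //; exact: centered_sym.
Qed.

Lemma centered_mean_pow k n : centered_mean n (fun x => x ^+ k) = mean_moment Q eta k n.
Proof.
rewrite /centered_mean /mean_moment; congr (_ * _); apply: eq_Ex => x.
by rewrite eigsum_pow //; exact: centered_sym.
Qed.

Lemma centered_mean_moment k : exists m : R, 0 <= m <= 2 ^+ k /\
  centered_mean n (fun x => x ^+ k) @[n --> \oo] --> m.
Proof.
have [m [m2 hm]] := mean_moment_limit Q01 eta01 eta_to0 var_le profile_approx k.
by exists m; split=> //; under eq_fun do rewrite centered_mean_pow.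
Qed.

Lemma centered_mean_limit (a b : R) : a < b ->
  exists c : R, centered_mean n (ramp a b) @[n --> \oo] --> c.
Proof.
move=> ab; have [L [K hLK]] := ramp_smooth ab.
have /choice[m hm] := centered_mean_moment.
apply: (moment_method centered_mean_functional _ _ hLK (m := m)).
- by move=> k; have [] := hm k.
- by move=> k; have [] := hm k.
- by move=> x; exact: ramp_bounds.
Qed.

(** Tightness: the limit second moment is at most 4, and 5 leaves room for convergence. *)
Lemma second_moment_near : \forall n \near \oo, centered_mean n (fun x => x ^+ 2) <= 5.
Proof.
have [m [/andP[_ m4] /cvgrPdist_le/(_ 1 ltr01)]] := centered_mean_moment 2.
by apply: filterS => n; rewrite ler_norml => /andP[h _]; move: m4 h; lra.
Qed.

Lemma ramp_limit_bounds a b c : a < b -> centered_mean n (ramp a b) @[n --> \oo] --> c ->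
  0 <= c <= 1.
Proof.
move=> ab hc; apply: cvg_bounds hc _; near=> n.
have n0 : (0 < n)%N by near: n; exact: nbhs_infty_gt.
have pL := centered_mean_functional n0.
rewrite -(pf_zero pL) -(pf_one pL).
by apply/andP; split; apply: (pf_le pL) => x; case/andP: (ramp_bounds x ab).
Unshelve. all: by end_near. Qed.

(** Chebyshev: the ramp lies above [1 - x^2 / a^2], and [a >= 1 + 5 / e] gives [a^2 >= 5 / e]. *)
Lemma ramp_limit_top e : 0 < e -> exists M : R, forall a b c, a < b -> M <= a ->
  centered_mean n (ramp a b) @[n --> \oo] --> c -> 1 - e <= c.
Proof.
move=> e0; exists (1 + 5 / e) => a b c ab Ma hc.
have e5 : 0 < 5 / e by rewrite divr_gt0.
have a1 : 1 <= a by lra.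
have a20 : 0 < a ^+ 2 by rewrite exprn_gt0; lra.
suff : 1 - e <= c <= 1 by case/andP.
apply: cvg_bounds hc _; near=> n.
have n0 : (0 < n)%N by near: n; exact: nbhs_infty_gt.
have pL := centered_mean_functional n0.
have m2 : centered_mean n (fun x => x ^+ 2) <= 5 by near: n; exact: second_moment_near.
apply/andP; split; last first.
  by rewrite -(pf_one pL); apply: (pf_le pL) => x; case/andP: (ramp_bounds x ab).
apply: (@le_trans _ _ (centered_mean n (fun x => - (a ^+ 2)^-1 * x ^+ 2 + 1))).
  rewrite (pf_lin pL _ (fun x => x ^+ 2) (fun=> 1)) (pf_one pL).
  have : (a ^+ 2)^-1 * centered_mean n (fun x => x ^+ 2) <= e; last by lra.
  rewrite mulrC ler_pdivrMr //; apply: le_trans m2 _.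
  have : 5 / e * e <= a ^+ 2 * e by apply: ler_wpM2r; [exact: ltW|nra].
  by rewrite divfK ?gt_eqF // mulrC.
apply: (pf_le pL) => x; have /andP[r0 r1] := ramp_bounds x ab.
have x20 := sqr_ge0 x.
have [xa|xa] := lerP x a.
  rewrite ramp_left // mulNr; have : 0 <= (a ^+ 2)^-1 * x ^+ 2; last by lra.
  by rewrite mulr_ge0 // invr_ge0 ltW.
have : 1 <= (a ^+ 2)^-1 * x ^+ 2; last by lra.
by rewrite mulrC ler_pdivlMr // mul1r; nra.
Unshelve. all: by end_near. Qed.

Lemma ramp_limit_bot e : 0 < e -> exists M : R, forall a b c, a < b -> b <= M ->
  centered_mean n (ramp a b) @[n --> \oo] --> c -> c <= e.
Proof.
move=> e0; exists (- (1 + 5 / e)) => a b c ab Mb hc.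
have e5 : 0 < 5 / e by rewrite divr_gt0.
have b1 : b <= -1 by lra.
have b20 : 0 < b ^+ 2 by rewrite lt0r sqr_ge0 andbT expf_neq0 //; lra.
suff : 0 <= c <= e by case/andP.
apply: cvg_bounds hc _; near=> n.
have n0 : (0 < n)%N by near: n; exact: nbhs_infty_gt.
have pL := centered_mean_functional n0.
have m2 : centered_mean n (fun x => x ^+ 2) <= 5 by near: n; exact: second_moment_near.
apply/andP; split.
  by rewrite -(pf_zero pL); apply: (pf_le pL) => x; case/andP: (ramp_bounds x ab).
apply: (@le_trans _ _ (centered_mean n (fun x => (b ^+ 2)^-1 * x ^+ 2))).
  apply: (pf_le pL) => x; have /andP[r0 r1] := ramp_bounds x ab.
  have x20 := sqr_ge0 x.
  have [xb|xb] := lerP b x; first by rewrite ramp_right // mulr_ge0 // invr_ge0 ltW.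
  apply: le_trans r1 _; rewrite mulrC ler_pdivlMr // mul1r; nra.
rewrite (pf_scale pL _ (fun x => x ^+ 2)) mulrC ler_pdivrMr //; apply: le_trans m2 _.
have : 5 / e * e <= b ^+ 2 * e by apply: ler_wpM2r; [exact: ltW|nra].
by rewrite divfK ?gt_eqF // mulrC.
Unshelve. all: by end_near. Qed.

Lemma centered_frobenius n (x : {ffun 'I_n * 'I_n -> bool}) : 0 <= p n ->
  (forall e : 'I_n * 'I_n, Q e <= p n) ->
  \sum_i \sum_j ((eta n *: adj x) i j - centered (@Q n) (eta n) x i j) ^+ 2 <=
    n%:R ^+ 2 * (eta n ^+ 2 * p n ^+ 2).
Proof.
move=> p0 Qp; apply: (@le_trans _ _ (\sum_(i < n) \sum_(j < n) (eta n ^+ 2 * p n ^+ 2))).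
  apply: ler_sum => i _; apply: ler_sum => j _; rewrite !mxE /xi.
  have -> : ((nrm (i, j)).1 == (nrm (i, j)).2) = (i == j).
    rewrite /nrm /=; case: (leP i j) => // _; exact: eq_sym.
  case: eqP => _.
    by rewrite mulr0 subr0 expr0n mulr_ge0 ?sqr_ge0.
  rewrite -mulrBr opprB addrC subrK exprMn; apply: ler_wpM2l; first exact: sqr_ge0.
  by rewrite lerXn2r ?nnegrE // ?Qp //; case/andP: (Q01 (nrm (i, j))).
by rewrite !sum_cst card_ord mulrA -expr2.
Qed.

(** The squared Frobenius norm of the removed mean is at most [n^2 eta^2 p^2 = n p * (n p eta^2) <=
    2 n p], which is o(n). *)
Lemma expected_mean_shift h h' L K : smooth_test h h' L K ->
  (fun n => expected_mean n h - centered_mean n h) @ \oo --> (0 : R).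
Proof.
move=> hh; apply/cvgrPdist_le => e e0; have e2 : 0 < e / 2 by rewrite divr_gt0.
have [L0 K0] := smooth_test_ge0 hh.
pose C := K + L ^+ 2 / (e / 2).
have C0 : 0 <= C by rewrite addr_ge0 // divr_ge0 ?sqr_ge0 // ltW.
have D0 : 0 < e / 2 / (2 * (C + 1)) by rewrite divr_gt0 // mulr_gt0 // ltr_wpDl.
near=> n; rewrite sub0r normrN.
have n0 : (0 < n)%N by near: n; exact: nbhs_infty_gt.
have n0R : 0 < n%:R :> R by rewrite ltr0n.
have p0 : 0 <= p n by near: n.
have Qp : forall e : 'I_n * 'I_n, Q e <= p n by near: n.
have ep : n%:R * (p n * eta n ^+ 2) <= 2 by near: n.
have psmall : p n <= e / 2 / (2 * (C + 1)).
  have : `|0 - p n| <= e / 2 / (2 * (C + 1)).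
    by near: n; move/cvgrPdist_le : p_to0; exact.
  by rewrite sub0r normrN ger0_norm.
rewrite /expected_mean /centered_mean -ExZ -ExB.
apply: le_trans (ler_norm_Ex (@Q01 n) _) _; rewrite -[leRHS](Ex_cst (@Q n)).
apply: (le_Ex (@Q01 n)) => x.
rewrite /spectral_mean [_^-1 * _]mulrC -mulrBl normrM [`|_^-1|]ger0_norm ?invr_ge0 ?(ltW n0R) //.
rewrite ler_pdivrMr //.
apply: le_trans (eigsum_perturb_l2 (scaled_adj_sym x) (centered_sym _ _ _) hh e2) _.
rewrite -/C (_ : e * n%:R = e / 2 * n%:R + e / 2 * n%:R); last by field.
rewrite lerD2l; apply: le_trans (ler_wpM2l C0 (centered_frobenius x p0 Qp)) _.
have -> : C * (n%:R ^+ 2 * (eta n ^+ 2 * p n ^+ 2)) =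
   C * p n * (n%:R * (p n * eta n ^+ 2)) * n%:R by ring.
apply: ler_wpM2r; first exact: ltW.
apply: (@le_trans _ _ (C * p n * 2)); first by apply: ler_wpM2l => //; exact: mulr_ge0.
move: psmall; rewrite ler_pdivlMr; last by rewrite mulr_gt0 // ltr_wpDl.
lra.
Unshelve. all: by end_near. Qed.

Lemma adj_upd_entry n (x : {ffun 'I_n * 'I_n -> bool}) e i j : 
  `|(eta n *: adj (upd x e true)) i j - (eta n *: adj (upd x e false)) i j| <=
    `|eta n| * ((i == e.1) && (j == e.2))%:R + `|eta n| * ((i == e.2) && (j == e.1))%:R.
Proof.
rewrite !mxE; case: (eqVneq i j) => [->|ij].
  by rewrite subrr normr0 addr_ge0 // mulr_ge0.
rewrite !ffunE; case: eqP => [<-|_]; last by rewrite subrr normr0 addr_ge0 // mulr_ge0.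
rewrite mulr1 mulr0 subr0 /nrm /=; case: (leP i j) => _ /=; rewrite !eqxx /= mulr1.
  by rewrite lerDl mulr_ge0.
by rewrite lerDr mulr_ge0.
Qed.

Lemma sum_delta n (a b : 'I_n) : \sum_i \sum_j ((i == a) && (j == b))%:R = 1 :> R.
Proof.
rewrite (bigD1 a) //= [X in _ + X]big1 ?addr0.
  by rewrite (bigD1 b) //= !eqxx big1 ?addr0 // => j /negPf ->; rewrite andbF.
by move=> i /negPf ia; rewrite big1 // => j _; rewrite ia.
Qed.

(** A flip moves at most two symmetric entries, by [eta] each; [eta <= 1] makes the quadratic term
    linear in [eta]. *)
Lemma spectral_mean_bounded_diff h h' L K n : smooth_test h h' L K -> (0 < n)%N ->
  0 <= eta n <= 1 ->
  bounded_diff ((2 * L + 4 * K) * eta n / n%:R) (@spectral_mean n h).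
Proof.
move=> hh n0 /andP[e0 e1] x e; have [L0 K0] := smooth_test_ge0 hh.
have n0R : 0 < n%:R :> R by rewrite ltr0n.
rewrite /spectral_mean -mulrBl normrM [`|_^-1|]ger0_norm ?invr_ge0 ?(ltW n0R) //.
apply: ler_wpM2r; first by rewrite invr_ge0 ltW.
apply: le_trans (eigsum_perturb_l1 (scaled_adj_sym _) (scaled_adj_sym _) hh) _.
have entry i j := adj_upd_entry x e i j; rewrite !ger0_norm // in entry.
set A := eta n *: adj (upd x e true); set B := eta n *: adj (upd x e false).
have l1 : \sum_i \sum_j `|A i j - B i j| <= 2 * eta n.
  apply: le_trans (ler_sum _ (fun i _ => ler_sum _ (fun j _ => entry i j))) _.
  under eq_bigr => i _ do rewrite big_split /= -!mulr_sumr.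
  by rewrite big_split /= -!mulr_sumr !sum_delta; lra.
have l2 : \sum_i \sum_j (A i j - B i j) ^+ 2 <= 2 * eta n * (2 * eta n).
  apply: (@le_trans _ _ (\sum_i \sum_j (2 * eta n) * `|A i j - B i j|)).
    apply: ler_sum => i _; apply: ler_sum => j _.
    rewrite -real_normK ?num_real // expr2; apply: ler_wpM2r => //.
    apply: le_trans (entry i j) _.
    have h1 (b : bool) : eta n * b%:R <= eta n by case: b; rewrite ?mulr1 ?mulr0.
    by have := h1 ((i == e.1) && (j == e.2)); have := h1 ((i == e.2) && (j == e.1)); lra.
  under eq_bigr => i _ do rewrite -mulr_sumr.
  by rewrite -mulr_sumr; apply: ler_wpM2l => //; rewrite mulr_ge0.
have h1 := ler_wpM2l L0 l1; have h2 := ler_wpM2l K0 l2.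
have h3 : K * (2 * eta n * (2 * eta n)) <= K * (4 * eta n) by apply: ler_wpM2l => //; nra.
lra.
Qed.

(** With [c = D eta / n] the sum of variances [n^2 p c^2] is at most [2 D^2 / n]. The two terms of
    the fourth moment give 38 = 8 * 2^2 + 3 * 2. *)
Lemma spectral_mean_concentration h h' L K : smooth_test h h' L K ->
  exists C : R, 0 <= C /\ \forall n \near \oo, forall e : R, 0 < e ->
    \sum_(x | e <= `|@spectral_mean n h x - expected_mean n h|) bern_weight (@Q n) x <=
      C / n%:R ^+ 2 / e ^+ 4.
Proof.
move=> hh; have [L0 K0] := smooth_test_ge0 hh.
pose D := 2 * L + 4 * K; have D0 : 0 <= D by rewrite addr_ge0 // mulr_ge0.
exists (38 * D ^+ 4); split; first by rewrite mulr_ge0 // exprn_ge0.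
near=> n => e e0.
have n0 : (0 < n)%N by near: n; exact: nbhs_infty_gt.
have n0R : 0 < n%:R :> R by rewrite ltr0n.
have n1R : 1 <= n%:R :> R by rewrite ler1n.
have p0 : 0 <= p n by near: n.
have Qp : forall e : 'I_n * 'I_n, Q e <= p n by near: n.
have ep : n%:R * (p n * eta n ^+ 2) <= 2 by near: n.
have e01 : 0 <= eta n <= 1 by near: n.
have /andP[eta0 eta1] := e01.
pose c := D * eta n / n%:R.
have c0 : 0 <= c by rewrite divr_ge0 ?(ltW n0R) // mulr_ge0.
have bd := spectral_mean_bounded_diff hh n0 e01.
have m4 := fourth_moment_bound (@Q01 n) c0 Qp bd.
apply: le_trans (markov_fourth (@Q01 n) (fun x => spectral_mean h x - expected_mean n h) e0) _.
apply: ler_wpM2r; first by rewrite invr_ge0 exprn_ge0 // ltW.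
apply: le_trans m4 _; rewrite card_prod card_ord natrM.
set y := n%:R * (p n * eta n ^+ 2) in ep.
have y0 : 0 <= y by rewrite mulr_ge0 ?(ltW n0R) // mulr_ge0 // sqr_ge0.
have -> : n%:R * n%:R * (p n * c ^+ 2) = D ^+ 2 * y / n%:R.
  by rewrite /c /y; field; rewrite gt_eqF.
have -> : n%:R * n%:R * (3 * p n * c ^+ 4) = 3 * (D ^+ 4 * y * eta n ^+ 2) / n%:R ^+ 3.
  by rewrite /c /y; field; rewrite gt_eqF.
have D40 : 0 <= D ^+ 4 by rewrite exprn_ge0.
have t1 : 8 * (D ^+ 2 * y / n%:R) ^+ 2 <= 32 * D ^+ 4 / n%:R ^+ 2.
  have -> : 8 * (D ^+ 2 * y / n%:R) ^+ 2 = 8 * D ^+ 4 * y ^+ 2 / n%:R ^+ 2.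
    by field; rewrite gt_eqF.
  apply: ler_wpM2r; first by rewrite invr_ge0 exprn_ge0.
  have : y ^+ 2 <= 4 by nra.
  by move/(ler_wpM2l D40); lra.
have t2 : 3 * (D ^+ 4 * y * eta n ^+ 2) / n%:R ^+ 3 <= 6 * D ^+ 4 / n%:R ^+ 2.
  apply: (@le_trans _ _ (6 * D ^+ 4 / n%:R ^+ 3)).
    apply: ler_wpM2r; first by rewrite invr_ge0 exprn_ge0.
    have : y * eta n ^+ 2 <= 2.
      apply: le_trans ep; rewrite ler_piMr // exprn_ile1 //.
    by move/(ler_wpM2l D40); lra.
  apply: ler_wpM2l; first by rewrite mulr_ge0.
  by rewrite lef_pV2 ?posrE ?exprn_gt0 // ler_weXn2l.
lra.
Unshelve. all: by end_near. Qed.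

End SpectralMeans.

(** * Transfer to the probability space *)

Section BorelCantelli.
Context d (T : measurableType d) (R : realType) (P : probability T R).

(** The bounds are compared with the telescoping series of [1 / (i + 1) - 1 / (i + 2)], so that the
    partial sums stay below [2 C]. The shift by [N.+1] skips the indices without a bound and the
    denominator 0. *)
Lemma ae_eventually_not (F : nat -> set T) (C : R) : 0 <= C ->
  (forall n, measurable (F n)) ->
  (\forall n \near \oo, (P (F n) <= (C / n%:R ^+ 2)%:E)%E) ->
  {ae P, forall w, \forall n \near \oo, ~ F n w}.
Proof.
move=> C0 mF [N _ hN].
pose F' n := F (n + N.+1)%N.
have F'le n : (P (F' n) <= (2 * C * (n.+1%:R^-1 - n.+2%:R^-1))%:E)%E.
  apply: le_trans (hN _ _) _; first by rewrite /= addnS ltnW // ltnS leq_addl.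
  rewrite lee_fin (_ : 2 * C * _ = C * (2 / (n.+1%:R * n.+2%:R))); last first.
    rewrite -[n.+2%:R]natr1; have : 0 < n.+1%:R :> R by [].
    by move: (n.+1%:R) => u u0; field; rewrite !gt_eqF //; lra.
  apply: ler_wpM2l => //; rewrite -[leRHS]invrK lef_pV2 ?posrE ?invr_gt0; last 2 first.
  - by rewrite exprn_gt0 // ltr0n addnS.
  - by rewrite divr_gt0 // mulr_gt0.
  rewrite invf_div ler_pdivrMr // -natrX -!natrM ler_nat.
  by nia.
have lim0 : P (lim_sup_set F') = 0.
  apply: lim_sup_set_cvg0 => [k|]; first exact: mF.
  apply: (@le_lt_trans _ _ (2 * C)%:E); last exact: ltry.
  apply: lime_le; first by apply: is_cvg_nneseries.
  apply: nearW => n; apply: (@le_trans _ _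
      (\sum_(0 <= i < n) (2 * C * (i.+1%:R^-1 - i.+2%:R^-1))%:E)%E).
    by apply: lee_sum => i _; exact: F'le.
  rewrite sumEFin lee_fin -mulr_sumr ler_piMr ?mulr_ge0 //.
  rewrite (_ : \sum_(0 <= i < n) _ = 1 - n.+1%:R^-1); first by rewrite lerBlDr lerDl.
  elim: n => [|n IHn]; first by rewrite big_geq // invr1 subrr.
  by rewrite big_nat_recr //= IHn addrA subrK.
exists (lim_sup_set F'); split => //.
  by apply: bigcap_measurable => // k _; apply: bigcup_measurable => j _; exact: mF.
move=> w /= nw k _; apply: contrapT => nk; apply: nw.
exists (k + N.+1)%N => // n /= kn Fn; apply: nk.
exists (n - N.+1)%N => /=; first by rewrite leq_subRL ?(leq_trans _ kn) ?leq_addl // addnC.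
by rewrite /F' subnK // (leq_trans _ kn) // leq_addl.
Qed.

End BorelCantelli.

Section Configuration.
Context dT (T : measurableType dT) (R : realType) (P : probability T R).
Variables (n c : nat) (sz : nat -> nat) (q : nat -> nat -> R).
Variable X : 'I_n -> 'I_n -> {RV P >-> bool}.
Hypothesis X_sbm : stochastic_block_model c sz q X.

Definition pair_prob (e : 'I_n * 'I_n) : R :=
  if (e.1 < e.2)%N then q (vertex_class c sz e.1) (vertex_class c sz e.2) else 0.

Definition configuration (w : T) : {ffun 'I_n * 'I_n -> bool} :=
  [ffun e : 'I_n * 'I_n => (e.1 < e.2)%N && X e.1 e.2 w].

Lemma adjacency_configuration w : adjacency X w = adj R (configuration w).
Proof.
apply/matrixP => i j; rewrite !mxE ffunE.
case: (eqVneq i j) => [->|ij]; first by rewrite (sbm_diag X_sbm).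
rewrite /nrm /=; case: (leP i j) => h /=.
  have -> : (i < j)%N by rewrite ltn_neqAle; apply/andP; split; [exact: ij|exact: h].
  by [].
by rewrite (_ : (j < i)%N) ?(sbm_sym X_sbm i j) //; exact: h.
Qed.

Let class_ok (i : 'I_n) : (vertex_class c sz i < c)%N /\ in_class sz (vertex_class c sz i) i.
Proof. by apply: vertex_classP; rewrite (sbm_sizes X_sbm). Qed.

Let pairs := [set ij : 'I_n * 'I_n | (ij.1 < ij.2)%N]%SET.

Lemma configuration_eq_set (x : {ffun 'I_n * 'I_n -> bool}) :
  (forall e : 'I_n * 'I_n, ~~ (e.1 < e.2)%N -> x e = false) ->
  configuration @^-1` [set x] =
  \bigcap_(e in [set` pairs]) (X e.1 e.2 @^-1` [set x e]).
Proof.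
move=> x0; apply/seteqP; split=> w /=.
  by move=> <- e /=; rewrite inE => lt; rewrite ffunE lt.
move=> h; apply/ffunP => e; rewrite ffunE.
case: (boolP (e.1 < e.2)%N) => [lt|/x0 -> //].
by have := h e; rewrite /= inE lt => /(_ isT).
Qed.

Lemma configuration_measurable x : measurable (configuration @^-1` [set x]).
Proof.
have [x0|] := pselect (forall e : 'I_n * 'I_n, ~~ (e.1 < e.2)%N -> x e = false).
  rewrite configuration_eq_set //; apply: fin_bigcap_measurable; first exact: finite_finset.
  by move=> e _; exact: measurable_funPTI.
move=> nx; rewrite (_ : _ @^-1` _ = set0) // -subset0 => w /= wx; apply: nx => e ne.
by rewrite -wx ffunE (negPf ne).
Qed.

(** An upper bound is what the deviation events call for. A configuration with a true coordinate
    outside the increasing pairs is never attained; for the others the two sides agree. *)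
Lemma configuration_prob x :
  (P (configuration @^-1` [set x]) <= (bern_weight pair_prob x)%:E)%E.
Proof.
have Q01 e : 0 <= pair_prob e <= 1.
  rewrite /pair_prob; case: ifP => _; last by rewrite lexx ler01.
  by apply: (sbm_prob X_sbm); have [] := class_ok e.1; have [] := class_ok e.2.
have [x0|nx] := pselect (forall e : 'I_n * 'I_n, ~~ (e.1 < e.2)%N -> x e = false); last first.
  rewrite (_ : _ @^-1` _ = set0) ?measure0 ?lee_fin ?bern_weight_ge0 //.
  by rewrite -subset0 => w /= wx; apply: nx => e ne; rewrite -wx ffunE (negPf ne).
rewrite configuration_eq_set //.
rewrite (sbm_indep X_sbm (J := pairs) (B := fun e => [set x e])) //.
have -> : bern_weight pair_prob x = \prod_(e in pairs) bern (pair_prob e) (x e).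
  rewrite /bern_weight (bigID [in pairs]) /= [X in _ * X]big1 ?mulr1 // => e.
  by rewrite inE => ne; rewrite x0 // /bern /pair_prob (negPf ne) subr0.
rewrite -prodEFin le_eqVlt; apply/orP; left; apply/eqP; apply: eq_bigr => e.
rewrite inE => lt; have [c1 i1] := class_ok e.1; have [c2 i2] := class_ok e.2.
have ne : e.1 != e.2 by rewrite -val_eqE /= ltn_eqF.
have := sbm_bernoulli X_sbm c1 c2 ne i1 i2 [set x e].
rewrite /distribution /pushforward => ->.
rewrite bernoulli_probE; last exact: (sbm_prob X_sbm).
have memE (b b' : bool) : (b \in [set b']%classic) = (b == b').
  by apply/idP/eqP; rewrite inE.
rewrite /pair_prob lt /bern !diracE !memE; case: (x e) => /=.
  by rewrite mule1 mule0 adde0.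
by rewrite mule1 mule0 add0e.
Qed.

(** Finitely many configurations: events about the spectrum are measurable without any regularity of
    eigenvalues. *)
Lemma configuration_event (B : pred {ffun 'I_n * 'I_n -> bool}) :
  measurable [set w | B (configuration w)] /\
  (P [set w | B (configuration w)] <= (\sum_(x | B x) bern_weight pair_prob x)%:E)%E.
Proof.
have -> : [set w | B (configuration w)] =
    \big[setU/set0]_(x <- enum B) (configuration @^-1` [set x]).
  rewrite -bigcup_seq; apply/seteqP; split=> w /=.
    by move=> Bw; exists (configuration w) => //=; rewrite mem_enum.
  by move=> [x /=]; rewrite mem_enum => Bx ->.
have -> : \sum_(x | B x) bern_weight pair_prob x = \sum_(x <- enum B) bern_weight pair_prob x.
  by rewrite big_enum.
elim: (enum B) => [|x r [IHm IHle]].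
  by rewrite !big_nil measure0 lexx; split.
have mx := configuration_measurable x.
rewrite !big_cons EFinD; split; first exact: measurableU.
by apply: le_trans (measureU2 _ mx IHm) _; apply: leeD => //; exact: configuration_prob.
Qed.

End Configuration.

Section EsdRamp.
Variable R : realType.

Lemma count_sum (s : seq R) (P : pred R) : (count P s)%:R = \sum_(x <- s) (P x)%:R :> R.
Proof. by elim: s => [|x s IHs]; rewrite ?big_nil // big_cons -IHs natrD. Qed.

Lemma esd_le_ramp n (A : 'M[R]_n) x a b : a < b -> x <= a ->
  esd A x <= eigsum (ramp a b) A / n%:R.
Proof.
move=> ab xa; rewrite /esd count_sum; apply: ler_wpM2r; first by rewrite invr_ge0.
apply: ler_sum => t _; have [tx|_] := boolP (t <= x).
  by rewrite ramp_left // (le_trans tx).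
by case/andP: (ramp_bounds t ab).
Qed.

Lemma esd_ge_ramp n (A : 'M[R]_n) x a b : a < b -> b <= x ->
  eigsum (ramp a b) A / n%:R <= esd A x.
Proof.
move=> ab bx; rewrite /esd count_sum; apply: ler_wpM2r; first by rewrite invr_ge0.
apply: ler_sum => t _; have [tx|] := boolP (t <= x).
  by case/andP: (ramp_bounds t ab).
by rewrite -ltNge => xt; rewrite ramp_right // ltW // (le_lt_trans bx).
Qed.

End EsdRamp.

Unset Implicit Arguments.
Set Strict Implicit.
Set Printing Implicit Defensive.

Theorem corollary7p1 (dT : measure_display) (T : measurableType dT)
  (R : realType) (P : probability T R)
  (d : nat -> nat) (sz : nat -> nat -> nat) (q : nat -> nat -> nat -> R)
  (X : forall n : nat, 'I_n -> 'I_n -> {RV P >-> bool})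
  (alpha : nat -> R) (s : nat -> nat -> R)
  (alpha_ge0 : forall k : nat, 0 <= alpha k)
  (size_lim : forall k : nat,
     class_fraction R sz n k @[n --> \oo] --> alpha k)
  (X_sbm : forall n : nat, stochastic_block_model (d n) (sz n) (q n) (X n))
  (p_omega : n%:R * max_prob (d n) (q n) @[n --> \oo] --> +oo)
  (p_sup : sup (range (fun n : nat => max_prob (d n) (q n))) < 1)
  (s_01 : forall k l : nat, 0 <= s k l <= 1)
  (ratio_lim : forall k l : nat,
     variance_ratio (d n) (q n) k l @[n --> \oo] --> s k l)
  (p_to0 : max_prob (d n) (q n) @[n --> \oo] --> (0 : R))
  (d_to_oo : d @ \oo --> \oo)
  (extra : condition1 alpha \/
     exists (s0 : R) (sk0 : nat -> R), condition2 d sz q alpha s s0 sk0) :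
  exists mu : probability (measurableTypeR R) R,
    {ae P, forall w : T,
      converges_weakly
        (fun n : nat => esd ((sigma (d n) (q n) * Num.sqrt n%:R)^-1
                             *: adjacency (X n) w)) mu}.
Proof.
have sizes n : (\sum_(k < d n) sz n k)%N = n by exact: sbm_sizes (X_sbm n).
have q01 n k l : (k < d n)%N -> (l < d n)%N -> 0 <= q n k l <= 1.
  exact: (sbm_prob (X_sbm n)).
have q_sym n k l : (k < d n)%N -> (l < d n)%N -> q n k l = q n l k.
  exact: (sbm_prob_sym (X_sbm n)).
pose p n := max_prob (d n) (q n).
pose Q n := @edge_prob R d sz q n.
pose eta := scale d q.
have Q01 n (e : 'I_n * 'I_n) : 0 <= Q n e <= 1 by exact: edge_prob01.
have eta01 : \forall n \near \oo, 0 <= eta n <= 1 by exact: scale01.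
have eta0 : eta @ \oo --> (0 : R) by exact: scale_to0.
have var_le := scale_var_le sizes q01 p_omega p_to0.
have approx : kernel_approx (profile Q eta).
  apply: (profile_kernel_approx sizes q_sym p_omega p_to0 d_to_oo size_lim).
  exact: (conditions_class_approx sizes q01 q_sym p_omega p_to0 alpha_ge0 size_lim s_01
    ratio_lim d_to_oo extra).
have pnear := p_near p_omega p_to0 0.
have p_ge0 : \forall n \near \oo, 0 <= p n.
  by apply: filterS pnear => n [_ p0 _ _]; exact: ltW.
have Q_le : \forall n \near \oo, forall e : 'I_n * 'I_n, Q n e <= p n.
  by apply: filterS p_ge0 => n p0 e; exact: edge_prob_le.
have eta_p : \forall n \near \oo, n%:R * (p n * eta n ^+ 2) <= 2.
  apply: filterS pnear => n [n0 p0 p2 _].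
  rewrite /eta scale_sqr; last by apply/andP; rewrite /p in p0 *; lra.
  have p1 : 0 < 1 - p n by rewrite /p; lra.
  rewrite (_ : n%:R * _ = (1 - p n)^-1); last by rewrite /p in p0 p1 *; field; rewrite !gt_eqF.
  by rewrite -[leRHS]invrK lef_pV2 ?posrE ?invr_gt0 //; rewrite /p; lra.
have limit_ex : forall ab : rat * rat, exists c : R, ab.1 < ab.2 ->
    centered_mean Q eta n (ramp (ratr ab.1) (ratr ab.2)) @[n --> \oo] --> c.
  move=> [a b] /=; have [ab|_] := boolP (a < b); last by exists 0.
  have ab' : ratr a < ratr b :> R by rewrite ltr_rat.
  have [c hc] := centered_mean_limit Q01 eta01 eta0 var_le approx ab'.
  by exists c.
have [G' hG'] := choice limit_ex.
pose G a b := G' (a, b).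
have hG a b : a < b -> centered_mean Q eta n (ramp (ratr a) (ratr b)) @[n --> \oo] --> G a b.
  exact: (hG' (a, b)).
have G01 a b : a < b -> 0 <= G a b <= 1.
  move=> ab; have ab' : ratr a < ratr b :> R by rewrite ltr_rat.
  exact: (ramp_limit_bounds Q01 ab' (hG a b ab)).
have G_top (e : R) : 0 < e -> exists M : R, forall a b, a < b -> M <= ratr a -> 1 - e <= G a b.
  move=> e0; have [M hM] := ramp_limit_top Q01 eta01 eta0 var_le approx e0.
  by exists M => a b ab Ma; apply: (hM (ratr a) (ratr b)) => //; rewrite ?ltr_rat //; exact: hG.
have G_bot (e : R) : 0 < e -> exists M : R, forall a b, a < b -> ratr b <= M -> G a b <= e.
  move=> e0; have [M hM] := ramp_limit_bot Q01 eta01 eta0 var_le approx e0.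
  by exists M => a b ab Ma; apply: (hM (ratr a) (ratr b)) => //; rewrite ?ltr_rat //; exact: hG.
have [mu muE] := limit_measure G01 G_top G_bot.
exists mu.
(* Deviation events for a rational ramp and a tolerance 1 / (m + 1), a countable family. *)
pose dev (abm : rat * rat * nat) n (x : {ffun 'I_n * 'I_n -> bool}) :=
  let h := ramp (ratr abm.1.1) (ratr abm.1.2) in
  abm.2.+1%:R^-1 <= `|spectral_mean eta h x - expected_mean Q eta n h|.
have ae_dev (abm : rat * rat * nat) : abm.1.1 < abm.1.2 ->
    {ae P, forall w, \forall n \near \oo, ~ dev abm n (configuration (X n) w)}.
  move=> ab; have ab' : ratr abm.1.1 < ratr abm.1.2 :> R by rewrite ltr_rat.
  have [L [K hLK]] := ramp_smooth ab'.
  have [C [C0 hC]] := spectral_mean_concentration Q01 eta01 p_ge0 Q_le eta_p hLK.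
  pose e : R := abm.2.+1%:R^-1; have e0 : 0 < e by rewrite invr_gt0.
  apply: (@ae_eventually_not _ _ _ _ (fun n => [set w | dev abm n (configuration (X n) w)])
    (C / e ^+ 4)).
  - by rewrite divr_ge0 // exprn_ge0 // ltW.
  - by move=> n; have [] := configuration_event (X_sbm n) (dev abm n).
  - near=> n; have [_ Ple] := configuration_event (X_sbm n) (dev abm n).
    apply: le_trans Ple _; rewrite lee_fin mulrAC.
    have hCn : forall e : R, 0 < e ->
      \sum_(x | e <= `|spectral_mean eta (ramp (ratr abm.1.1) (ratr abm.1.2)) x -
         expected_mean Q eta n (ramp (ratr abm.1.1) (ratr abm.1.2))|) bern_weight (Q n) x <=
      C / n%:R ^+ 2 / e ^+ 4 by near: n.
    exact: hCn.
(* [ae_foralln] quantifies over natural numbers, so the triples are enumerated by [unpickle]. *)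
have ae_all : {ae P, forall w, forall k : nat, forall abm : rat * rat * nat,
    unpickle k = Some abm -> abm.1.1 < abm.1.2 ->
    \forall n \near \oo, ~ dev abm n (configuration (X n) w)}.
  apply: ae_foralln => k; case: (unpickle k) => [abm|]; last by apply: aeW.
  have [ab|nab] := boolP (abm.1.1 < abm.1.2).
    by apply: filterS (ae_dev abm ab) => w h _ [<-].
  by apply: aeW => w _ [<-]; rewrite (negPf nab).
apply: filterS ae_all => w hw.
apply: (weak_convergence G01 (S := fun n h => eigsum h (eta n *: adjacency (X n) w) / n%:R) muE).
- by move=> n x a b ab xa; apply: esd_le_ramp => //; rewrite ltr_rat.
- by move=> n x a b ab xa; apply: esd_ge_ramp => //; rewrite ltr_rat.
- move=> a b ab; have ab' : ratr a < ratr b :> R by rewrite ltr_rat.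
  have [L [K hLK]] := ramp_smooth ab'.
  have shift := expected_mean_shift Q01 p_ge0 Q_le p_to0 eta_p hLK.
  (* A third each for the random fluctuation, the removal of the mean and the convergence of the
     centered means. *)
  apply/cvgrPdist_le => e e0; have e3 : 0 < e / 3 by rewrite divr_gt0.
  pose m := Num.bound (e / 3)^-1.
  have me : m.+1%:R^-1 <= e / 3.
    rewrite -[leRHS]invrK lef_pV2 ?posrE ?invr_gt0 //; apply: ltW.
    by apply: lt_trans (archi_boundP _) _; rewrite ?invr_ge0 ?ltW // ltr_nat.
  near=> n.
  have h1 : ~ dev (a, b, m) n (configuration (X n) w).
    by near: n; exact: (hw (pickle (a, b, m)) (a, b, m) (pickleK _) ab).
  have h2 : `|0 - (expected_mean Q eta n (ramp (ratr a) (ratr b)) -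
       centered_mean Q eta n (ramp (ratr a) (ratr b)))| <= e / 3.
    by near: n; move/cvgrPdist_le : shift; exact.
  have h3 : `|G a b - centered_mean Q eta n (ramp (ratr a) (ratr b))| <= e / 3.
    by near: n; have /cvgrPdist_le := hG a b ab; exact.
  move/negP: h1; rewrite /dev /= -ltNge => h1.
  have {}h1 := le_trans (ltW h1) me.
  have -> : eigsum (ramp (ratr a) (ratr b)) (eta n *: adjacency (X n) w) / n%:R =
      spectral_mean eta (ramp (ratr a) (ratr b)) (configuration (X n) w).
    by rewrite /spectral_mean (adjacency_configuration (X_sbm n)).
  by move: h1 h2 h3; rewrite !ler_norml; lra.
Unshelve. all: by end_near. Qed.
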